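(* Let $G$ be a finite group and $X$ a smooth $G$-manifold. Then $$\sum_{n\ge0}e(X^n,G_n)\,q^n=\prod_{r=1}^{\infty}(1-q^r)^{-e(X,G)},$$ where $e(\cdot,\cdot)$ is the orbifold Euler characteristic and $G_n=G\sim S_n$ is the wreath product acting on $X^n$.
   Context: For a finite group $\Gamma$ acting on a smooth manifold $Y$, the orbifold Euler characteristic is $e(Y,\Gamma)=\frac1{|\Gamma|}\sum_{g_1g_2=g_2g_1}e(Y^{g_1,g_2})$, the sum over pairs of commuting elements of $\Gamma$, where $Y^{g_1,g_2}$ is the common fixed point set and $e(\cdot)$ is the usual Euler characteristic; equivalently $e(Y,\Gamma)=\sum_{[g]\in\Gamma_*}e(Y^g/Z_\Gamma(g))$, where $\Gamma_*$ is the set of conjugacy classes and $Z_\Gamma(g)$ the centralizer. All Euler characteristics occurring are assumed to be defined (finite-dimensional total homology). $G_n$ is the semidirect product of $G^n$ and $S_n$ with multiplication $(g,s)(h,t)=(g\cdot s(h),st)$, where $s(g_1,\dots,g_n)=(g_{s^{-1}(1)},\dots,g_{s^{-1}(n)})$; it acts on $X^n$ by $((g_1,\dots,g_n),s).(x_1,\dots,x_n)=(g_1x_{s^{-1}(1)},\dots,g_nx_{s^{-1}(n)})$. $G_0$ is trivial and $X^0$ is a point. *)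

(* Defs.v *)
From HB Require Import structures.
From mathcomp Require Import all_boot all_order all_algebra all_fingroup.
From mathcomp Require Import all_classical all_reals all_analysis.
From mathcomp.multinomials Require Import freeg.
Import numFieldNormedType.Exports.
Import Order.TTheory GRing.Theory Num.Theory.

Set Implicit Arguments.
Unset Strict Implicit.
Unset Printing Implicit Defensive.

Local Open Scope classical_set_scope.
Local Open Scope ring_scope.

Section SmoothMaps.
Context {R : realType} {m n : nat}.
Implicit Types (f : 'rV[R]_m -> 'rV[R]_n) (U : set 'rV[R]_m).

(* Class [C^k] on an open set [U], through iterated partial derivatives along
   the canonical basis; the values of [f] outside [U] are irrelevant. *)
Fixpoint Ck_on (k : nat) U f : Prop :=
  (forall x, U x -> {for x, continuous f}) /\
  if k is k'.+1 then
    forall i : 'I_m,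
      (forall x, U x -> derivable f x (delta_mx 0 i)) /\
      Ck_on k' U ('D_(delta_mx 0 i) f)
  else True.

Definition smooth_on U f := forall k, Ck_on k U f.

End SmoothMaps.

(* [chart_inv] is only meaningful on the image of [chart_dom]; when [X] is
   empty there is no chart, and the empty atlas does the job. *)
Record chart (R : realType) (d : nat) (X : topologicalType) := Chart {
  chart_dom : set X;
  chart_fun : X -> 'rV[R]_d;
  chart_inv : 'rV[R]_d -> X;
  chart_dom_open : open chart_dom;
  chart_img_open : open (chart_fun @` chart_dom);
  chart_funK : forall x, chart_dom x -> chart_inv (chart_fun x) = x;
  chart_fun_cont : {within chart_dom, continuous chart_fun};
  chart_inv_cont : {within chart_fun @` chart_dom, continuous chart_inv}
}.

Definition smooth_in_charts (R : realType) (d d' : nat) (X X' : topologicalType)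
    (f : X -> X') (c : chart R d X) (c' : chart R d' X') : Prop :=
  smooth_on (chart_fun c @` (chart_dom c `&` f @^-1` chart_dom c'))
            (chart_fun c' \o f \o chart_inv c).

(* The atlas need not be maximal. *)
Record smoothManifold (R : realType) (d : nat) := SmoothManifold {
  manifold_sort :> topologicalType;
  atlas : set (chart R d manifold_sort);
  manifold_hausdorff : hausdorff_space manifold_sort;
  manifold_second_countable : @second_countable manifold_sort;
  atlas_cover : forall x, exists2 c, atlas c & chart_dom c x;
  atlas_compat : forall c c', atlas c -> atlas c' -> smooth_in_charts id c c'
}.

Definition smooth_map (R : realType) (d d' : nat) (X : smoothManifold R d)
    (X' : smoothManifold R d') (f : X -> X') : Prop :=
  continuous f /\
  forall c c', atlas c -> atlas c' -> smooth_in_charts f c c'.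

Section StandardSimplex.
Context {R : realType}.

Definition simplex_set (n : nat) : set 'rV[R]_n.+1 :=
  [set x | (forall i, 0 <= x 0 i) /\ \sum_i x 0 i = 1].
Arguments simplex_set n : clear implicits.

Definition simplex (n : nat) : topologicalType := set_type (simplex_set n).

(* The [i]-th face inclusion inserts a zero at coordinate [i]. *)
Definition face_row (n : nat) (i : 'I_n.+2) (x : 'rV[R]_n.+1) : 'rV[R]_n.+2 :=
  \row_j (if unlift i j is Some k then x 0 k else 0).

Lemma face_row_in (n : nat) (i : 'I_n.+2) (x : simplex n) :
  face_row i (set_val x) \in simplex_set n.+1.
Proof.
have [x0 x1] : simplex_set n (set_val x) by exact: set_valP.
rewrite inE; split=> [j|].
  by rewrite mxE; case: unliftP => // k _; exact: x0.
rewrite (bigD1_ord i) //= mxE unlift_none add0r -x1.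
by apply: eq_bigr => k _; rewrite mxE liftK.
Qed.

Definition face_fun (n : nat) (i : 'I_n.+2) (x : simplex n) : simplex n.+1 :=
  SigSub (face_row_in i x).

Lemma face_row_cont (n : nat) (i : 'I_n.+2) : continuous (@face_row n i).
Proof.
move=> x A [P Pnbhs PA].
exists (fun r k => P r (fintype.lift i k)) => [r k|y Py].
  by have := Pnbhs r (fintype.lift i k); rewrite mxE liftK (ord1 r).
apply: PA => r j; rewrite mxE; case: unliftP => [k ->|jE].
  by have := Py r k; rewrite (ord1 r).
apply: nbhs_singleton; have := Pnbhs r j.
by rewrite mxE {1}jE unlift_none.
Qed.

Lemma face_fun_cont (n : nat) (i : 'I_n.+2) : continuous (@face_fun n i).
Proof.
apply: continuous_comp_initial => x.
have -> : set_val \o face_fun i = face_row i \o set_val by [].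
by apply: continuous_comp; [exact: initial_continuous|exact: face_row_cont].
Qed.

HB.instance Definition _ (n : nat) (i : 'I_n.+2) :=
  @isContinuous.Build (simplex n) (simplex n.+1) (@face_fun n i)
    (@face_fun_cont n i).

End StandardSimplex.

Section Homology.
Context (R : realType) (Y : topologicalType).

Definition singular (n : nat) := continuousType (@simplex R n) Y.

Definition chain (n : nat) := {freeg (singular n) / rat}.

Definition face (n : nat) (i : 'I_n.+2) (s : singular n.+1) : singular n :=
  s \o face_fun i.

Definition boundary (n : nat) : chain n -> chain n.-1 :=
  if n is n'.+1 return chain n -> chain n.-1 then
    fglift (fun s : singular n'.+1 =>
      \sum_(i < n'.+2) (-1) ^+ i *: (<< face i s >> : chain n'))
  else fun=> 0.

(* The classes of the cycles [b] form a basis of [H_n(Y; Q) = Z_n / B_n]. *)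
Definition homology_basis (n k : nat) (b : 'I_k -> chain n) : Prop :=
  [/\ forall i, boundary (b i) = 0,
      forall z, boundary z = 0 ->
        exists (a : 'I_k -> rat) (w : chain n.+1),
          z = \sum_i a i *: b i + boundary w
    & forall (a : 'I_k -> rat) (w : chain n.+1),
        \sum_i a i *: b i = boundary w -> forall i, a i = 0].

Definition homology_dim (n k : nat) : Prop :=
  exists b : 'I_k -> chain n, homology_basis b.

Definition finite_homology : Prop :=
  (forall n, exists k, homology_dim n k) /\
  (exists N, forall n, (N <= n)%N -> homology_dim n 0).

(* Junk value [0] if [H_n(Y; Q)] is infinite-dimensional. *)
Definition betti (n : nat) : nat := xget 0%N [set k | homology_dim n k].

(* A sum of finite support as soon as [finite_homology] holds, and the junk
   value [0] if the support is infinite. *)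
Definition euler_char : int :=
  \sum_(n \in [set: nat]) (-1) ^+ n * (betti n)%:Z.

End Homology.

Record left_action (gT : finGroupType) (T : Type) := LeftAction {
  lact :> gT -> T -> T;
  lact1 : forall x, lact 1%g x = x;
  lactM : forall g h x, lact (g * h)%g x = lact g (lact h x)
}.

Definition common_fixed (gT : finGroupType) (T : Type) (to : left_action gT T)
    (g h : gT) : set T :=
  [set x | to g x = x /\ to h x = x].
Arguments common_fixed {gT T} to g h.

Definition fixed_space (gT : finGroupType) (Y : topologicalType)
    (to : left_action gT Y) (g h : gT) : topologicalType :=
  set_type (common_fixed to g h).

Definition orbifold_euler (R : realType) (gT : finGroupType)
    (Y : topologicalType) (to : left_action gT Y) : rat :=
  (#|gT|%:R)^-1 *
  \sum_(g : gT) \sum_(h : gT | (g * h == h * g)%g)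
    (euler_char R (fixed_space to g h))%:~R.

Definition wreath (gT : finGroupType) (n : nat) : Type :=
  ({ffun 'I_n -> gT} * 'S_n)%type.

HB.instance Definition _ (gT : finGroupType) (n : nat) :=
  Finite.on (wreath gT n).

Section Wreath.
Context {gT : finGroupType} {n : nat}.
Implicit Types a b c : wreath gT n.

Definition wreath_one : wreath gT n := ([ffun=> 1%g], 1%g).

(* [(g, s) (h, t) = (g . s(h), s o t)]; the product [t * s] of permutations in
   MathComp is the composite [s o t]. *)
Definition wreath_mul a b : wreath gT n :=
  ([ffun i => a.1 i * b.1 ((a.2)^-1 i)]%g, (b.2 * a.2)%g).

Definition wreath_inv a : wreath gT n :=
  ([ffun i => (a.1 (a.2 i))^-1]%g, (a.2)^-1%g).

Lemma wreath_mulA : associative wreath_mul.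
Proof.
move=> a b c; congr pair; last by rewrite /= mulgA.
by apply/ffunP => i; rewrite !ffunE /= mulgA invMg permM.
Qed.

Lemma wreath_mul1 : left_id wreath_one wreath_mul.
Proof.
move=> [g s]; congr pair; last by rewrite /= mulg1.
by apply/ffunP => i; rewrite !ffunE /= mul1g invg1 perm1.
Qed.

Lemma wreath_mulV : left_inverse wreath_one wreath_inv wreath_mul.
Proof.
move=> a; congr pair; last by rewrite /= mulgV.
by apply/ffunP => i; rewrite !ffunE /= invgK mulVg.
Qed.

HB.instance Definition _ := Finite_isGroup.Build (wreath gT n)
  wreath_mulA wreath_mul1 wreath_mulV.

End Wreath.

Section WreathAction.
Context {gT : finGroupType} {X : topologicalType} (to : left_action gT X).
Context (n : nat).

Definition wreath_act (a : wreath gT n) (x : {ptws 'I_n -> X}) :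
    {ptws 'I_n -> X} :=
  fun i => to (a.1 i) (x ((a.2)^-1%g i)).

Lemma wreath_act1 x : wreath_act 1%g x = x.
Proof. by apply/funext => i; rewrite /wreath_act ffunE lact1 invg1 perm1. Qed.

Lemma wreath_actM a b x :
  wreath_act (a * b)%g x = wreath_act a (wreath_act b x).
Proof.
by apply/funext => i; rewrite /wreath_act ffunE lactM /= invMg permM.
Qed.

Definition wreath_action : left_action (wreath gT n) {ptws 'I_n -> X} :=
  LeftAction wreath_act1 wreath_actM.

End WreathAction.

Definition fps := nat -> rat.

Definition fps_one : fps := fun n => (n == 0%N)%:R.

Definition fps_mul (f g : fps) : fps :=
  fun n => \sum_(i < n.+1) f i * g (n - i)%N.

(* [p] is the [q]-adic limit of the partial products of [F 1, F 2, ...]. *)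
Definition fps_infinite_prod (F : nat -> fps) (p : fps) : Prop :=
  forall n, exists M, forall m, (M <= m)%N ->
    (\big[fps_mul/fps_one]_(1 <= r < m.+1) F r) n = p n.

Definition gbinom (a : rat) (k : nat) : rat :=
  (\prod_(i < k) (a - i%:R)) / (k`!)%:R.

(* The binomial series [(1 - q^r)^a = \sum_k (-1)^k binom(a, k) q^(r k)] for
   [r > 0]. The exponent is rational because [orbifold_euler], being defined
   with a division by the order of the group, is a rational number; for an
   integer exponent this is the usual power of [1 - q^r]. *)
Definition one_minus_qr_pow (r : nat) (a : rat) : fps :=
  fun n => if (r %| n)%N then (-1) ^+ (n %/ r) * gbinom a (n %/ r) else 0.

(* Main.v *)
(* A commuting pair of elements of the wreath product [G_n] is a pair of
   commuting permutations of [n] points with [G]-valued labels, and its fixed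
   set in [X^n] is the product over the orbits of the fixed sets of the
   restricted pairs. Up to a change of labels, an orbit is a twisted torus with
   parameters [d, m >= 1] and [0 <= j < d] carrying one commuting pair [(g, h)]
   of [G], and its fixed set is then a copy of the common fixed set of [g] and
   [h] in [X]. Since Euler characteristics are multiplicative (the Kunneth
   theorem for rational singular homology, proved with the Alexander-Whitney map
   and acyclic models), splitting off the orbit of one point gives, for [E n =
   e(X^n, G_n)] and [e = e(X, G)],
     [n * E n = \sum_(d, m >= 1, d m <= n) d * e * E (n - d m)].
   The logarithmic derivative of the infinite product yields the same
   recurrence. *)

(* Finiteness of homology is assumed only for the sets fixed by commuting pairs of [G], while the
   recurrence multiplies Euler characteristics of fixed sets in powers of [X]. As [euler_char] is
   total with junk values, the argument runs on the relation [has_euler], which carries a finite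
   basis of homology and passes to homeomorphic spaces and to products; splitting off orbits then
   gives it for every fixed set that occurs. The Kunneth theorem is obtained for simplicial sets
   whose operators need not be monotone. Each simplex then receives a characteristic map from one
   infinite simplex, which is contractible, and the method of acyclic models only asks that the cone
   of the Alexander-Whitney map be acyclic there; no inverse shuffle map is constructed. The weights
   of the recurrence come from counting labelled pairs by the orbit of a marked point: with
   [k = d m] there are [n ^_ k] injections of the torus, [d] twists [j], and [|G| ^ (k - 1)] gauges
   trivial at the base point for each commuting pair of [G]. Division by [|G| ^ n n!] leaves
   [d * e * E (n - k)]; the factor [n] on the other side is the choice of the marked point. *)
Require Import Defs.
From HB Require Import structures.
From mathcomp Require Import all_boot all_order all_algebra all_fingroup.
From mathcomp Require Import all_classical all_reals all_analysis.
From mathcomp Require Import ring zify.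
From mathcomp.multinomials Require Import freeg.
Import numFieldNormedType.Exports.
Import Order.TTheory GRing.Theory Num.Theory.

Set Implicit Arguments.
Unset Strict Implicit.
Unset Printing Implicit Defensive.

Local Open Scope ring_scope.

(** * Free rational modules and quasi-isomorphisms *)

(* An alias of [{freeg K / rat}] whose module structure is stated over [rat] itself. *)
Definition chains (K : choiceType) : Type := {freeg K / rat}.
HB.instance Definition _ K := Choice.copy (chains K) {freeg K / rat}.
HB.instance Definition _ K := GRing.Zmodule.copy (chains K) {freeg K / rat}.
HB.instance Definition _ K := @GRing.Zmodule_isLmodule.Build rat (chains K) _
    (@fgscaleA _ _) (@fgscale1r _ _) (@fgscaleDr _ _) (@fgscaleDl _ _).
Notation "''V' K" := (chains K) (at level 8, K at level 2, format "''V' K").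

Section FreeModules.
Variables (K : choiceType).

Definition gen (x : K) : 'V K := << x >>.

Definition cf (x : K) (c : 'V K) : rat := coeff x c.

Lemma cf_is_linear x : scalar (cf x).
Proof. by move=> k a b; rewrite /cf [LHS]coeffD [X in X + _]coeffZ. Qed.

HB.instance Definition _ x := GRing.isLinear.Build _ _ _ _ (cf x) (cf_is_linear x).

Lemma cf_gen (x y : K) : cf y (gen x) = (x == y)%:R.
Proof. by rewrite /cf coeffU mul1r. Qed.

Lemma gen_ext (a b : 'V K) : (forall x, cf x a = cf x b) -> a = b.
Proof. by move=> H; apply/eqP/freeg_eqP. Qed.

Lemma genZ k x : k *: gen x = << k *g x >> :> 'V K.
Proof. by apply: gen_ext => y; rewrite linearZ /= cf_gen /cf coeffU. Qed.

Lemma gen_sum (c : 'V K) : c = \sum_(x <- dom c) cf x c *: gen x.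
Proof. by rewrite -[LHS]freeg_sumE; apply: eq_bigr => x _; rewrite genZ. Qed.

Lemma gen_ind1 (Q : 'V K -> Prop) : Q 0 ->
  (forall k x c, Q c -> Q (k *: gen x + c)) -> forall c, Q c.
Proof.
by move=> Q0 QD; elim/freeg_ind_dom0 => // k x D _ _ /(QD k x); rewrite genZ.
Qed.

Section Lift.
Variables (M : lmodType rat).

Definition lin (f : K -> M) : 'V K -> M := fglift f.

Lemma lin_is_linear f : linear (lin f).
Proof.
have linD (a b : 'V K) : lin f (a + b) = lin f a + lin f b.
  have addf : zmod_morphism (lin f) by exact: (lift_is_additive f).
  pose g := GRing.isZmodMorphism.Build _ _ (lin f) addf.
  pose F : {additive 'V K -> M} := HB.pack (lin f) g.
  by have /= := raddfD F a b.
have lin0 : lin f 0 = 0 by apply: (addrI (lin f 0)); rewrite -linD !addr0.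
have linZ k x : lin f (k *: gen x) = k *: f x by rewrite genZ /lin liftU.
move=> k a b; rewrite linD; congr (_ + _).
elim/gen_ind1: a => [|c x a IH]; first by rewrite scaler0 lin0 scaler0.
by rewrite scalerDr !linD scalerDr IH scalerA !linZ scalerA.
Qed.

HB.instance Definition _ f := GRing.isLinear.Build _ _ _ _ (lin f) (lin_is_linear f).

Lemma lin_gen f x : lin f (gen x) = f x.
Proof. by rewrite /lin /gen liftU scale1r. Qed.
End Lift.

Definition supp (P : pred K) (c : 'V K) := forall x, cf x c != 0 -> P x.

Lemma supp_ind (P : pred K) (Q : 'V K -> Prop) :
  Q 0 -> (forall k a b, Q a -> Q b -> Q (k *: a + b)) ->
  (forall x, P x -> Q (gen x)) -> forall c, supp P c -> Q c.
Proof.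
move=> Q0 QD Qg c Pc; rewrite (gen_sum c) big_seq.
elim/big_ind: _ => // [a b Qa Qb|x].
  by rewrite -[a]scale1r; apply: QD.
rewrite mem_dom => xc; rewrite -[_ *: _]addr0; apply: QD => //.
exact: Qg (Pc _ xc).
Qed.

Lemma lin_eqP (M : lmodType rat) (P : pred K) (F G : {linear 'V K -> M}) :
  (forall x, P x -> F (gen x) = G (gen x)) -> forall c, supp P c -> F c = G c.
Proof.
move=> FG; apply: (@supp_ind P (fun c => F c = G c)) => //; first by rewrite !linear0.
by move=> k a b Fa Fb; rewrite !linearP Fa Fb.
Qed.

End FreeModules.

Section Support.
Variable K : choiceType.
Implicit Types (P : pred K) (c : 'V K).

Lemma supp0 P : supp P 0.
Proof. by move=> x; rewrite linear0 eqxx. Qed.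

Lemma suppD P a b : supp P a -> supp P b -> supp P (a + b).
Proof.
move=> Pa Pb x; rewrite linearD /= => /eqP nz.
have [a0|/Pa//] := eqVneq (cf x a) 0.
by apply: Pb; apply/eqP => b0; apply: nz; rewrite a0 b0 addr0.
Qed.

Lemma suppZ P k c : supp P c -> supp P (k *: c).
Proof. by move=> Pc x; rewrite linearZ /= mulf_eq0 negb_or => /andP[_ /Pc]. Qed.

Lemma suppN P c : supp P c -> supp P (- c).
Proof. by rewrite -scaleN1r; apply: suppZ. Qed.

Lemma suppB P a b : supp P a -> supp P b -> supp P (a - b).
Proof. by move=> Pa Pb; apply/suppD/suppN. Qed.

Lemma supp_gen P x : P x -> supp P (gen x).
Proof. by move=> Px y; rewrite cf_gen; have [<-|_] := eqVneq x y; rewrite ?eqxx. Qed.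

Lemma supp_sum P (I : Type) (r : seq I) (Q : pred I) (F : I -> 'V K) :
  (forall i, Q i -> supp P (F i)) -> supp P (\sum_(i <- r | Q i) F i).
Proof.
move=> H; elim/big_ind: _ => //; [exact: supp0 | exact: suppD].
Qed.

Lemma suppW P P' c : (forall x, P x -> P' x) -> supp P c -> supp P' c.
Proof. by move=> PP' Pc x /Pc/PP'. Qed.

Lemma supp_bound (dg : K -> nat) c : exists N, supp (fun x => dg x < N)%N c.
Proof.
exists (\max_(x <- dom c) dg x).+1 => x; rewrite /cf -mem_dom => xc.
by rewrite ltnS (bigD1_seq x) ?uniq_dom //= leq_maxl.
Qed.

Lemma supp_pred0 P c : (forall x, ~~ P x) -> supp P c -> c = 0.
Proof.
move=> P0 Pc; apply: gen_ext => x; rewrite linear0; apply/eqP.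
by apply: contraT => /Pc; rewrite (negbTE (P0 x)).
Qed.

End Support.

Lemma supp_lin (K L : choiceType) (P : pred K) (Q : pred L)
    (F : {linear 'V K -> 'V L}) c :
  (forall x, P x -> supp Q (F (gen x))) -> supp P c -> supp Q (F c).
Proof.
move=> PQ; apply: (@supp_ind _ P (fun c => supp Q (F c))) => //.
  by rewrite linear0; apply: supp0.
by move=> k a b Qa Qb; rewrite linearP; apply/suppD => //; apply: suppZ.
Qed.

Section QuasiIso.

(* Bijectivity on homology: [a = 0] gives surjectivity, the first component of
   the conclusion gives injectivity, and the whole is acyclicity of the cone. *)
Definition qiso (A B : lmodType rat) (dA : A -> A) (dB : B -> B) (f : A -> B) :=
  forall a b, dA a = 0 -> f a = dB b ->
  exists a' b', a = dA a' /\ b = f a' + dB b'.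

Section Two.
Variables (A B : lmodType rat) (dA : {linear A -> A}) (dB : {linear B -> B}).
Variable f : {linear A -> B}.
Hypothesis ddA : forall a, dA (dA a) = 0.
Hypothesis fd : forall a, f (dA a) = dB (f a).

Lemma qiso_inj a b : qiso dA dB f -> dA a = 0 -> f a = dB b -> exists a', a = dA a'.
Proof. by move=> qf da fa; have [a' [b' [-> _]]] := qf a b da fa; exists a'. Qed.

Lemma qiso_surj b : qiso dA dB f -> dB b = 0 ->
  exists a b', dA a = 0 /\ b = f a + dB b'.
Proof.
move=> qf db; have [||a [b' [a0 ->]]] := qf 0 b; rewrite ?linear0 //.
by exists a, b'.
Qed.

Lemma qiso_intro :
  (forall a b, dA a = 0 -> f a = dB b -> exists a', a = dA a') ->
  (forall b, dB b = 0 -> exists a b', dA a = 0 /\ b = f a + dB b') ->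
  qiso dA dB f.
Proof.
move=> inj surj a b da fa; have [a0 a0E] := inj a b da fa.
have [|a1 [b1 [a10 bE]]] := surj (b - f a0).
  by rewrite linearB -fd -a0E fa subrr.
exists (a0 + a1), b1; rewrite !linearD a10 addr0; split=> //.
by rewrite -addrA -bE addrC subrK.
Qed.
End Two.

Lemma qiso_comp (A B C : lmodType rat) (dA : {linear A -> A})
    (dB : {linear B -> B}) (dC : {linear C -> C})
    (f : {linear A -> B}) (g : {linear B -> C}) :
  (forall a, dA (dA a) = 0) ->
  (forall a, f (dA a) = dB (f a)) -> (forall a, g (dB a) = dC (g a)) ->
  qiso dA dB f -> qiso dB dC g -> qiso dA dC (g \o f).
Proof.
move=> ddA fd gd qf qg a c da /= gfa.
have [||b [c' [fb cE]]] := qg (f a) c => //; first by rewrite -fd da linear0.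
have [a' [b' [aE bE]]] := qf a b da fb.
exists a', (g b' + c'); split=> //.
by rewrite cE bE /= !linearD gd addrA.
Qed.

(** Two-out-of-three, in the direction that compares complexes through augmentations [g] and
    [g \o f] already known to be quasi-isomorphisms. *)
Lemma qiso_cancel (A B C : lmodType rat) (dA : {linear A -> A})
    (dB : {linear B -> B}) (dC : {linear C -> C})
    (f : {linear A -> B}) (g : {linear B -> C}) :
  (forall a, f (dA a) = dB (f a)) -> (forall a, g (dB a) = dC (g a)) ->
  qiso dB dC g -> qiso dA dC (g \o f) -> qiso dA dB f.
Proof.
move=> fd gd qg qgf; apply: qiso_intro => // [a b da fa|b db].
  apply: (@qiso_inj _ _ dA dC (g \o f) a (g b) qgf da).
  by rewrite /= fa gd.
have [|a [c [da /= gbE]]] := @qiso_surj _ _ dA dC (g \o f) (g b) qgf.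
  by rewrite -gd db linear0.
have [||b' bE] := @qiso_inj _ _ dB dC g (b - f a) c qg.
- by rewrite linearB db -fd da linear0 subrr.
- by rewrite linearB gbE /= addrC addKr.
by exists a, b'; rewrite -bE addrC subrK.
Qed.

(** The homotopy [H] contracts the complex onto the line spanned by [pt], on which [e] is an
    isomorphism; [rat^o] is a complex with zero differential. *)
Lemma qiso_aug (A : lmodType rat) (d H : {linear A -> A})
    (e : {linear A -> rat^o}) (pt : A) :
  (forall c, d (H c) + H (d c) = c - e c *: pt) -> d pt = 0 -> e pt = 1 ->
  (forall c, e (d c) = 0) -> qiso d (fun _ : rat^o => 0) e.
Proof.
(* [H a] bounds [a] because [e a = 0]; the multiple of [pt] is a cycle and corrects the augmentation
   of the witness to [b]. *)
move=> hH dpt ept ed a b da ea; exists (H a + (b - e (H a)) *: pt), 0; split.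
  rewrite linearD linearZ /= dpt scaler0 addr0.
  by have := hH a; rewrite da linear0 ea scale0r subr0 addr0.
rewrite linearD linearZ /= ept addr0 /GRing.scale /= mulr1.
by rewrite addrC subrK.
Qed.

End QuasiIso.

(** * Based complexes and their tensor products *)

(** All degrees share one free module and one endomorphism, and the grading is a function on the
    basis. No type depends on a degree, at the price of cutting chains into homogeneous parts when
    needed. *)
Record cplx := Cplx {
  cells :> choiceType;
  deg : cells -> nat;
  bd : cells -> 'V cells;
  bd_deg : forall x, supp (fun y => (deg y).+1 == deg x) (bd x);
  bd_bd : forall x, lin bd (bd x) = 0
}.

Definition diff (C : cplx) : 'V C -> 'V C := lin (@bd C).
Arguments diff C c : clear implicits.

HB.instance Definition _ (C : cplx) :=
  GRing.isLinear.Build _ _ _ _ (diff C) (lin_is_linear (@bd C)).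

Lemma diff_gen (C : cplx) (x : C) : diff C (gen x) = bd x.
Proof. exact: lin_gen. Qed.

Lemma diff_diff (C : cplx) (c : 'V C) : diff C (diff C c) = 0.
Proof.
elim/gen_ind1: c => [|k x c IH]; first by rewrite !linear0.
by rewrite !linearP /= IH diff_gen [diff C (bd x)]bd_bd scaler0 addr0.
Qed.

Lemma chain_map (C C' : cplx) (f : C -> 'V C') :
  (forall x, lin f (bd x) = diff C' (f x)) ->
  forall c, lin f (diff C c) = diff C' (lin f c).
Proof.
move=> H c; elim/gen_ind1: c => [|k x c IH]; first by rewrite !linear0.
by rewrite !linearP /= IH diff_gen H lin_gen.
Qed.

Section TensorProduct.
Variables K M : choiceType.

Definition tens (a : 'V K) (b : 'V M) : 'V (K * M)%type :=
  lin (fun y => lin (fun x => gen (x, y)) a) b.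

Lemma tens_is_linear a : linear (tens a).
Proof. exact: linearP. Qed.

HB.instance Definition _ a :=
  GRing.isLinear.Build _ _ _ _ (tens a) (tens_is_linear a).

Lemma tensPl k a a' b : tens (k *: a + a') b = k *: tens a b + tens a' b.
Proof.
elim/gen_ind1: b => [|l y b IH]; first by rewrite !linear0 addr0.
rewrite !linearP /= IH /tens !lin_gen linearP /= !scalerDr !scalerA addrACA.
by rewrite (mulrC l k).
Qed.

Lemma tens0l b : tens 0 b = 0.
Proof.
elim/gen_ind1: b => [|k y b IH]; first by rewrite linear0.
by rewrite linearP /= IH /tens lin_gen linear0 scaler0 addr0.
Qed.

Lemma tensDl a a' b : tens (a + a') b = tens a b + tens a' b.
Proof. by have := tensPl 1 a a' b; rewrite !scale1r. Qed.

Lemma tensZl k a b : tens (k *: a) b = k *: tens a b.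
Proof. by have := tensPl k a 0 b; rewrite tens0l !addr0. Qed.

Lemma tens_gen x y : tens (gen x) (gen y) = gen (x, y).
Proof. by rewrite /tens !lin_gen. Qed.

Lemma tens_suml (I : Type) (r : seq I) (P : pred I) (F : I -> 'V K) b :
  tens (\sum_(i <- r | P i) F i) b = \sum_(i <- r | P i) tens (F i) b.
Proof.
elim/big_rec2: _ => [|i u v _ <-]; first by rewrite tens0l.
by rewrite tensDl.
Qed.

Lemma supp_tens (P : pred K) (Q : pred M) (R : pred (K * M)) a b :
  (forall x y, P x -> Q y -> R (x, y)) -> supp P a -> supp Q b -> supp R (tens a b).
Proof.
move=> PQR Pa; apply: supp_lin => y Qy.
rewrite /= /tens lin_gen; move: Pa; apply: supp_lin => x Px.
by rewrite /= lin_gen; apply/supp_gen/PQR.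
Qed.

(* [lslice x c] and [rslice y c] are the coefficients of [c] along [x (x) _]
   and [_ (x) y]. *)
Definition lslice (x : K) : 'V (K * M)%type -> 'V M :=
  lin (fun p => if p.1 == x then gen p.2 else 0).
Definition rslice (y : M) : 'V (K * M)%type -> 'V K :=
  lin (fun p => if p.2 == y then gen p.1 else 0).

HB.instance Definition _ x :=
  GRing.isLinear.Build _ _ _ _ (lslice x)
    (lin_is_linear (fun p => if p.1 == x then gen p.2 else 0)).
HB.instance Definition _ y :=
  GRing.isLinear.Build _ _ _ _ (rslice y)
    (lin_is_linear (fun p => if p.2 == y then gen p.1 else 0)).

Lemma cf_lslice x y c : cf y (lslice x c) = cf (x, y) c.
Proof.
elim/gen_ind1: c => [|k p c IH]; first by rewrite !linear0.
rewrite !linearP /= IH /lslice lin_gen; congr (_ * _ + _); rewrite cf_gen.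
by case: p => u v /=; rewrite xpair_eqE; case: eqP; rewrite ?linear0 ?cf_gen.
Qed.

Lemma cf_rslice x y c : cf x (rslice y c) = cf (x, y) c.
Proof.
elim/gen_ind1: c => [|k p c IH]; first by rewrite !linear0.
rewrite !linearP /= IH /rslice lin_gen; congr (_ * _ + _); rewrite cf_gen.
case: p => u v /=; rewrite xpair_eqE andbC.
by case: eqP; rewrite ?linear0 ?cf_gen.
Qed.

Lemma lslice_tens x a b : lslice x (tens a b) = cf x a *: b.
Proof.
apply: gen_ext => y; rewrite cf_lslice linearZ /=.
elim/gen_ind1: b => [|k v b IH]; first by rewrite !linear0 mulr0.
rewrite !linearP /= IH mulrDr; congr (_ + _); rewrite mulrCA; congr (_ * _) => {IH}.
elim/gen_ind1: a => [|l u a IH]; first by rewrite tens0l !linear0 mul0r.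
rewrite tensPl !linearP /= IH mulrDl; congr (_ + _); rewrite -mulrA; congr (_ * _).
by rewrite tens_gen !cf_gen xpair_eqE; case: eqP; rewrite ?mul1r ?mul0r.
Qed.

Lemma rslice_tens y a b : rslice y (tens a b) = cf y b *: a.
Proof.
apply: gen_ext => x; rewrite cf_rslice linearZ /= mulrC.
by rewrite -cf_lslice lslice_tens linearZ.
Qed.

End TensorProduct.

Definition tmap (K K' M M' : choiceType) (f : K -> 'V K') (g : M -> 'V M') :
    'V (K * M)%type -> 'V (K' * M')%type := lin (fun p => tens (f p.1) (g p.2)).

HB.instance Definition _ K K' M M' f g :=
  GRing.isLinear.Build _ _ _ _ (@tmap K K' M M' f g)
    (lin_is_linear (fun p => tens (f p.1) (g p.2))).

Lemma tmap_tens (K K' M M' : choiceType) (f : K -> 'V K') (g : M -> 'V M') a b :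
  tmap f g (tens a b) = tens (lin f a) (lin g b).
Proof.
elim/gen_ind1: b => [|k v b IH]; first by rewrite !linear0.
rewrite !linearP /= IH /=; congr (_ *: _ + _) => {IH}.
elim/gen_ind1: a => [|l u a IH]; first by rewrite tens0l linear0 linear0 tens0l.
by rewrite tensPl !linearP /= tensPl IH tens_gen /tmap !lin_gen.
Qed.

Section TensorComplex.
Variables C C' : cplx.

Definition tbd (p : C * C') : 'V (C * C')%type :=
  tens (bd p.1) (gen p.2) + (-1) ^+ deg p.1 *: tens (gen p.1) (bd p.2).

Definition tdeg (p : C * C') : nat := (deg p.1 + deg p.2)%N.

Lemma tbd_deg p : supp (fun q => (tdeg q).+1 == tdeg p) (tbd p).
Proof.
case: p => x y; apply: suppD.
  apply: (supp_tens (P := fun x' => (deg x').+1 == deg x) (Q := pred1 y)).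
  - by move=> x' y' /eqP E /eqP ->; rewrite /tdeg /= -E.
  - exact: bd_deg.
  - by apply: supp_gen => /=.
apply: suppZ.
apply: (supp_tens (P := pred1 x) (Q := fun y' => (deg y').+1 == deg y)).
- by move=> x' y' /eqP -> /eqP E; rewrite /tdeg /= -E addnS.
- by apply: supp_gen => /=.
- exact: bd_deg.
Qed.

Lemma tbd_tens (n : nat) a b : supp (fun x => deg x == n) a ->
  lin tbd (tens a b) =
    tens (diff C a) b + (-1) ^+ n *: tens a (diff C' b).
Proof.
move=> an; elim/gen_ind1: b => [|k y b IH].
  by rewrite !linear0 ?scaler0 ?addr0.
rewrite !linearP /= IH [RHS]addrACA -scalerDr; congr (_ *: _ + _) => {IH}.
move: an; apply: (@supp_ind _ _ (fun a => lin tbd (tens a (gen y)) = _)).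
- by rewrite !(linear0, tens0l) ?scaler0 ?addr0.
- move=> l a1 a2 E1 E2; rewrite linearP !tensPl linearP /= E1 E2.
  rewrite [in LHS]scalerDr [LHS]addrACA; congr (_ + _).
  by rewrite scalerDr !scalerA mulrC.
- by move=> x /eqP <-; rewrite tens_gen lin_gen !diff_gen.
Qed.

Lemma tbd_tbd p : lin tbd (tbd p) = 0.
Proof.
case: p => x y; rewrite /tbd linearD linearZ /=.
have [n xn] : exists n, deg x = n by exists (deg x).
rewrite (@tbd_tens n (gen x)); last by apply: supp_gen; rewrite xn.
case: n xn => [|n] xn.
  have -> : bd x = 0.
    by apply: supp_pred0 (@bd_deg _ x) => y'; rewrite xn.
  rewrite tens0l linear0 add0r diff_gen.
  have -> : bd x = 0.
    by apply: supp_pred0 (@bd_deg _ x) => y'; rewrite xn.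
  by rewrite tens0l [diff _ (bd y)]bd_bd linear0 ?scaler0 ?addr0 ?scaler0.
rewrite (@tbd_tens n (bd x)); last first.
  by apply: suppW (@bd_deg _ x) => x'; rewrite xn.
rewrite !diff_gen [diff _ (bd x)]bd_bd [diff _ (bd y)]bd_bd linear0 tens0l.
by rewrite scaler0 addr0 add0r -scalerDl xn exprS mulN1r subrr scale0r.
Qed.

Definition tcplx : cplx := Cplx tbd_deg tbd_tbd.

Lemma diff_tens (n : nat) a b : supp (fun x => deg x == n) a ->
  diff tcplx (tens a b) = tens (diff C a) b + (-1) ^+ n *: tens a (diff C' b).
Proof. exact: tbd_tens. Qed.

End TensorComplex.

Lemma lin_genK (K : choiceType) (c : 'V K) : lin (@gen K) c = c.
Proof.
by elim/gen_ind1: c => [|k x c IH]; rewrite ?linear0 // linearP /= IH lin_gen.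
Qed.

Lemma supp_gen1 (K : choiceType) (x : K) : supp (pred1 x) (gen x).
Proof. by apply: supp_gen => /=. Qed.

Section TensorQuasiIso.
Variables (C J M : cplx) (f : J -> 'V M).
Hypothesis fd : forall x, lin f (bd x) = diff M (f x).

Let F := tmap (@gen C) f.
Let dJ := diff (tcplx C J).
Let dM := diff (tcplx C M).

Lemma tmapr_chain c : tmap (@gen C) f (diff (tcplx C J) c) =
  diff (tcplx C M) (tmap (@gen C) f c).
Proof.
elim/gen_ind1: c => [|k [x y] c IH]; first by rewrite !linear0.
rewrite !linearP /= IH; congr (_ *: _ + _).
rewrite diff_gen /= /tbd linearD linearZ /= !tmap_tens !lin_genK lin_gen fd.
rewrite /tmap lin_gen (@diff_tens _ _ (deg x)) ?diff_gen //.
exact: supp_gen.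
Qed.

Lemma lslice_tmapr x c : lslice x (tmap (@gen C) f c) = lin f (lslice x c).
Proof.
elim/gen_ind1: c => [|k [u v] c IH]; first by rewrite !linear0.
rewrite !linearP /= IH /tmap /lslice !lin_gen -/(lslice _ _) lslice_tens cf_gen /=.
by case: eqP => _; rewrite ?scale1r ?scale0r ?linear0 ?lin_gen.
Qed.

(** When no cell of [c] has first degree above that of [x], the boundary of the first factor cannot
    produce [x]; only the second factor contributes, with its Koszul sign. *)
Lemma lslice_diff (D : cplx) (x : C) (c : 'V (C * D)%type) :
  supp (fun p => deg p.1 < (deg x).+1)%N c ->
  lslice x (diff (tcplx C D) c) = (-1) ^+ deg x *: diff D (lslice x c).
Proof.
apply: (@supp_ind _ _ (fun c => _ = _ *: diff D (lslice x c))).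
- by rewrite !linear0.
- by move=> k a b Ea Eb; rewrite !linearP /= Ea Eb.
move=> [u v] /=; rewrite ltnS => ux.
rewrite diff_gen /= /tbd linearD linearZ /= !lslice_tens /= cf_gen.
have -> : cf x (bd u) = 0.
  apply/eqP; apply: contraT => /(@bd_deg _ u) /eqP E.
  by rewrite -E ltnn in ux.
rewrite scale0r add0r /lslice lin_gen /=.
by case: eqP => [<-|_]; rewrite ?scale1r ?scale0r ?linear0 ?diff_gen.
Qed.

Lemma supp_lslice (D : cplx) N (c : 'V (C * D)%type) :
  supp (fun p => deg p.1 < N.+1)%N c ->
  (forall x : C, deg x = N -> lslice x c = 0) -> supp (fun p => deg p.1 < N)%N c.
Proof.
move=> cN sc [x y] nz /=; have /= := cN _ nz; rewrite ltnS leq_eqVlt.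
case/orP=> // /eqP xN; move: nz.
by rewrite -cf_lslice sc // linear0 eqxx.
Qed.

(** Induction on a common bound [N] for the first degrees in [a] and [b]. On the slices of top
    degree only the differentials of [J] and [M] act, so [qf] solves each of them; subtracting the
    solutions lowers the bound. *)
Lemma tens_qisor : qiso (diff J) (diff M) (lin f) ->
  qiso (diff (tcplx C J)) (diff (tcplx C M)) (tmap (@gen C) f).
Proof.
move=> qf a b.
have [Na aN] := supp_bound (fun p => deg p.1) a.
have [Nb bN] := supp_bound (fun p => deg p.1) b.
have {aN} : supp (fun p => deg p.1 < maxn Na Nb)%N a.
  by apply: suppW aN => x h; rewrite (leq_trans h) // leq_maxl.
have {bN} : supp (fun p => deg p.1 < maxn Na Nb)%N b.
  by apply: suppW bN => x h; rewrite (leq_trans h) // leq_maxr.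
elim: (maxn Na Nb) a b => [|N IH] a b bN aN da fab.
  exists 0, 0; rewrite !linear0 addr0; split.
    by apply: supp_pred0 aN.
  by apply: supp_pred0 bN.
have /choice [w wP] (x : C) : exists w : 'V J * 'V M, deg x = N ->
    lslice x a = diff J w.1 /\
    (-1) ^+ N *: lslice x b = lin f w.1 + diff M w.2.
  have [xN|] := eqVneq (deg x) N; last by move=> ne; exists (0, 0) => /eqP; rewrite (negbTE ne).
  have [||a' [b' [aE bE]]] := qf (lslice x a) ((-1) ^+ N *: lslice x b).
  - have := lslice_diff (x := x) (c := a); rewrite xN da linear0 => /(_ aN).
    by move/esym/eqP; rewrite scaler_eq0 signr_eq0 => /eqP.
  - by rewrite -lslice_tmapr fab lslice_diff xN // linearZ.
  by exists (a', b') => _.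
pose X := [seq x <- undup ([seq p.1 | p <- dom a] ++ [seq p.1 | p <- dom b]) | deg x == N].
have XN x : x \in X -> deg x = N by rewrite mem_filter => /andP[/eqP].
have sX (D : cplx) (g : C -> 'V D) x : deg x = N ->
    lslice x (\sum_(u <- X) tens (gen u) (g u)) = if x \in X then g x else 0.
  move=> xN; rewrite linear_sum /=.
  under eq_bigr => u _ do rewrite lslice_tens cf_gen.
  case: ifP => xX.
    rewrite (bigD1_seq x) ?filter_uniq ?undup_uniq //= eqxx scale1r big1 ?addr0 //.
    by move=> u /negbTE ->; rewrite scale0r.
  rewrite big_seq big1 // => u uX; case: eqP => [ux|]; last by rewrite scale0r.
  by rewrite -ux uX in xX.
(* The sign undoes the one of [lslice_diff]: the slices of [dJ A] in degree [N] are then exactly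
   those of [a], and those of [F A + dM B] are those of [b]. *)
pose A := (-1) ^+ N *: \sum_(u <- X) tens (gen u) (w u).1.
pose B := \sum_(u <- X) tens (gen u) (w u).2.
have NX (D : cplx) (g : C -> 'V D) :
    supp (fun p => deg p.1 < N.+1)%N (\sum_(u <- X) tens (gen u) (g u)).
  rewrite big_seq; apply: supp_sum => u /XN uN.
  apply: (supp_tens (P := pred1 u) (Q := predT)) => //; last exact: supp_gen1.
  by move=> x y /eqP -> _ /=; rewrite uN.
have AN : supp (fun p => deg p.1 < N.+1)%N A by apply/suppZ/NX.
have BN : supp (fun p => deg p.1 < N.+1)%N B by apply/NX.
have Nd (D : cplx) (c : 'V (C * D)%type) : supp (fun p => deg p.1 < N.+1)%N c ->
    supp (fun p => deg p.1 < N.+1)%N (diff (tcplx C D) c).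
  apply: supp_lin => -[x y] /= xN; rewrite lin_gen /=; apply: suppD; [|apply: suppZ].
    apply: (supp_tens (P := fun z => (deg z).+1 == deg x) (Q := predT)) => //.
      by move=> z t /eqP zx _ /=; rewrite (leq_trans _ xN) // ltnS -zx.
    exact: bd_deg.
  apply: (supp_tens (P := pred1 x) (Q := predT)) => //; last exact: supp_gen1.
  by move=> z t /eqP -> _.
have NF c : supp (fun p => deg p.1 < N.+1)%N c ->
    supp (fun p => deg p.1 < N.+1)%N (tmap (@gen C) f c).
  apply: supp_lin => -[x y] /= xN; rewrite /tmap lin_gen /=.
  apply: (supp_tens (P := pred1 x) (Q := predT)) => //; last exact: supp_gen1.
  by move=> z t /eqP -> _.
have out (D : cplx) (c : 'V (C * D)%type) x :
    {subset [seq p.1 | p <- dom c] <= [seq p.1 | p <- dom a] ++ [seq p.1 | p <- dom b]} ->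
    deg x = N -> x \notin X -> lslice x c = 0.
  move=> sub xN; rewrite mem_filter xN eqxx mem_undup /= => xX.
  apply: gen_ext => y; rewrite cf_lslice linear0; apply/eqP.
  apply: contraNT xX => nz; apply: sub; apply/mapP; exists (x, y) => //.
  by rewrite mem_dom.
have [||||a' [b' [aE bE]]] := IH (a - dJ A) (b - F A - dM B).
- apply: supp_lslice => [|x xN].
    apply: suppB; [apply: suppB => // |]; [exact: NF | exact: Nd].
  rewrite !linearB /= lslice_tmapr lslice_diff ?xN // {1}/A /B !linearZ /= !sX //.
  case: ifPn => [xX|xX]; last first.
    rewrite !linear0 !(subr0, addr0) (out _ b) // => p; rewrite mem_cat => ->.
    by rewrite orbT.
  have [_ /(congr1 (fun c => (-1) ^+ N *: c))] := wP x xN.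
  rewrite scalerA -expr2 sqrr_sign scale1r scalerDr => ->; rewrite !scalerN.
  by rewrite [LHS]addrAC addrK subrr.
- apply: supp_lslice => [|x xN].
    by apply: suppB => //; exact: Nd.
  rewrite !linearB /= lslice_diff ?xN // {1}/A !linearZ /= !sX //.
  rewrite scalerA -expr2 sqrr_sign scale1r.
  case: ifPn => [xX|xX]; last first.
    rewrite !linear0 !(subr0, addr0) (out _ a) // => p; rewrite mem_cat => ->.
    by [].
  by have [-> _] := wP x xN; rewrite subrr.
- by rewrite linearB /= da diff_diff subrr.
- rewrite !linearB /= fab -tmapr_chain diff_diff subr0.
  by rewrite /dJ tmapr_chain.
exists (a' + A), (b' + B); split.
  by rewrite linearD /= -aE subrK.
rewrite !linearD /=.
have -> : F a' + F A + (dM b' + dM B) = F a' + dM b' + (F A + dM B) by rewrite addrACA.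
by rewrite -bE [F A + _]addrC [RHS]addrA !subrK.
Qed.

End TensorQuasiIso.

Section ZeroComplex.
Variables (J : finType) (dg : J -> nat).

Lemma zbd_deg x : supp (fun y => (dg y).+1 == dg x) (0 : 'V J).
Proof. exact: supp0. Qed.

Lemma zbd_bd (x : J) : lin (fun=> 0 : 'V J) (0 : 'V J) = 0.
Proof. exact: linear0. Qed.

(** Plays the role of the homology itself: a chain map out of it is a family of cycles, and it is a
    quasi-isomorphism when their classes form a basis. *)
Definition zcplx : cplx := Cplx zbd_deg zbd_bd.

Lemma diff_zcplx c : diff zcplx c = 0.
Proof.
elim/gen_ind1: c => [|k x c IH]; first by rewrite linear0.
by rewrite linearP /= IH diff_gen addr0 scaler0.
Qed.

End ZeroComplex.

Lemma diff_tens_zcplx (C : cplx) (J : finType) (dg : J -> nat) (a : 'V C) (y : J) :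
  diff (tcplx C (zcplx dg)) (tens a (gen y)) = tens (diff C a) (gen y).
Proof.
elim/gen_ind1: a => [|k x a IH]; first by rewrite !(linear0, tens0l).
rewrite tensPl !linearP /= tensPl IH; congr (_ *: _ + _).
by rewrite tens_gen !diff_gen /= /tbd linear0 scaler0 addr0.
Qed.

Lemma rslice_diff_zcplx (C : cplx) (J : finType) (dg : J -> nat)
    (c : 'V (C * J)%type) (y : J) :
  rslice y (diff (tcplx C (zcplx dg)) c) = diff C (rslice y c).
Proof.
elim/gen_ind1: c => [|k [x z] c IH]; first by rewrite !linear0.
rewrite !linearP /= IH; congr (_ *: _ + _).
rewrite -tens_gen diff_tens_zcplx !rslice_tens cf_gen.
by case: eqP; rewrite ?scale1r ?scale0r ?linear0.
Qed.

Lemma rslice_sum (K : choiceType) (J : finType) (c : 'V (K * J)%type) :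
  c = \sum_(y : J) tens (rslice y c) (gen y).
Proof.
apply: gen_ext => -[x y]; rewrite -cf_rslice -[in RHS]cf_rslice; congr cf.
rewrite linear_sum /= (bigD1 y) //= rslice_tens cf_gen eqxx scale1r big1 ?addr0 //.
by move=> z /negbTE; rewrite rslice_tens cf_gen => ->; rewrite scale0r.
Qed.

(** With a finite basis and no differential on the right, the tensor product is a finite direct sum
    of copies of the left complex, and the problem is solved in each right slice. *)
Lemma tens_qisol (C : cplx) (J J' : finType) (dg : J -> nat) (dg' : J' -> nat)
    (z : J -> 'V C) :
  qiso (diff (zcplx dg)) (diff C) (lin z) ->
  qiso (diff (tcplx (zcplx dg) (zcplx dg'))) (diff (tcplx C (zcplx dg')))
    (tmap z (@gen J')).
Proof.
move=> qz a b da fab.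
have Fs y c : rslice y (tmap z (@gen J') c) = lin z (rslice y c).
  elim/gen_ind1: c => [|k [u v] c IH]; first by rewrite !linear0.
  rewrite !linearP /= IH -tens_gen tmap_tens !rslice_tens lin_genK !lin_gen cf_gen.
  by case: eqP; rewrite ?scale1r ?scale0r ?linear0 ?lin_gen.
have /choice [w wP] (y : J') : exists w : 'V J * 'V C,
    rslice y a = diff (zcplx dg) w.1 /\ rslice y b = lin z w.1 + diff C w.2.
  have [||a' [b' ab']] := qz (rslice y a) (rslice y b).
  - by rewrite diff_zcplx.
  - by rewrite -Fs fab rslice_diff_zcplx.
  by exists (a', b').
exists (\sum_y tens (w y).1 (gen y)), (\sum_y tens (w y).2 (gen y)).
rewrite [in LHS](rslice_sum a) [in X in _ /\ X = _](rslice_sum b) !linear_sum -big_split /=.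
split; apply: eq_bigr => y _; have [Ea Eb] := wP y.
  by rewrite Ea diff_tens_zcplx.
by rewrite tmap_tens lin_gen diff_tens_zcplx Eb tensDl.
Qed.

(* Simplicial sets with arbitrary, not necessarily monotone, operators: [act x n f]
   is the pullback of [x] along the map of vertices [f : [0..n] -> [0..dim x]],
   extended by junk values to [nat]. *)
Record symset := SymSet {
  simplices :> choiceType;
  dim : simplices -> nat;
  act : simplices -> nat -> (nat -> nat) -> simplices;
  dim_act : forall x n f, dim (act x n f) = n;
  act_ext : forall x n f g, (forall i, (i <= n)%N -> f i = g i) -> act x n f = act x n g;
  act_id : forall x, act x (dim x) id = x;
  act_comp : forall x n f m g, (forall i, (i <= n)%N -> (f i <= dim x)%N) ->
    (forall i, (i <= m)%N -> (g i <= n)%N) ->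
    act (act x n f) m g = act x m (f \o g)
}.

(* The cancellation behind [d d = 0]. *)
Lemma simplicial_sum0 (M : lmodType rat) n (F : nat -> nat -> M) :
  (forall i j, (j < i <= n)%N -> (j < n)%N -> F i j = - F j i.-1) ->
  \sum_(i < n.+1) \sum_(j < n) F i j = 0.
Proof.
move=> HF.
under eq_bigr => i _ do rewrite (bigID (fun j : 'I_n => (j < i)%N)) /=.
rewrite big_split /=.
have -> : \sum_(i < n.+1) \sum_(j < n | ~~ (j < i)%N) F i j =
    \sum_(i < n) \sum_(j < n | (i <= j)%N) F i j.
  rewrite big_ord_recr /= [X in _ + X]big1 ?addr0; last first.
    by move=> j; rewrite -leqNgt leqNgt ltn_ord.
  by apply: eq_bigr => i _; apply: eq_bigl => j; rewrite -leqNgt.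
rewrite (exchange_big_dep predT) //=.
rewrite -big_split /= big1 // => j _.
rewrite [in X in X + _]big_mkcond big_ord_recl /= add0r -big_mkcond /=.
rewrite -[X in X + _]opprK -sumrN -[X in _ + X]opprK -opprD.
apply/eqP; rewrite oppr_eq0 -sumrN -big_split /= big1 // => i; rewrite ltnS => ji.
by rewrite HF ?lift0 ?ltnS //= ?opprK ?subrr // ji ltn_ord.
Qed.

Section SymSet.
Variable S : symset.

Definition sbd (x : S) : 'V S :=
  if dim x is n.+1 then \sum_(i < n.+2) (-1) ^+ i *: gen (act x n (bump i)) else 0.

Lemma sbdS (x : S) n : dim x = n.+1 ->
  sbd x = \sum_(i < n.+2) (-1) ^+ i *: gen (act x n (bump i)).
Proof. by rewrite /sbd => ->. Qed.

Lemma sbd0 (x : S) : dim x = 0%N -> sbd x = 0.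
Proof. by rewrite /sbd => ->. Qed.

Lemma sbd_deg x : supp (fun y => (dim y).+1 == dim x) (sbd x).
Proof.
rewrite /sbd; case E: (dim x) => [|n]; first exact: supp0.
by apply: supp_sum => i _; apply/suppZ/supp_gen; rewrite dim_act.
Qed.

Lemma bump_le h n i : (i <= n)%N -> (bump h i <= n.+1)%N.
Proof. by rewrite /bump; case: leqP; lia. Qed.

Lemma sbd_sbd x : lin sbd (sbd x) = 0.
Proof.
case E: (dim x) => [|[|n]]; first by rewrite sbd0 // linear0.
  rewrite (sbdS E) linear_sum big1 // => i _.
  by rewrite linearZ /= lin_gen sbd0 ?scaler0 // dim_act.
rewrite (sbdS E) linear_sum /=.
pose F i j : 'V S := (-1) ^+ (i + j) *: gen (act x n (bump i \o bump j)).
rewrite -[RHS](@simplicial_sum0 _ n.+2 F); last first.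
  move=> i j /andP[ji iN] jN; rewrite /F -scaleNr; congr (_ *: gen _).
    by case: i ji {iN} => // i _; rewrite addSn exprS mulN1r addnC.
  apply: act_ext => k kn /=; rewrite /bump; lia.
apply: eq_bigr => i _; rewrite linearZ /= lin_gen (@sbdS _ n) ?dim_act //.
rewrite scaler_sumr; apply: eq_bigr => j _; rewrite scalerA -exprD.
congr (_ *: gen _); apply: act_comp => k kn; first by rewrite E; apply: bump_le.
exact: bump_le.
Qed.

Definition scplx : cplx := Cplx sbd_deg sbd_sbd.

End SymSet.

(** * The Alexander-Whitney map and the Kunneth theorem *)

Section ProductSymSet.
Variables S T : symset.

Definition psimplices := {p : S * T | dim p.1 == dim p.2}.
HB.instance Definition _ := Choice.on psimplices.

Definition pdim (x : psimplices) := dim (val x).1.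

Lemma pact_subproof (x : psimplices) n f :
  dim (act (val x).1 n f, act (val x).2 n f).1 ==
  dim (act (val x).1 n f, act (val x).2 n f).2.
Proof. by rewrite /= !dim_act. Qed.

Definition pact (x : psimplices) n f : psimplices :=
  exist (fun p : S * T => is_true (dim p.1 == dim p.2)) _ (pact_subproof x n f).

Lemma pdimr x : dim (val x).2 = pdim x.
Proof. by rewrite -(eqP (valP x)). Qed.

Lemma pdim_act x n f : pdim (pact x n f) = n.
Proof. exact: dim_act. Qed.

Lemma pact_ext x n f g :
  (forall i, (i <= n)%N -> f i = g i) -> pact x n f = pact x n g.
Proof. by move=> fg; apply: val_inj; congr pair; apply: act_ext. Qed.

Lemma pact_id x : pact x (pdim x) id = x.
Proof.
apply: val_inj => /=; rewrite act_id -(pdimr x) act_id.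
by case: x => -[].
Qed.

Lemma pact_comp x n f m g : (forall i, (i <= n)%N -> (f i <= pdim x)%N) ->
  (forall i, (i <= m)%N -> (g i <= n)%N) ->
  pact (pact x n f) m g = pact x m (f \o g).
Proof.
by move=> fx gn; apply: val_inj; congr pair; apply: act_comp; rewrite //= pdimr.
Qed.

Definition pset : symset := SymSet pdim_act pact_ext pact_id pact_comp.

(* Alexander-Whitney: front face of the first factor, back face of the second. *)
Definition aw (x : pset) : 'V (S * T)%type :=
  \sum_(p < (pdim x).+1)
    gen (act (val x).1 p id, act (val x).2 (pdim x - p) (addn p)).

Lemma aw_deg (x : pset) :
  supp (fun q => @tdeg (scplx S) (scplx T) q == dim x) (aw x).
Proof.
apply: supp_sum => p _; apply: supp_gen; rewrite /tdeg /= !dim_act.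
by apply/eqP; rewrite subnKC // -ltnS.
Qed.

(** Each side lists the ways to cut [x] at a vertex and omit a vertex. The boundary of the tensor
    has two further terms for each cut, omitting the last vertex of the front face of dimension
    [p.+1] or the first vertex of the back face that starts at [p]; both are [E0], with opposite
    signs. *)
Lemma aw_chain (x : pset) :
  lin aw (sbd x) = diff (tcplx (scplx S) (scplx T)) (aw x).
Proof.
have x2 := pdimr x.
rewrite [in RHS]/aw linear_sum /=.
under [RHS]eq_bigr => p _ do rewrite diff_gen /= /tbd /=.
case E: (pdim x) => [|n].
  rewrite (sbd0 (x := x)) // linear0 big_ord1 /=.
  by rewrite !sbd0 ?dim_act // tens0l linear0 scaler0 addr0.
rewrite (sbdS (x := x) E) linear_sum /=.
(* The [p]-th term of [aw] of the [i]-th face: vertex [i] is missing from the front part when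
   [i <= p] and from the back part otherwise. *)
pose G i p : 'V (S * T)%type :=
  gen (act (val x).1 p (bump i), act (val x).2 (n - p) (bump i \o addn p)).
transitivity (\sum_(p < n.+1) \sum_(i < n.+2) (-1) ^+ i *: G i p).
  rewrite exchange_big /=; apply: eq_bigr => i _.
  rewrite linearZ /= lin_gen -scaler_sumr; congr (_ *: _).
  rewrite /aw pdim_act; apply: eq_bigr => p _; congr gen; congr pair.
    apply: (act_comp (x := (val x).1)) => // k kn.
      by rewrite -[dim _]/(pdim x) E; apply: bump_le.
    by rewrite (leq_trans kn) // -ltnS.
  apply: (act_comp (x := (val x).2)) => // k kn.
    by rewrite x2 E; apply: bump_le.
  by move: (ltn_ord p) kn; lia.
(* The two sums are aligned by a shift of the first one: front faces of dimension [p.+1] are grouped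
   with back faces starting at [p]. The terms left over at the ends contain the boundary of a
   vertex. *)
rewrite big_split /= [X in _ = X + _]big_ord_recl /= sbd0 ?dim_act // tens0l add0r.
rewrite [X in _ = _ + X]big_ord_recr /= (@sbd0 _ (act _ (n.+1 - n.+1) _)); last first.
  by rewrite dim_act subnn.
rewrite linear0 scaler0 addr0 -big_split /=; apply: eq_bigr => p _.
have pn : (p <= n)%N by rewrite -ltnS.
change (bump 0 p) with p.+1; rewrite (@sbdS _ _ p) ?dim_act // (@sbdS _ _ (n - p)); last first.
  by rewrite dim_act subSn.
rewrite tens_suml [X in _ = X + _]big_ord_recr /= tensZl tens_gen linear_sum.
rewrite [X in _ = _ + _ *: X]big_ord_recl /=.
rewrite linearZ /= tens_gen expr0 scale1r scalerDr.
pose E0 : 'V (S * T)%type := gen (act (val x).1 p id, act (val x).2 (n - p) (addn p.+1)).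
have -> : gen (act (act (val x).1 p.+1 id) p (bump p.+1),
    act (val x).2 (n.+1 - p.+1) (addn p.+1)) = E0.
  rewrite subSS; congr gen; congr pair.
  rewrite act_comp; first by apply: act_ext => k kp; rewrite /= /bump leqNgt ltnS kp.
    by move=> k kp; rewrite -[dim _]/(pdim x) E; lia.
  by move=> k kp; apply: bump_le.
have -> : gen (act (val x).1 p id,
    act (act (val x).2 (n.+1 - p) (addn p)) (n - p) (bump 0)) = E0.
  congr gen; congr pair; rewrite act_comp.
  - by apply: act_ext => k _ /=; rewrite /bump /= addnA addn1.
  - by move=> k; rewrite x2 E; lia.
  - by move=> k; rewrite /bump /=; lia.
rewrite -[RHS]addrA [X in _ = _ + X]addrA -scalerDl exprS mulN1r addNr scale0r add0r.
rewrite -[LHS](big_mkord predT (fun i => (-1) ^+ i *: G i p)).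
rewrite (@big_cat_nat _ _ _ p.+1) //=; last by lia.
rewrite big_mkord; congr (_ + _).
  apply: eq_bigr => i _; rewrite tensZl tens_gen; congr (_ *: gen _).
  rewrite /G subSS; congr pair.
    rewrite act_comp //; last by move=> k kp; apply: bump_le.
    by move=> k kp; rewrite -[dim _]/(pdim x) E; lia.
  by apply: act_ext => k _ /=; rewrite /bump; move: (ltn_ord i); lia.
rewrite -{1}[p.+1]add0n big_addn.
have -> : (n.+2 - p.+1 = (n - p).+1)%N by lia.
rewrite big_mkord scaler_sumr; apply: eq_bigr => i _.
rewrite linearZ /= tens_gen scalerA -exprD /lift /bump /=.
congr (_ ^+ _ *: gen _); first by lia.
rewrite /G; congr pair.
  by apply: act_ext => k kp; rewrite /bump; lia.
rewrite act_comp.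
- by apply: act_ext => k _ /=; rewrite /bump; lia.
- by move=> k; rewrite x2 E; lia.
- by move=> k kn; rewrite subSn //; apply: bump_le.
Qed.

End ProductSymSet.

(** * Mapping cones *)

Section Cone.
Variables (C C' : cplx) (f : C -> 'V C').
Hypothesis f_deg : forall x, supp (fun y => deg y == deg x) (f x).
Hypothesis fd : forall x, lin f (bd x) = diff C' (f x).

Let cone := (C + C')%type.
Definition inlV : 'V C -> 'V cone := lin (fun x => gen (inl x)).
Definition inrV : 'V C' -> 'V cone := lin (fun x => gen (inr x)).
HB.instance Definition _ := GRing.isLinear.Build _ _ _ _ inlV (lin_is_linear (fun x => gen (inl x))).
HB.instance Definition _ := GRing.isLinear.Build _ _ _ _ inrV (lin_is_linear (fun x => gen (inr x))).

Definition cone_deg (x : cone) : nat :=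
  match x with inl x => (deg x).+1 | inr y => deg y end.

Definition cone_bd (x : cone) : 'V cone :=
  match x with
  | inl x => inlV (bd x) + inrV (f x)
  | inr y => - inrV (bd y)
  end.

Lemma cone_bd_deg x : supp (fun y => (cone_deg y).+1 == cone_deg x) (cone_bd x).
Proof.
case: x => x /=; last first.
  apply/suppN/(supp_lin _ (@bd_deg _ x)) => y /eqP yx.
  by rewrite /= ?/inlV ?/inrV lin_gen; apply: supp_gen; rewrite /= yx.
apply: suppD.
  apply/(supp_lin _ (@bd_deg _ x)) => y /eqP yx.
  by rewrite /= ?/inlV ?/inrV lin_gen; apply: supp_gen; rewrite /= yx.
apply/(supp_lin _ (@f_deg x)) => y /eqP yx.
by rewrite /= ?/inlV ?/inrV lin_gen; apply: supp_gen; rewrite /= yx.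
Qed.

Lemma cone_bdl a : lin cone_bd (inlV a) = inlV (diff C a) + inrV (lin f a).
Proof.
elim/gen_ind1: a => [|k x a IH]; first by rewrite !linear0 addr0.
rewrite !linearP /= IH [RHS]addrACA -scalerDr; congr (_ *: _ + _).
by rewrite /inlV !lin_gen diff_gen.
Qed.

Lemma cone_bdr b : lin cone_bd (inrV b) = - inrV (diff C' b).
Proof.
elim/gen_ind1: b => [|k x b IH]; first by rewrite !linear0 ?oppr0.
rewrite !linearP /= IH; congr (_ *: _ + _).
by rewrite /inrV !lin_gen diff_gen.
Qed.

Lemma cone_bd_bd x : lin cone_bd (cone_bd x) = 0.
Proof.
case: x => x; rewrite /= ?linearD ?linearN /=; last first.
  by rewrite cone_bdr [diff _ _]bd_bd linear0 !oppr0.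
by rewrite cone_bdl cone_bdr [diff _ _]bd_bd linear0 add0r fd subrr.
Qed.

Definition cone_cplx : cplx := Cplx cone_bd_deg cone_bd_bd.

Let pl (x : cone) : 'V C := if x is inl y then gen y else 0.
Let pr (x : cone) : 'V C' := if x is inr y then gen y else 0.

Lemma cone_inj a b a' b' : inlV a + inrV b = inlV a' + inrV b' -> a = a' /\ b = b'.
Proof.
have prll c : lin pl (inlV c) = c.
  by elim/gen_ind1: c => [|k x c IH]; rewrite ?linear0 // !linearP /= IH /inlV !lin_gen.
have prrr c : lin pr (inrV c) = c.
  by elim/gen_ind1: c => [|k x c IH]; rewrite ?linear0 // !linearP /= IH /inrV !lin_gen.
have prlr c : lin pl (inrV c) = 0.
  elim/gen_ind1: c => [|k x c IH]; rewrite ?linear0 // !linearP /= IH /inrV !lin_gen.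
  by rewrite addr0 scaler0.
have prrl c : lin pr (inlV c) = 0.
  elim/gen_ind1: c => [|k x c IH]; rewrite ?linear0 // !linearP /= IH /inlV !lin_gen.
  by rewrite addr0 scaler0.
move=> E; split.
  have /= := congr1 (lin pl) E.
  by rewrite !linearD /= !prll !prlr !addr0.
have /= := congr1 (lin pr) E.
by rewrite !linearD /= !prrr !prrl !add0r.
Qed.

Lemma cone_split c : exists a b, c = inlV a + inrV b.
Proof.
elim/gen_ind1: c => [|k x c [a [b ->]]]; first by exists 0, 0; rewrite !linear0 addr0.
case: x => x; [exists (k *: gen x + a), b|exists a, (k *: gen x + b)].
  by rewrite linearP /= /inlV lin_gen addrA.
by rewrite linearP /= /inrV lin_gen addrCA.
Qed.

Definition acyclic (D : cplx) := forall c, diff D c = 0 -> exists w, c = diff D w.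

(** A chain [inlV a + inrV b] is a cycle of the cone exactly under the hypotheses of [qiso], and
    bounds [inlV a' + inrV (- b')] exactly under its conclusion. A single contraction of the cone
    thus gives injectivity and surjectivity together. *)
Lemma acyclic_coneP :
  acyclic cone_cplx <-> qiso (diff C) (diff C') (lin f).
Proof.
have dE a b : diff cone_cplx (inlV a + inrV b) =
    inlV (diff C a) + inrV (lin f a - diff C' b).
  rewrite linearD /= -[diff cone_cplx (inlV a)]/(lin cone_bd _) -[diff cone_cplx (inrV b)]/(lin cone_bd _).
  by rewrite cone_bdl cone_bdr linearB /= addrA.
have z0 : 0 = inlV 0 + inrV 0 by rewrite !linear0 addr0.
split=> [ac a b da fab|qf c].
  have [|w] := ac (inlV a + inrV b).
    by rewrite dE da fab subrr !linear0 addr0.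
  have [a' [b' ->]] := cone_split w; rewrite dE => /cone_inj[-> ->].
  by exists a', (- b'); rewrite linearN.
have [a [b ->]] := cone_split c; rewrite dE z0 => /cone_inj[da /eqP].
rewrite subr_eq0 => /eqP fab; have [a' [b' [-> ->]]] := qf a b da fab.
by exists (inlV a' + inrV (- b')); rewrite dE linearN opprK.
Qed.

End Cone.

Definition augf (S : symset) (x : S) : rat^o := (dim x == 0%N)%:R.

Lemma augf_sbd (S : symset) (x : S) : lin (@augf S) (sbd x) = 0.
Proof.
case E: (dim x) => [|[|n]]; first by rewrite sbd0 // linear0.
  rewrite (sbdS E) linear_sum big_ord_recl big_ord1 /= !linearZ /= !lin_gen.
  by rewrite /augf !dim_act expr0 expr1 scale1r scaleN1r subrr.
rewrite (sbdS E) linear_sum big1 // => i _.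
by rewrite linearZ /= lin_gen /augf dim_act scaler0.
Qed.

Lemma augf_diff (S : symset) (c : 'V S) : lin (@augf S) (diff (scplx S) c) = 0.
Proof.
elim/gen_ind1: c => [|k x c IH]; first by rewrite !linear0.
by rewrite !linearP /= IH diff_gen augf_sbd scaler0 addr0.
Qed.

Lemma diff_tens_gen (S T : symset) (x : S) (b : 'V T) :
  diff (tcplx (scplx S) (scplx T)) (tens (gen x) b) =
  tens (sbd x) b + (-1) ^+ dim x *: tens (gen x) (diff (scplx T) b).
Proof.
rewrite (@diff_tens (scplx S) (scplx T) (dim x)) ?diff_gen //.
exact: supp_gen.
Qed.

Definition augf2 (S : symset) (p : S * S) : rat^o := augf p.1 * augf p.2.

Lemma augf2_tens (S : symset) (a b : 'V S) :
  lin (@augf2 S) (tens a b) = lin (@augf S) a * lin (@augf S) b.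
Proof.
elim/gen_ind1: b => [|k y b IH]; first by rewrite !linear0 mulr0.
rewrite !linearP /= IH mulrDr /GRing.scale /= mulrCA; congr (_ * _ + _) => {IH}.
elim/gen_ind1: a => [|k' x a IH]; first by rewrite !(linear0, tens0l) mul0r.
rewrite tensPl !linearP /= IH mulrDl /GRing.scale /= -mulrA; congr (_ * _ + _).
by rewrite tens_gen !lin_gen.
Qed.

Lemma augf2_diff (S : symset) (c : 'V (S * S)%type) :
  lin (@augf2 S) (diff (tcplx (scplx S) (scplx S)) c) = 0.
Proof.
elim/gen_ind1: c => [|k [x y] c IH]; first by rewrite !linear0.
rewrite !linearP /= IH -tens_gen diff_tens_gen [lin (@augf2 S) _]linearD /=.
rewrite [lin (@augf2 S) (_ *: _)]linearZ /= !augf2_tens augf_sbd augf_diff.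
by rewrite mul0r mulr0 !(scaler0, addr0).
Qed.

(** * Contractions from a cone operator *)

Section Coned.
Variables (S : symset) (s : S -> S) (pt : S).
Hypothesis s_dim : forall x, dim (s x) = (dim x).+1.
Hypothesis s_d0 : forall x, act (s x) (dim x) (bump 0) = x.
Hypothesis s_dS : forall x n i, dim x = n.+1 -> (i <= n.+1)%N ->
  act (s x) n.+1 (bump i.+1) = s (act x n (bump i)).
Hypothesis s_pt : forall x, dim x = 0%N -> act (s x) 0 (bump 1) = pt.
Hypothesis pt_dim : dim pt = 0%N.

Local Notation H := (lin (fun x => gen (s x))).

(** Face [0] of [s x] is [x] and face [i.+1] is [s] applied to face [i], so everything else cancels,
    except that a vertex leaves the face [pt], which the augmentation counts. *)
Lemma coned_homotopy c :
  diff (scplx S) (lin (fun x => gen (s x)) c) +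
  lin (fun x => gen (s x)) (diff (scplx S) c) =
  c - lin (@augf S) c *: gen pt.
Proof.
elim/gen_ind1: c => [|k x c IH]; first by rewrite !linear0 addr0 scale0r subr0.
rewrite !linearP /= addrACA -scalerDr IH scalerDl opprD [RHS]addrACA.
congr (_ + _); rewrite -scalerA -scalerBr; congr (_ *: _) => {IH}.
rewrite !lin_gen !diff_gen /= /augf; case E: (dim x) => [|n].
  rewrite (@sbdS _ _ 0) ?s_dim ?E // big_ord_recl big_ord1 /= sbd0 // linear0 addr0.
  rewrite expr0 expr1 scale1r scaleN1r scale1r s_pt //.
  by congr (gen _ - _); rewrite -[RHS]s_d0 E.
rewrite scale0r subr0 (@sbdS _ _ n.+1) ?s_dim ?E // big_ord_recl /= expr0 scale1r.
rewrite (sbdS E) linear_sum /= -addrA -big_split big1 ?addr0 /=.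
  by rewrite -[in RHS](s_d0 x) E.
move=> i _; rewrite linearZ /= lin_gen -s_dS //; last by rewrite -ltnS.
by rewrite exprS mulN1r scaleNr addNr.
Qed.

Lemma coned_qiso :
  qiso (diff (scplx S)) (fun _ : rat^o => 0) (lin (@augf S)).
Proof.
apply: (@qiso_aug _ (diff (scplx S)) (lin (fun x => gen (s x))) (lin (@augf S)) (gen pt)).
- exact: coned_homotopy.
- by rewrite [LHS]lin_gen /= sbd0.
- by apply: etrans (lin_gen _ _) _; rewrite /augf pt_dim.
exact: augf_diff.
Qed.

(** If [P] is the projection [c |-> e(c) pt], the contraction of the tensor square is
    [H (x) 1 + P (x) H]: it deforms the first factor to [pt], and then the second. *)
Lemma coned_qiso2 :
  qiso (diff (tcplx (scplx S) (scplx S))) (fun _ : rat^o => 0) (lin (@augf2 S)).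
Proof.
pose H2f (p : S * S) := gen (s p.1, p.2) + augf p.1 *: gen (pt, s p.2).
have H2t a b : lin H2f (tens a b) = tens (H a) b + lin (@augf S) a *: tens (gen pt) (H b).
  elim/gen_ind1: b => [|k y b IH]; first by rewrite !linear0 ?addr0.
  rewrite !linearP /= IH [RHS]addrACA -scalerDr; congr (_ *: _ + _) => {IH}.
  elim/gen_ind1: a => [|k' x a IH].
    by rewrite !(linear0, tens0l) scale0r addr0.
  rewrite tensPl !linearP /= tensPl IH scalerDl [RHS]addrACA -scalerA -scalerDr.
  by congr (_ *: _ + _); rewrite tens_gen !lin_gen !tens_gen.
have h0 x : H (gen x) = gen (s x) by rewrite lin_gen.
apply: (@qiso_aug _ (diff (tcplx (scplx S) (scplx S))) (lin H2f) (lin (@augf2 S))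
          (tens (gen pt) (gen pt))).
- move=> c; elim/gen_ind1: c => [|k [x y] c IH].
    by rewrite !linear0 addr0 scale0r subr0.
  rewrite !linearP /= addrACA -scalerDr IH scalerDl opprD [RHS]addrACA.
  congr (_ + _); rewrite -scalerA -scalerBr; congr (_ *: _) => {IH}.
  rewrite -tens_gen H2t augf2_tens !h0 diff_tens_gen.
  rewrite linearD linearZ /= !diff_tens_gen s_dim pt_dim.
  rewrite [lin H2f _]linearD /= [lin H2f (_ *: _)]linearZ /= !H2t !diff_gen /= augf_sbd scale0r addr0.
  rewrite (sbd0 pt_dim) tens0l add0r expr0 scale1r !h0 !lin_gen.
  have := coned_homotopy (gen x); have := coned_homotopy (gen y).
  rewrite !lin_gen !diff_gen /= => hy hx.
  have {}hx : sbd (s x) = gen x - augf x *: gen pt - H (sbd x) by rewrite -hx addrK.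
  have {}hy : sbd (s y) = gen y - augf y *: gen pt - H (sbd y) by rewrite -hy addrK.
  rewrite hx hy exprS mulN1r scalerDr.
  rewrite -[in X in tens X (gen y)]scaleN1r -[in X in tens X (gen y)]scaleN1r.
  rewrite !tensDl !tensZl !linearB !linearZ /= !scaleN1r !tens_gen scaleNr.
  (* In positive dimension the augmentation of [x] vanishes; in dimension [0] the Koszul sign is
     [1], as the terms of [P (x) H] require. *)
  rewrite /augf; case: (dim x) => [|n] /=; last first.
    by rewrite !(scale0r, mul0r, addr0) addrACA subrK addNr addr0.
  rewrite expr0 !scale1r mul1r.
  by apply: gen_ext => q; rewrite !(linearD, linearN) /=; ring.
- apply: etrans (diff_tens_gen _ _) _.
  by rewrite diff_gen /= sbd0 // tens0l linear0 scaler0 addr0.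
- by apply: etrans (augf2_tens _ _) _; rewrite lin_gen /augf pt_dim mulr1.
exact: augf2_diff.
Qed.

End Coned.

Record ssmap (S T : symset) := SSMap {
  ssfun :> S -> T;
  ss_dim : forall x, dim (ssfun x) = dim x;
  ss_act : forall x n f, (forall i, (i <= n)%N -> (f i <= dim x)%N) ->
    ssfun (act x n f) = act (ssfun x) n f
}.

Lemma sbd_natural (S T : symset) (phi : ssmap S T) x :
  lin (fun y => gen (phi y)) (sbd x) = sbd (phi x).
Proof.
case E: (dim x) => [|n]; first by rewrite !sbd0 ?linear0 // ss_dim.
rewrite (sbdS E) (@sbdS _ _ n) ?ss_dim // linear_sum; apply: eq_bigr => i _.
rewrite linearZ /= lin_gen ss_act // => k kn; rewrite E; exact: bump_le.
Qed.

Definition awcone (S T : symset) :=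
  @cone_cplx (scplx (pset S T)) (tcplx (scplx S) (scplx T)) (@aw S T)
    (@aw_deg S T) (@aw_chain S T).

Section ConeMap.
Variables (S T S' T' : symset) (phi : ssmap S S') (psi : ssmap T T').

Lemma pmap_subproof (x : pset S T) :
  dim (phi (val x).1, psi (val x).2).1 == dim (phi (val x).1, psi (val x).2).2.
Proof. by rewrite /= !ss_dim; exact: (valP x). Qed.

Definition pmap (x : pset S T) : pset S' T' :=
  exist (fun p : S' * T' => is_true (dim p.1 == dim p.2)) _ (pmap_subproof x).

Lemma pmap_dim x : dim (pmap x) = dim x.
Proof. exact: ss_dim. Qed.

Lemma pmap_act x n f : (forall i, (i <= n)%N -> (f i <= dim x)%N) ->
  pmap (act x n f) = act (pmap x) n f.
Proof.
move=> fx; apply: val_inj; congr pair; apply: ss_act => //.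
by move=> i /fx; rewrite pdimr.
Qed.

Definition pssmap : ssmap (pset S T) (pset S' T') := SSMap pmap_dim pmap_act.

Definition conemap (e : awcone S T) : awcone S' T' :=
  match e with
  | inl x => inl (pmap x)
  | inr p => inr (phi p.1, psi p.2)
  end.

Let pushp (p : S * T) := (phi p.1, psi p.2).

Lemma aw_natural x :
  lin (fun p => gen (pushp p)) (aw x) = aw (pmap x).
Proof.
rewrite /aw linear_sum -[pdim (pmap x)]/(dim (phi (val x).1)) ss_dim.
apply: eq_bigr => p _; rewrite /= lin_gen; congr gen; congr pair => /=.
  by rewrite ss_act // => k kp; rewrite (leq_trans kp) // -ltnS.
rewrite ss_act // => k; rewrite pdimr; by move: (ltn_ord p); lia.
Qed.

Lemma tbd_natural p :
  lin (fun p => gen (pushp p)) (@tbd (scplx S) (scplx T) p) =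
  @tbd (scplx S') (scplx T') (pushp p).
Proof.
have tE c : lin (fun p => gen (pushp p)) c =
    tmap (fun y => gen (phi y)) (fun y => gen (psi y)) c.
  rewrite /tmap; congr (lin _ c); apply/funext => -[u v].
  by rewrite tens_gen.
case: p => x y; rewrite tE /tbd linearD linearZ /= !tmap_tens !lin_gen.
by rewrite !sbd_natural ss_dim.
Qed.

Lemma conemap_natural c :
  lin (fun e => gen (conemap e)) (diff (awcone S T) c) =
  diff (awcone S' T') (lin (fun e => gen (conemap e)) c).
Proof.
apply: (@chain_map (awcone S T) (awcone S' T')) => -[x|p]; rewrite diff_gen /=.
  rewrite linearD /=; congr (_ + _).
    rewrite -[sbd (pmap x)](sbd_natural pssmap).
    elim/gen_ind1: (sbd x) => [|k y a IH]; first by rewrite !linear0.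
    by rewrite !linearP /= IH /inlV !lin_gen.
  rewrite -aw_natural.
  elim/gen_ind1: (aw x) => [|k y a IH]; first by rewrite !linear0.
  by rewrite !linearP /= IH /inrV !lin_gen.
rewrite linearN /= -[@tbd (scplx S') (scplx T') (phi _, _)]tbd_natural; congr (- _).
elim/gen_ind1: (tbd p) => [|k y a IH]; first by rewrite !linear0.
by rewrite !linearP /= IH /inrV !lin_gen.
Qed.

End ConeMap.

(* The simplices of the infinite simplex: nonempty lists of vertices. *)
Section InfiniteSimplex.

Definition dsort : Type := (nat * seq nat)%type.
HB.instance Definition _ := Choice.on dsort.

Definition vert (l : dsort) i : nat := nth l.1 (l.1 :: l.2) i.
Definition ddim (l : dsort) : nat := size l.2.
Definition dact (l : dsort) n (f : nat -> nat) : dsort :=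
  (vert l (f 0%N), mkseq (fun i => vert l (f i.+1)) n).

Lemma vert_dact l n f i : (i <= n)%N -> vert (dact l n f) i = vert l (f i).
Proof. by case: i => // i i_n; rewrite /vert /= nth_mkseq. Qed.

Lemma ddim_dact l n f : ddim (dact l n f) = n.
Proof. by rewrite /ddim size_mkseq. Qed.

Lemma dact_ext l n f g :
  (forall i, (i <= n)%N -> f i = g i) -> dact l n f = dact l n g.
Proof.
move=> fg; rewrite /dact fg //; congr pair; apply/eq_in_map => i.
by rewrite mem_iota => /andP[_ i_n]; rewrite fg.
Qed.

Lemma dact_id l : dact l (ddim l) id = l.
Proof. by case: l => a s; rewrite /dact /ddim /= mkseq_nth. Qed.

Lemma dact_comp l n f m g : (forall i, (i <= n)%N -> (f i <= ddim l)%N) ->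
  (forall i, (i <= m)%N -> (g i <= n)%N) ->
  dact (dact l n f) m g = dact l m (f \o g).
Proof.
move=> _ gn; rewrite /dact -/(dact l n f) vert_dact ?gn //; congr pair.
apply/eq_in_map => i; rewrite mem_iota => /andP[_ i_n].
by rewrite vert_dact ?gn.
Qed.

Definition dset : symset := SymSet ddim_dact dact_ext dact_id dact_comp.

Definition dcone (l : dset) : dset := (0%N, l.1 :: l.2).
Definition dpt : dset := (0%N, [::]).

Lemma dset_ext (l l' : dsort) : ddim l = ddim l' ->
  (forall i, (i <= ddim l)%N -> vert l i = vert l' i) -> l = l'.
Proof.
move=> ll' E; rewrite -[l]dact_id -[l']dact_id -ll' /dact E //; congr pair.
by apply/eq_in_map => i; rewrite mem_iota => /andP[_ i_n]; rewrite E.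
Qed.

Lemma vert_dcone (l : dsort) i : (i <= ddim l)%N -> vert (dcone l) i.+1 = vert l i.
Proof. by move=> il; apply: set_nth_default. Qed.

Lemma dcone_d0 (l : dset) : act (dcone l) (dim l) (bump 0) = l.
Proof.
apply: dset_ext => [|i]; rewrite ddim_dact // => il.
by rewrite vert_dact // vert_dcone.
Qed.

Lemma dcone_dS (l : dset) n i : dim l = n.+1 -> (i <= n.+1)%N ->
  act (dcone l) n.+1 (bump i.+1) = dcone (act l n (bump i)).
Proof.
move=> ln i_n; apply: dset_ext => [|[|k]].
- by rewrite ddim_dact /ddim /= size_mkseq.
- by rewrite vert_dact.
rewrite ddim_dact => kn; rewrite vert_dact // bumpS !vert_dcone.
- by rewrite vert_dact.
- by rewrite ddim_dact.
by rewrite -[ddim l]/(dim l) ln; apply: bump_le.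
Qed.

Lemma dcone_pt (l : dset) : dim l = 0%N -> act (dcone l) 0 (bump 1) = dpt.
Proof. by move=> _; apply: dset_ext => [|[]]. Qed.

Lemma dset_qiso2 :
  qiso (diff (tcplx (scplx dset) (scplx dset))) (fun _ : rat^o => 0) (lin (@augf2 dset)).
Proof. exact: (@coned_qiso2 dset dcone dpt (fun=> erefl) dcone_d0 dcone_dS dcone_pt erefl). Qed.

Lemma pdset_qiso :
  qiso (diff (scplx (pset dset dset))) (fun _ : rat^o => 0) (lin (@augf (pset dset dset))).
Proof.
pose s (x : pset dset dset) : pset dset dset :=
  exist (fun p : dset * dset => is_true (dim p.1 == dim p.2))
    (dcone (val x).1, dcone (val x).2) (valP x).
pose pt : pset dset dset :=
  exist (fun p : dset * dset => is_true (dim p.1 == dim p.2)) (dpt, dpt) isT.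
apply: (@coned_qiso _ s pt) => //.
- move=> x; have e2 := dcone_d0 (val x).2; rewrite pdimr in e2.
  apply: val_inj; rewrite [RHS]surjective_pairing; congr pair => //.
  exact: dcone_d0.
- move=> x n i xn i_n; apply: val_inj; congr pair; apply: dcone_dS => //.
  by rewrite pdimr.
- move=> x x0; apply: val_inj; congr pair; exact: dcone_pt.
Qed.

Lemma augf2_aw (S : symset) (x : pset S S) :
  lin (@augf2 S) (aw x) = @augf (pset S S) x.
Proof.
rewrite /aw linear_sum /=.
under eq_bigr => p _ do rewrite lin_gen /augf2 /augf /= !dim_act.
rewrite /augf /=; case: (pdim x) => [|n]; first by rewrite big_ord1 mulr1.
rewrite big1 // => -[[|p] pn] _ /=; first by rewrite mulr0.
by rewrite mul0r.
Qed.

(** The product and the tensor square of the infinite simplex are both contractible, and [aw]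
    respects their augmentations. *)
Lemma dset_acyclic : acyclic (awcone dset dset).
Proof.
apply/acyclic_coneP.
apply: (@qiso_cancel _ _ rat^o (diff (scplx (pset dset dset)))
  (diff (tcplx (scplx dset) (scplx dset))) (\0 : {linear rat^o -> rat^o})
  (lin (@aw dset dset)) (lin (@augf2 dset))).
- exact/chain_map/aw_chain.
- exact: augf2_diff.
- exact: dset_qiso2.
have -> : lin (@augf2 dset) \o lin (@aw dset dset) = lin (@augf (pset dset dset)).
  apply/funext => c /=; elim/gen_ind1: c => [|k x c IH]; first by rewrite !linear0.
  rewrite !linearP /= IH !lin_gen; congr (_ *: _ + _).
  exact: (@augf2_aw dset x).
exact: pdset_qiso.
Qed.

End InfiniteSimplex.

(** * Characteristic maps and acyclic models *)

Section Push.
Variables (S : symset) (x : S).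

(** The characteristic map of [x], pulling [x] back along an arbitrary list of vertices. Clipping by
    [dim x] keeps the operator legal, so that one infinite simplex serves for all dimensions. *)
Definition spush_fun (l : dset) : S :=
  act x (dim l) (fun i => minn (vert l i) (dim x)).

Lemma spush_dim l : dim (spush_fun l) = dim l.
Proof. exact: dim_act. Qed.

Lemma spush_act (l : dset) n f : (forall i, (i <= n)%N -> (f i <= dim l)%N) ->
  spush_fun (act l n f) = act (spush_fun l) n f.
Proof.
move=> fl; rewrite /spush_fun dim_act act_comp //; last by move=> i _; apply: geq_minr.
by apply: act_ext => i i_n; rewrite vert_dact.
Qed.

Definition spush : ssmap dset S := SSMap spush_dim spush_act.

End Push.

Lemma spush_comp (S : symset) (x : S) (l0 l : dset) :
  spush (spush x l0) l = spush x (spush l0 l).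
Proof.
rewrite /= /spush_fun dim_act act_comp.
- rewrite -[dim (act l0 _ _)]/(ddim (dact l0 _ _)) ddim_dact.
  by apply: act_ext => i i_n; rewrite vert_dact.
- by move=> i _; apply: geq_minr.
by move=> i _; apply: geq_minr.
Qed.

Definition idd (n : nat) : dset := (0%N, iota 1 n).

Lemma dim_idd n : dim (idd n) = n.
Proof. exact: size_iota. Qed.

Lemma spush_idd (S : symset) (x : S) : spush x (idd (dim x)) = x.
Proof.
rewrite /= /spush_fun dim_idd -[RHS]act_id; apply: act_ext => i ix.
rewrite (_ : vert _ _ = i) ?(minn_idPl ix) //.
rewrite /vert /=; case: i ix => // i ix.
by apply: etrans (nth_iota _ _ ix) _.
Qed.

Section ConePush.
Variables S T : symset.

Definition push (e : awcone S T) : awcone dset dset -> awcone S T :=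
  match e with
  | inl x => conemap (spush (val x).1) (spush (val x).2)
  | inr p => conemap (spush p.1) (spush p.2)
  end.

Definition ty (e : awcone S T) : bool * nat * nat :=
  match e with
  | inl x => (true, dim (val x).1, dim (val x).2)
  | inr p => (false, dim p.1, dim p.2)
  end.

(** The natural operator determined by one chain [w t] of the model for each type [t] of cell. *)
Definition contr (w : bool * nat * nat -> 'V (awcone dset dset)) :
    'V (awcone S T) -> 'V (awcone S T) :=
  lin (fun e => lin (fun e' => gen (push e e')) (w (ty e))).
HB.instance Definition _ w := GRing.isLinear.Build _ _ _ _ (contr w)
  (lin_is_linear (fun e => lin (fun e' => gen (push e e')) (w (ty e)))).

Lemma push_natural e c :
  lin (fun e' => gen (push e e')) (diff (awcone dset dset) c) =
  diff (awcone S T) (lin (fun e' => gen (push e e')) c).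
Proof. by case: e => ?; apply: conemap_natural. Qed.

End ConePush.

(** The universal cell of type [t]: each cell of that type is its image under its own [push]. In the
    summand of the product the two dimensions agree, so the first is used twice. *)
Definition idcell (t : bool * nat * nat) : awcone dset dset :=
  if t.1.1 then
    inl (exist (fun p : dset * dset => is_true (dim p.1 == dim p.2))
           (idd t.1.2, idd t.1.2) (eqxx _))
  else inr (idd t.1.2, idd t.2).

Lemma push_idcell (S T : symset) (e : awcone S T) : push e (idcell (ty e)) = e.
Proof.
case: e => [x|[x y]] /=.
  have x2 := spush_idd (val x).2; rewrite -(eqP (valP x)) in x2.
  congr inl; apply: val_inj; rewrite [RHS]surjective_pairing; congr pair => //.
  exact: spush_idd.
by congr inr; congr pair; apply: spush_idd.
Qed.

Lemma deg_idcell (S T : symset) (e : awcone S T) : deg (idcell (ty e)) = deg e.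
Proof.
case: e => [x|[x y]] /=.
  congr (_.+1); apply: dim_idd.
by rewrite /tdeg; congr addn; apply: dim_idd.
Qed.

Lemma ty_push (S T : symset) (e : awcone S T) e' : ty (push e e') = ty e'.
Proof. by case: e => ?; case: e' => ?; rewrite /ty /push /conemap !ss_dim. Qed.

Lemma push_push (S T : symset) (e : awcone S T) e' e'' :
  push (push e e') e'' = push e (push e' e'').
Proof.
by case: e => ?; case: e' => ?; case: e'' => ?;
  [congr inl; apply: val_inj | congr inr | congr inl; apply: val_inj | congr inr
  |congr inl; apply: val_inj | congr inr | congr inl; apply: val_inj | congr inr];
  congr pair; apply: spush_comp.
Qed.

(** Naturality is built into [contr]: pushing keeps the type of a cell, and characteristic maps
    compose. *)
Lemma contr_natural (S T : symset) w (e : awcone S T) c :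
  lin (fun e' => gen (push e e')) (contr w c) =
  contr w (lin (fun e' => gen (push e e')) c).
Proof.
elim/gen_ind1: c => [|k e' c IH]; first by rewrite !linear0.
rewrite !linearP /= IH; congr (_ *: _ + _) => {IH}.
rewrite /contr !lin_gen ty_push.
elim/gen_ind1: (w _) => [|k' e'' c' IH]; first by rewrite !linear0.
by rewrite !linearP /= IH !lin_gen push_push.
Qed.

(* Acyclic models: the contraction is chosen on the identity cells of the
   infinite simplices, where the cone is acyclic, and transported naturally. *)
Lemma natural_contraction N : exists w, forall (S T : symset) (c : 'V (awcone S T)),
  supp (fun e => deg e < N)%N c ->
  diff (awcone S T) (contr w c) + contr w (diff (awcone S T) c) = c.
Proof.
elim: N => [|N [w wP]].
  by exists (fun=> 0) => S T c /supp_pred0 ->; rewrite ?linear0 ?addr0.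
have bdN (S T : symset) (e : awcone S T) : (deg e <= N)%N ->
    supp (fun e' => deg e' < N)%N (bd e).
  by move=> eN; apply: suppW (@bd_deg _ e) => e' /eqP ee'; rewrite -ltnS ee'.
pose D := awcone dset dset.
have /choice [w' w'P] (t : bool * nat * nat) : exists v : 'V D,
    deg (idcell t) = N -> diff D v = gen (idcell t) - contr w (diff D (gen (idcell t))).
  have [tN|tN] := eqVneq (deg (idcell t)) N; last by exists 0 => /eqP; rewrite (negbTE tN).
  (* The chain to be filled is a cycle: the homotopy identity below degree [N], applied to the
     boundary of the universal cell, says that [contr w] of that boundary has the same boundary as
     the cell. *)
  have [|v ->] := dset_acyclic (c := gen (idcell t) - contr w (diff D (gen (idcell t)))).
    rewrite linearB /=.
    have := wP _ _ (diff D (gen (idcell t))).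
    rewrite diff_diff linear0 addr0 => ->; first by rewrite subrr.
    by rewrite diff_gen; apply: bdN; rewrite tN.
  by exists v.
pose w2 t := if deg (idcell t) == N then w' t else w t.
exists w2 => S T.
have low (c : 'V (awcone S T)) : supp (fun e => deg e < N)%N c -> contr w2 c = contr w c.
  apply: lin_eqP => e eN; rewrite /= ?/contr !lin_gen /w2 deg_idcell.
  by rewrite ltn_eqF.
apply: (@supp_ind _ _ (fun c => _ = c)).
- by rewrite !linear0 addr0.
- by move=> k a b Ea Eb; rewrite !linearP /= addrACA -scalerDr Ea Eb.
move=> e; rewrite ltnS leq_eqVlt.
have dE : diff (awcone S T) (gen e) = bd e by exact: lin_gen.
case/orP=> [/eqP eN|eN]; last first.
  have eS : supp (fun e => deg e < N)%N (gen e) by apply: supp_gen.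
  rewrite (low _ eS) dE (low (bd e)); last exact/bdN/ltnW.
  by rewrite -dE; apply: wP.
rewrite dE (low (bd e)); last by apply: bdN; rewrite eN.
rewrite {1}/contr lin_gen /w2 deg_idcell eN eqxx -push_natural.
rewrite w'P ?deg_idcell // linearB /= lin_gen push_idcell contr_natural.
by rewrite push_natural lin_gen push_idcell dE subrK.
Qed.

(** A chain has finitely many cells, so a contraction valid below one bound is enough, and the
    contractions for different bounds need not be compatible. *)
Lemma awcone_acyclic (S T : symset) : acyclic (awcone S T).
Proof.
move=> c dc; have [N cN] := supp_bound (@deg (awcone S T)) c.
have [w /(_ S T c cN)] := natural_contraction N.
by rewrite dc linear0 addr0 => <-; exists (contr w c).
Qed.

Lemma aw_qiso (S T : symset) :
  qiso (diff (scplx (pset S T))) (diff (tcplx (scplx S) (scplx T))) (lin (@aw S T)).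
Proof.
have [+ _] := @acyclic_coneP (scplx (pset S T)) (tcplx (scplx S) (scplx T)) _
  (@aw_deg S T) (@aw_chain S T).
by apply; apply: awcone_acyclic.
Qed.

(** * Homogeneous components and the Kunneth theorem *)

Section Homogeneous.
Variables (K : choiceType) (dg : K -> nat).

Definition hpart (n : nat) : 'V K -> 'V K :=
  lin (fun x => if dg x == n then gen x else 0).
HB.instance Definition _ n := GRing.isLinear.Build _ _ _ _ (hpart n)
  (lin_is_linear (fun x => if dg x == n then gen x else 0)).

Lemma supp_hpart n c : supp (fun x => dg x == n) (hpart n c).
Proof.
elim/gen_ind1: c => [|k x c IH]; first by rewrite linear0; apply: supp0.
rewrite linearP /=; apply/suppD => //; apply: suppZ.
by rewrite /hpart lin_gen; case: ifP => xn; [apply: supp_gen | apply: supp0].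
Qed.

Lemma hpart_id n c : supp (fun x => dg x == n) c -> hpart n c = c.
Proof.
apply: (@supp_ind _ _ (fun c => hpart n c = c)); first exact: linear0.
  by move=> k a b Ea Eb; rewrite linearP /= Ea Eb.
by move=> x xn; rewrite /hpart lin_gen xn.
Qed.

Lemma hpart_eq0 n m c : supp (fun x => dg x == m) c -> m != n -> hpart n c = 0.
Proof.
move=> cm mn; move: cm; apply: (@supp_ind _ _ (fun c => hpart n c = 0)).
- exact: linear0.
- by move=> k a b Ea Eb; rewrite linearP /= Ea Eb scaler0 addr0.
by move=> x /eqP xm; rewrite /hpart lin_gen xm (negbTE mn).
Qed.

Lemma cf_hpart n c x : cf x (hpart n c) = if dg x == n then cf x c else 0.
Proof.
elim/gen_ind1: c => [|k y c IH]; first by rewrite !linear0 if_same.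
rewrite !linearP /= IH /hpart lin_gen.
have [<-|yx] := eqVneq y x; first by case: eqP => _; rewrite ?linear0 ?mulr0 ?addr0.
rewrite cf_gen (negbTE yx) mulr0 add0r.
by case: (dg y == n); rewrite ?linear0 ?cf_gen ?(negbTE yx) mulr0 add0r.
Qed.

End Homogeneous.

(** Here [m] is the drop in degree, [1] for a differential and [0] for a chain map; the form [n + m]
    avoids a truncated subtraction in the index. *)
Lemma hpart_lin (K L : choiceType) (dK : K -> nat) (dL : L -> nat) (f : K -> 'V L) n m c :
  (forall x, supp (fun y => (dL y + m == dK x)%N) (f x)) ->
  lin f (hpart dK (n + m) c) = hpart dL n (lin f c).
Proof.
move=> fdeg; elim/gen_ind1: c => [|k x c IH]; first by rewrite !linear0.
rewrite !linearP /= IH lin_gen /hpart lin_gen -/(hpart dL n); congr (_ *: _ + _).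
case: eqP => [xn|/eqP xn].
  rewrite lin_gen hpart_id //; apply: suppW (@fdeg x) => y.
  by rewrite xn eqn_add2r.
rewrite linear0; symmetry.
have fx : supp (fun y => dL y == (dK x - m)%N) (f x).
  by apply: suppW (@fdeg x) => y /eqP <-; rewrite addnK.
have [mx|mx] := leqP m (dK x).
  by rewrite (hpart_eq0 fx) //; apply: contraNneq xn => <-; rewrite subnK.
suff -> : f x = 0 by rewrite linear0.
apply: supp_pred0 (@fdeg x) => y; apply: contraTneq mx => <-.
by rewrite -leqNgt leq_addl.
Qed.

Lemma diff_hpart (C : cplx) n (c : 'V C) :
  diff C (hpart (@deg C) n.+1 c) = hpart (@deg C) n (diff C c).
Proof.
rewrite -addn1; apply: hpart_lin => x.
by apply: suppW (@bd_deg _ x) => y; rewrite addn1.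
Qed.

Lemma diff_hpart0 (C : cplx) (c : 'V C) : diff C (hpart (@deg C) 0 c) = 0.
Proof.
apply: (@lin_eqP _ _ (fun x => deg x == 0%N) (diff C) \0).
  move=> x /eqP x0; apply: etrans (lin_gen _ _) _.
  by apply: supp_pred0 (@bd_deg _ x) => y; rewrite x0.
exact: supp_hpart.
Qed.

Lemma hpart_cycle (C : cplx) n (c : 'V C) : diff C c = 0 -> diff C (hpart (@deg C) n c) = 0.
Proof. by case: n => [|n] dc; rewrite ?diff_hpart0 // diff_hpart dc linear0. Qed.

(* The classes of the cycles [z j] form a graded basis of the homology of [S]. *)
Definition hmodel (S : symset) (J : finType) (dg : J -> nat) (z : J -> 'V S) :=
  [/\ forall j, supp (fun x => dim x == dg j) (z j),
      forall j, diff (scplx S) (z j) = 0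
    & qiso (diff (zcplx dg)) (diff (scplx S)) (lin z)].

Lemma aw_diff (S T : symset) c : lin (@aw S T) (diff (scplx (pset S T)) c) =
  diff (tcplx (scplx S) (scplx T)) (lin (@aw S T) c).
Proof.
exact: (@chain_map (scplx (pset S T)) (tcplx (scplx S) (scplx T)) _ (@aw_chain S T)).
Qed.

Section Kunneth.
Variables (S T : symset) (J J' : finType) (dg : J -> nat) (dg' : J' -> nat).
Variables (z : J -> 'V S) (z' : J' -> 'V T).
Hypotheses (mz : hmodel dg z) (mz' : hmodel dg' z').

Let dgp (p : J * J') := (dg p.1 + dg' p.2)%N.

Lemma diff_zz c : diff (tcplx (zcplx dg) (zcplx dg')) c = 0.
Proof.
elim/gen_ind1: c => [|k p c IH]; first by rewrite linear0.
by rewrite linearP /= IH diff_gen /= /tbd tens0l linear0 scaler0 !addr0 scaler0.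
Qed.

(** [z (x) z'] factors through [S (x) J'], so one factor is changed at a time. *)
Lemma tmap_zz_qiso :
  qiso (diff (tcplx (zcplx dg) (zcplx dg'))) (diff (tcplx (scplx S) (scplx T)))
    (tmap z z').
Proof.
have [_ zc qz] := mz; have [_ z'c qz'] := mz'.
have -> : tmap z z' = tmap (@gen S) z' \o tmap z (@gen J').
  apply/funext => c; rewrite /=; elim/gen_ind1: c => [|k [x y] c IH].
    by rewrite !linear0.
  by rewrite !linearP /= IH -tens_gen !tmap_tens !lin_gen lin_genK.
have f1 a : tmap z (@gen J') (diff (tcplx (zcplx dg) (zcplx dg')) a) =
    diff (tcplx (scplx S) (zcplx dg')) (tmap z (@gen J') a).
  rewrite diff_zz linear0; symmetry.
  elim/gen_ind1: a => [|k [x y] c IH]; first by rewrite !linear0.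
  rewrite !linearP /= IH /tmap lin_gen [diff _ _](diff_tens_zcplx (C := scplx S)) /=.
  by rewrite zc tens0l addr0 scaler0.
apply: (@qiso_comp _ _ _ (diff (tcplx (zcplx dg) (zcplx dg')))
  (diff (tcplx (scplx S) (zcplx dg'))) (diff (tcplx (scplx S) (scplx T)))).
- exact: diff_diff.
- exact: f1.
- move=> b; apply: (@tmapr_chain (scplx S) (zcplx dg') (scplx T)) => x.
  by rewrite z'c linear0.
- exact: tens_qisol.
apply: (@tens_qisor (scplx S) (zcplx dg') (scplx T)) => // x.
by rewrite z'c linear0.
Qed.

(** Since [aw] maps the product to the tensor product, the cycles [z p.1 (x) z' p.2] are lifted
    through it up to boundaries. The lifts [Zf] represent a basis because [aw] is a
    quasi-isomorphism and the tensors represent one. *)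
Lemma kunneth : exists z2 : J * J' -> 'V (pset S T), hmodel dgp z2.
Proof.
have [zs zc qz] := mz; have [z's z'c qz'] := mz'.
have us p : supp (fun q => @tdeg (scplx S) (scplx T) q == dgp p) (tens (z p.1) (z' p.2)).
  apply: supp_tens (zs p.1) (z's p.2) => x y /eqP xd /eqP yd.
  by rewrite /tdeg /= xd yd.
have uc p : diff (tcplx (scplx S) (scplx T)) (tens (z p.1) (z' p.2)) = 0.
  rewrite (@diff_tens (scplx S) (scplx T) (dg p.1)) ?zc ?z'c; last exact: zs.
  by rewrite tens0l linear0 scaler0 addr0.
have awc := @aw_diff S T.
have /choice [w wP] p : exists w : 'V (pset S T) * 'V (S * T)%type,
    [/\ diff (scplx (pset S T)) w.1 = 0, supp (fun x => dim x == dgp p) w.1 &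
     tens (z p.1) (z' p.2) = lin (@aw S T) w.1 + diff (tcplx (scplx S) (scplx T)) w.2].
  have [|a [b [da E]]] := qiso_surj (@aw_qiso S T) (b := tens (z p.1) (z' p.2)).
    exact: uc.
  (* The lift need not be homogeneous. Its part of degree [dgp p], with the part of the bounding
     chain one degree higher, satisfies the same equation. *)
  exists (hpart (@dim (pset S T)) (dgp p) a,
          hpart (@deg (tcplx (scplx S) (scplx T))) (dgp p).+1 b); split.
  - exact: (@hpart_cycle (scplx (pset S T))).
  - exact: supp_hpart.
  have hl := @hpart_lin _ _ (@dim (pset S T)) (@deg (tcplx (scplx S) (scplx T)))
    (@aw S T) (dgp p) 0 a.
  rewrite addn0 in hl; rewrite diff_hpart hl; last first.
    by move=> x y /(@aw_deg S T x y); rewrite addn0.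
  by rewrite -linearD -E; symmetry; apply: hpart_id; apply: us.
exists (fun p => (w p).1); split=> [p|p|]; [by have [] := wP p|by have [] := wP p|].
have dz c : diff (zcplx dgp) c = 0 by exact: diff_zcplx.
pose Zf p := (w p).1; pose Bf p := (w p).2.
have awZ c : tmap z z' c = lin (@aw S T) (lin Zf c) + diff (tcplx (scplx S) (scplx T)) (lin Bf c).
  elim/gen_ind1: c => [|k p c IH]; first by rewrite !linear0 addr0.
  rewrite !linearP /= IH [RHS]addrACA -scalerDr; congr (_ *: _ + _).
  by rewrite /tmap !lin_gen; have [_ _] := wP p.
have Zc c : diff (scplx (pset S T)) (lin Zf c) = 0.
  elim/gen_ind1: c => [|k p c IH]; first by rewrite !linear0.
  by rewrite !linearP /= IH lin_gen; have [-> _ _] := wP p; rewrite scaler0 addr0.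
have fdz c : lin Zf (diff (zcplx dgp) c) = diff (scplx (pset S T)) (lin Zf c).
  by rewrite dz linear0 Zc.
apply: (@qiso_intro _ _ (diff (zcplx dgp)) (diff (scplx (pset S T))) (lin Zf)).
- exact: fdz.
- move=> a b _ ab.
  have [||a' ->] := qiso_inj (a := a) (b := lin (@aw S T) b + lin Bf a) tmap_zz_qiso.
  - exact: diff_zz.
  - by apply: etrans (awZ a) _; rewrite ab awc linearD.
  by exists 0; rewrite linear0; apply: diff_zz.
move=> b db.
have cyc : diff (tcplx (scplx S) (scplx T)) (lin (@aw S T) b) = 0.
  by rewrite -awc [diff _ b]db linear0.
have [a [c [_ E]]] := qiso_surj tmap_zz_qiso cyc.
have [||v vE] := qiso_inj (a := b - lin Zf a) (b := lin Bf a + c) (@aw_qiso S T).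
- by rewrite linearB /= db Zc subrr.
- have {}E : lin (@aw S T) b = tmap z z' a + diff (tcplx (scplx S) (scplx T)) c := E.
  by rewrite linearB /= E awZ linearD /= -[X in X - _]addrA [LHS]addrC addKr.
have {}vE : b - lin Zf a = diff (scplx (pset S T)) v := vE.
have bE : b = lin Zf a + diff (scplx (pset S T)) v by rewrite -vE addrC subrK.
by exists a, v; split; [exact: dz | exact: bE].
Qed.

End Kunneth.

(** * Singular homology and Euler characteristics *)

Section AffineMaps.
Variable R : realType.

(** The affine map with vertex map [f] pushes barycentric weights forward; [inord] reads values of
    [f] above [n] as vertex [0]. *)
Definition aff_row m n (f : nat -> nat) (x : 'rV[R]_m.+1) : 'rV[R]_n.+1 :=
  \row_(j < n.+1) \sum_(i < m.+1 | inord (f i) == j) x 0 i.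

Lemma aff_row_in m n f (x : simplex m) :
  aff_row n f (set_val x) \in @simplex_set R n.
Proof.
have [x0 x1] : @simplex_set R m (set_val x) by exact: set_valP.
rewrite inE; split=> [j|]; first by rewrite mxE; apply: sumr_ge0.
rewrite -x1 (partition_big (fun i : 'I_m.+1 => inord (f i) : 'I_n.+1) predT) //=.
by apply: eq_bigr => j _; rewrite mxE.
Qed.

Definition aff m n f (x : @simplex R m) : @simplex R n := SigSub (aff_row_in n f x).

Lemma aff_row_cont m n f : continuous (@aff_row m n f).
Proof.
move=> x A [P PN PA].
have : \forall y \near x, forall r j, P r j (aff_row n f y r j).
  have FF : Filter (nbhs x) by exact: nbhs_filter.
  apply: (@filter_forall _ _ (fun r => [set y | forall j, P r j (aff_row n f y r j)]%classic) _ FF) => r.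
  apply: (@filter_forall _ _ (fun j => [set y | P r j (aff_row n f y r j)]%classic) _ FF) => j.
  have cj : continuous (fun y : 'rV[R]_m.+1 =>
      \sum_(i < m.+1 | inord (f i) == j :> 'I_n.+1) y 0 i).
    apply: continuous_big => [|i _]; first exact: add_continuous.
    exact: coord_continuous.
  have := PN r j; rewrite mxE => /cj cP; apply: (@filterS _ (nbhs x) FF _ _ _ cP) => y /=.
  by rewrite mxE.
by move=> cP; apply: filterS cP => y; apply: PA.
Qed.

Lemma aff_cont m n f : continuous (@aff m n f).
Proof.
apply: continuous_comp_initial => x.
have -> : set_val \o @aff m n f = @aff_row m n f \o set_val by [].
by apply: continuous_comp; [exact: initial_continuous|exact: aff_row_cont].
Qed.

HB.instance Definition _ m n f :=
  @isContinuous.Build (@simplex R m) (@simplex R n) (@aff m n f) (@aff_cont m n f).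

Lemma aff_ext m n f g : (forall i, (i <= m)%N -> f i = g i) -> @aff m n f =1 aff n g.
Proof.
move=> fg x; apply/val_inj/rowP => j /=; rewrite !mxE; apply: eq_bigl => i.
by rewrite fg // -ltnS.
Qed.

Lemma aff_id n : @aff n n id =1 id.
Proof.
move=> x; apply/val_inj/rowP => j /=; rewrite !mxE (big_pred1 j) // => i.
by rewrite inord_val.
Qed.

Lemma aff_comp p n m f g : (forall i, (i <= m)%N -> (g i <= n)%N) ->
  @aff n p f \o @aff m n g =1 aff p (f \o g).
Proof.
move=> gn x; apply/val_inj/rowP => j /=; rewrite !mxE.
under eq_bigr => i _ do rewrite mxE.
rewrite (exchange_big_dep predT) //= [RHS]big_mkcond /=; apply: eq_bigr => i _.
have gi : (inord (g i) : 'I_n.+1) = g i :> nat.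
  by rewrite inordK // ltnS gn // -ltnS.
case: eqP => [ij|ij].
  rewrite (big_pred1 (inord (g i))) // => k; apply/andP/eqP => [[]|->].
    by move=> /eqP ? /eqP.
  by rewrite gi; split; apply/eqP.
rewrite big_pred0 // => k; apply/negP => /andP[/eqP kj /eqP gk].
by apply: ij; rewrite -kj -gk gi.
Qed.

Lemma aff_bump n (i : 'I_n.+2) : @aff n n.+1 (bump i) =1 face_fun i.
Proof.
move=> x; apply/val_inj/rowP => j /=; rewrite !mxE.
case: unliftP => [k ->|->].
  rewrite (big_pred1 k) // => l; apply/eqP/eqP => [E|->].
    apply: (@lift_inj _ i); apply/val_inj; rewrite -E /= inordK //.
    exact: (@bump_le i n l (ltn_ord l)).
  by apply: val_inj; rewrite /= inordK // ltnS; apply: (@bump_le i n k (ltn_ord k)).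
rewrite big_pred0 // => l; apply/eqP => /(congr1 val) /=.
rewrite inordK; last exact: (@bump_le i n l (ltn_ord l)).
by move/eqP; rewrite eq_sym (negbTE (neq_bump _ _)).
Qed.

End AffineMaps.

Section Sing.
Variables (R : realType) (Y : topologicalType).

Definition sing_sort : Type := {n : nat & singular R Y n}.
HB.instance Definition _ := Choice.on sing_sort.

Definition sing_dim (x : sing_sort) : nat := tag x.

Definition sing_act (x : sing_sort) n f : sing_sort :=
  Tagged (singular R Y) (tagged x \o aff (tag x) f : singular R Y n).

Lemma singP n (s t : singular R Y n) : s =1 t -> s = t.
Proof. by move=> st; apply/continuousEP. Qed.

Lemma sing_dim_act x n f : sing_dim (sing_act x n f) = n.
Proof. by []. Qed.

Lemma sing_act_ext x n f g : (forall i, (i <= n)%N -> f i = g i) ->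
  sing_act x n f = sing_act x n g.
Proof.
by move=> fg; congr Tagged; apply: singP => y; rewrite /= (aff_ext _ fg).
Qed.

Lemma sing_act_id x : sing_act x (sing_dim x) id = x.
Proof.
case: x => n s; rewrite /sing_act /=; congr (Tagged _ _).
by apply: singP => y; rewrite /= aff_id.
Qed.

Lemma sing_act_comp x n f m g : (forall i, (i <= n)%N -> (f i <= sing_dim x)%N) ->
  (forall i, (i <= m)%N -> (g i <= n)%N) ->
  sing_act (sing_act x n f) m g = sing_act x m (f \o g).
Proof.
move=> _ gn; congr Tagged; apply: singP => y /=.
by have /= -> := @aff_comp R (tag x) n m f g gn y.
Qed.

Definition Sing : symset :=
  SymSet sing_dim_act sing_act_ext sing_act_id sing_act_comp.

End Sing.

Section Graded.
Variables (R : realType) (Y : topologicalType).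

Lemma boundaryS n (c : 'V (singular R Y n.+1)) :
  boundary (n := n.+1) c =
  lin (fun s => \sum_(i < n.+2) (-1) ^+ i *: gen (face i s)) c.
Proof. by []. Qed.

(** Bridge between [chain], whose type depends on the degree, and the chains of [Sing]: it
    identifies the former with the chains supported in dimension [n]. *)
Definition toSing n : 'V (singular R Y n) -> 'V (Sing R Y) :=
  lin (fun s => gen (Tagged (singular R Y) s : Sing R Y)).
HB.instance Definition _ n := GRing.isLinear.Build _ _ _ _ (@toSing n)
  (lin_is_linear (fun s => gen (Tagged (singular R Y) s : Sing R Y))).

Lemma toSing_gen n s :
  @toSing n (gen s) = gen (Tagged (singular R Y) s : Sing R Y).
Proof. exact: lin_gen. Qed.

Lemma cf_toSing n (s : singular R Y n) c :
  cf (Tagged (singular R Y) s : Sing R Y) (toSing c) = cf s c.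
Proof.
elim/gen_ind1: c => [|k t c IH]; first by rewrite !linear0.
by rewrite !linearP /= IH toSing_gen !cf_gen eq_Tagged.
Qed.

Lemma toSing_inj n : injective (@toSing n).
Proof. by move=> a b ab; apply: gen_ext => s; rewrite -!cf_toSing ab. Qed.

Lemma toSing_supp n (c : 'V (singular R Y n)) :
  supp (fun x : Sing R Y => dim x == n) (toSing c).
Proof.
elim/gen_ind1: c => [|k t c IH]; first by rewrite linear0; apply: supp0.
rewrite linearP /=; apply/suppD => //; apply/suppZ; rewrite toSing_gen.
exact: supp_gen.
Qed.

Lemma toSing_surj n (c : 'V (Sing R Y)) :
  supp (fun x : Sing R Y => dim x == n) c -> exists c', c = @toSing n c'.
Proof.
apply: (@supp_ind _ _ (fun c => exists c', c = @toSing n c')).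
- by exists 0; rewrite linear0.
- by move=> k a b [a' ->] [b' ->]; exists (k *: a' + b'); rewrite linearP.
by case=> m s /= /eqP mn; case: n / mn => //; exists (gen s); rewrite toSing_gen.
Qed.

Lemma toSing_boundary n (c : 'V (singular R Y n)) :
  toSing (boundary c : 'V (singular R Y n.-1)) = diff (scplx (Sing R Y)) (toSing c).
Proof.
case: n c => [|n] c.
  have := hpart_id (@toSing_supp 0 c) => <-.
  by rewrite [RHS](diff_hpart0 (C := scplx (Sing R Y))) [LHS]linear0.
rewrite boundaryS.
elim/gen_ind1: c => [|k s c IH]; first by rewrite !linear0.
rewrite !linearP /= IH; congr (_ *: _ + _).
rewrite toSing_gen diff_gen lin_gen /= linear_sum /=; apply: eq_bigr => i _.
rewrite linearZ /= toSing_gen; congr (_ *: gen _).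
congr Tagged; apply: singP => y /=.
by rewrite aff_bump.
Qed.

End Graded.

Definition has_euler (R : realType) (Y : topologicalType) (e : int) :=
  exists (J : finType) (dg : J -> nat) (z : J -> 'V (Sing R Y)),
    hmodel dg z /\ e = \sum_j (-1) ^+ dg j.

Section Euler.
Variables (R : realType) (Y : topologicalType).

(** If [k' < k], the matrix expressing the cycles [b] in the basis [b'] modulo boundaries has a
    nonzero left kernel vector, which is a forbidden relation among the classes of [b]. *)
Lemma homology_dim_uniq n k k' :
  homology_dim R Y n k -> homology_dim R Y n k' -> (k <= k')%N.
Proof.
move=> [b [bc _ bi]] [b' [_ bs' _]].
have /choice [A AP] i : exists a : 'I_k' -> rat, exists w : chain R Y n.+1,
    b i = \sum_j a j *: b' j + boundary w.
  exact: bs' (bc i).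
have /choice [W WP] := AP.
pose M := \matrix_(i < k, j < k') A i j.
rewrite leqNgt; apply/negP => kk'.
have kM : kermx M != 0.
  rewrite -mxrank_eq0 mxrank_ker subn_eq0 -ltnNge.
  exact: leq_ltn_trans (rank_leq_col M) kk'.
have /existsP[i /existsP[j0 nz]] : [exists i, [exists j, kermx M i j != 0]].
  apply: contraNT kM; rewrite negb_exists => /forallP H.
  apply/eqP/matrixP => i j; rewrite [RHS]mxE; apply/eqP.
  by have := H i; rewrite negb_exists => /forallP/(_ j); rewrite negbK.
pose a j : rat := kermx M i j.
have aM j' : \sum_j a j * A j j' = 0.
  have : (kermx M *m M) i j' = 0 by rewrite mulmx_ker mxE.
  by rewrite mxE => E; rewrite -[RHS]E; apply: eq_bigr => j _; rewrite [M _ _]mxE.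
pose bd1 (c : 'V (singular R Y n.+1)) : 'V (singular R Y n) :=
  lin (fun s => \sum_(i < n.+2) (-1) ^+ i *: gen (face i s)) c.
pose w : 'V (singular R Y n.+1) := \sum_j a j *: (W j : 'V (singular R Y n.+1)).
suff E : \sum_j a j *: b j = boundary (w : chain R Y n.+1).
  by have := bi _ _ E j0; apply/eqP.
transitivity (\sum_j a j *: (\sum_j' A j j' *: (b' j' : 'V (singular R Y n)) + bd1 (W j))).
  by apply: eq_bigr => j _; congr (_ *: _); exact: WP.
under eq_bigr => j _ do rewrite scalerDr scaler_sumr.
rewrite big_split /= exchange_big /= big1 ?add0r => [|j' _].
  transitivity (bd1 w); last by [].
  by rewrite /bd1 /w linear_sum; apply: eq_bigr => j _; rewrite linearZ.
under eq_bigr => j _ do rewrite scalerA.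
by rewrite -scaler_suml aM scale0r.
Qed.

Lemma fin_gen_sum (J : finType) (a : 'V J) : a = \sum_j cf j a *: gen j.
Proof.
apply: gen_ext => j; rewrite linear_sum (bigD1 j) //= linearZ /= cf_gen eqxx mulr1.
by rewrite big1 ?addr0 // => i /negbTE ij; rewrite linearZ /= cf_gen ij mulr0.
Qed.

Lemma hmodel_dim (J : finType) (dg : J -> nat) (z : J -> 'V (Sing R Y)) n :
  hmodel dg z -> homology_dim R Y n #|[pred j | dg j == n]|.
Proof.
move=> [zs zc qz]; pose A := [pred j | dg j == n].
have /choice [b bE] (i : 'I_#|A|) : exists c : 'V (singular R Y n), z (enum_val i) = toSing c.
  apply: toSing_surj; have := enum_valP i; rewrite inE => /eqP <-.
  exact: zs.
have lin0 (a : 'V J) : supp (fun j => dg j == n) a ->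
    lin z a = toSing (\sum_i cf (enum_val i) a *: b i).
  move=> an; rewrite {1}[a]fin_gen_sum (bigID A) /= [X in _ + X]big1 ?addr0; last first.
    move=> j; apply: contraNeq => nz; apply: an.
    by apply: contra_neq nz => ->; rewrite scale0r.
  rewrite linear_sum big_enum_val linear_sum; apply: eq_bigr => i _.
  by rewrite !linearZ /= lin_gen bE.
exists b; split.
- move=> i; apply: (@toSing_inj R Y n.-1); rewrite toSing_boundary -bE zc.
  by rewrite linear0.
- move=> c bc.
  have cyc : diff (scplx (Sing R Y)) (toSing (c : 'V (singular R Y n))) = 0.
    by rewrite -toSing_boundary bc [LHS]linear0.
  have [a [w [_ E]]] := qiso_surj qz cyc.
  (* Only the parts of degree [n] of [a] and [n.+1] of [w] matter, the given cycle being
     homogeneous. *)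
  have [v vE] := toSing_surj (@supp_hpart _ (@deg (scplx (Sing R Y))) n.+1 w).
  exists (fun i => cf (enum_val i) (hpart dg n a)), (v : chain R Y n.+1).
  apply: (@toSing_inj R Y n); rewrite [RHS]linearD /= -lin0; last exact: supp_hpart.
  rewrite [X in _ + X](@toSing_boundary R Y n.+1 v) -vE.
  rewrite diff_hpart; have hl := @hpart_lin _ _ dg (@deg (scplx (Sing R Y))) z n 0 a.
  rewrite addn0 in hl; rewrite hl => [|j x xj]; last by rewrite addn0; exact: zs xj.
  rewrite -linearD /=.
  have -> : lin z a + diff (scplx (Sing R Y)) w = toSing c by rewrite E.
  by rewrite hpart_id //; apply: toSing_supp.
move=> a w E i.
have zE : lin z (\sum_i a i *: gen (enum_val i)) =
    diff (scplx (Sing R Y)) (toSing (w : 'V (singular R Y n.+1))).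
  rewrite -(@toSing_boundary R Y n.+1) -[boundary _]E linear_sum [RHS]linear_sum.
  by apply: eq_bigr => j _; rewrite linearZ /= lin_gen bE [RHS]linearZ.
have [a' a'E] := qiso_inj qz (diff_zcplx _) zE.
have a0 : \sum_i a i *: gen (enum_val i) = 0 :> 'V J.
  by apply: etrans a'E _; apply: diff_zcplx.
have := congr1 (cf (enum_val i)) a0.
rewrite linear0 linear_sum (bigD1 i) //= linearZ /= cf_gen eqxx mulr1.
rewrite big1 ?addr0 // => j ji; rewrite linearZ /= cf_gen.
by rewrite (inj_eq enum_val_inj) (negbTE ji) mulr0.
Qed.

Lemma has_eulerP e : has_euler R Y e -> euler_char R Y = e.
Proof.
move=> [J [dg [z [mz ->]]]].
have bE n : betti R Y n = #|[pred j | dg j == n]|.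
  rewrite /betti; case: xgetP => [k _ /= hk|/(_ _ (hmodel_dim n mz))//].
  have hk' := hmodel_dim n mz; apply/eqP; rewrite eqn_leq.
  by rewrite (homology_dim_uniq hk hk') (homology_dim_uniq hk' hk).
rewrite /euler_char.
pose N := (\max_j dg j).+1.
have dN j : (dg j < N)%N by rewrite ltnS; apply: leq_bigmax.
transitivity (\sum_(n < N) \sum_(j | dg j == n) (-1) ^+ dg j : int); last first.
  rewrite (exchange_big_dep predT) //=; apply: eq_bigr => j _.
  by rewrite (big_pred1 (Ordinal (dN j))).
transitivity (\sum_(n < N) (-1) ^+ n * (betti R Y n)%:Z).
  rewrite (fsbig_ord _ _ (fun n => (-1) ^+ n * (betti R Y n)%:Z)).
  symmetry; apply: fsbig_widen => // n [_ /= nN].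
  rewrite bE eq_card0 ?mulr0 // => j; rewrite !inE; apply/negP => /eqP jn.
  by apply: nN; rewrite -jn.
apply: eq_bigr => n _; rewrite bE.
rewrite (eq_bigr (fun=> (-1) ^+ n)) => [|j /eqP -> //].
by rewrite sumr_const -mulr_natr natz.
Qed.

(** Bases of the separate degrees are assembled into one family indexed by pairs (degree, index).
    The index type is finite because uniqueness of the dimension forces [k n = 0] from [N] on. *)
Lemma finite_homology_euler : finite_homology R Y -> has_euler R Y (euler_char R Y).
Proof.
move=> [fin [N vanish]].
suff [e he] : exists e, has_euler R Y e by rewrite (has_eulerP he).
have /choice [k kP] : forall n, exists k, homology_dim R Y n k by [].
have k0 n : (N <= n)%N -> k n = 0%N.
  move=> /vanish h0; apply/eqP; rewrite -leqn0.
  exact: homology_dim_uniq (kP n) h0.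
pose J := {n : 'I_N & 'I_(k n)}.
pose b n : 'I_(k n) -> 'V (singular R Y n) := projT1 (cid (kP n)).
have bP n : homology_basis (b n : _ -> chain R Y n) := projT2 (cid (kP n)).
pose dg (x : J) : nat := tag x.
pose z (x : J) := toSing (b (tag x) (tagged x)).
pose pr (n : 'I_N) (i : 'I_(k n)) : J := Tagged (fun n : 'I_N => 'I_(k n)) i.
have linz (n : 'I_N) (a : 'V J) : supp (fun j => dg j == n) a ->
    lin z a = toSing (\sum_i cf (pr n i) a *: b n i).
  move=> an; rewrite {1}[a]fin_gen_sum linear_sum.
  transitivity (\sum_(m < N) \sum_(i < k m) cf (pr m i) a *: toSing (b m i)).
    rewrite (sig_big_dep (fun=> true) (fun=> xpredT)
      (fun (m : 'I_N) (i : 'I_(k m)) => cf (pr m i) a *: toSing (b m i))) /=.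
    by apply: eq_bigr => -[m i] _; rewrite linearZ /= lin_gen.
  rewrite (bigD1 n) //= [X in _ + X]big1 ?addr0 => [|m mn].
    by rewrite linear_sum; apply: eq_bigr => i _; rewrite linearZ.
  rewrite big1 // => i _; have [->|nz] := eqVneq (cf (pr m i) a) 0; first exact: scale0r.
  by case/eqP: mn; apply/val_inj/eqP; apply: an nz.
have sz x : supp (fun y : Sing R Y => dim y == dg x) (z x) by apply: toSing_supp.
have zc x : diff (scplx (Sing R Y)) (z x) = 0.
  rewrite /z -toSing_boundary; have [bc _ _] := bP (tag x).
  by rewrite bc [LHS]linear0.
exists (\sum_j (-1) ^+ dg j), J, dg, z; split=> //; split=> //.
have fd a : lin z (diff (zcplx dg) a) = diff (scplx (Sing R Y)) (lin z a).
  rewrite diff_zcplx linear0; symmetry.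
  elim/gen_ind1: a => [|l x a IH]; first by rewrite !linear0.
  by rewrite !linearP /= IH lin_gen zc addr0 scaler0.
apply: (@qiso_intro _ _ (diff (zcplx dg)) (diff (scplx (Sing R Y))) (lin z)).
- exact: fd.
- move=> a c _ ac; exists 0; rewrite linear0; apply: gen_ext => -[n i].
  rewrite linear0.
  have [v vE] := toSing_surj (@supp_hpart _ (@deg (scplx (Sing R Y))) n.+1 c).
  have E : \sum_i cf (pr n i) (hpart dg n a) *: b n i = boundary (v : chain R Y n.+1).
    apply: (@toSing_inj R Y n); rewrite -linz; last exact: supp_hpart.
    rewrite (@toSing_boundary R Y n.+1 v) -vE diff_hpart -[diff _ c]ac.
    have hl := @hpart_lin _ _ dg (@deg (scplx (Sing R Y))) z n 0 a.
    by rewrite addn0 in hl; rewrite hl // => x y /sz; rewrite addn0.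
  have [_ _ /(_ _ _ E i)] := bP n.
  by rewrite cf_hpart eqxx.
move=> c dc.
have [M cM] := supp_bound (@deg (scplx (Sing R Y))) c.
(* A cycle is the sum of its homogeneous parts, which are cycles, so each can be treated by the
   basis of its own degree. *)
have -> : c = \sum_(n < M) hpart (@deg (scplx (Sing R Y))) n c.
  apply: gen_ext => x; rewrite linear_sum /=.
  under eq_bigr => n _ do rewrite cf_hpart.
  have [x0|/cM xM] := eqVneq (cf x c) 0.
    by rewrite big1 // => n _; rewrite x0 if_same.
  rewrite (bigD1 (Ordinal xM)) //= eqxx big1 ?addr0 // => n; rewrite eq_sym => nx.
  by rewrite ifN.
elim/big_ind: _.
- by exists 0, 0; rewrite !linear0 addr0.
- move=> c1 c2 [a1 [w1 [_ ->]]] [a2 [w2 [_ ->]]]; exists (a1 + a2), (w1 + w2).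
  split; first exact: diff_zcplx.
  by rewrite !linearD /= addrACA.
move=> n _.
have [v vE] := toSing_surj (@supp_hpart _ (@deg (scplx (Sing R Y))) n c).
have bv : boundary (v : chain R Y n) = 0.
  apply: (@toSing_inj R Y n.-1); rewrite toSing_boundary -vE [RHS]linear0.
  exact: (@hpart_cycle (scplx (Sing R Y)) n c dc).
have [_ /(_ v bv) [a [w E]] _] := bP n.
have {}E : toSing v = toSing (\sum_i a i *: b n i) + diff (scplx (Sing R Y)) (toSing (w : 'V _)).
  by rewrite -(@toSing_boundary R Y n.+1) -linearD; congr toSing.
rewrite vE E; have [nN|/k0 kn0] := ltnP n N; last first.
  exists 0, (toSing (w : 'V _)); split; first exact: diff_zcplx.
  rewrite linear0 big1 ?linear0 // => i; by have := ltn_ord i; rewrite {2}kn0.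
exists (\sum_i a i *: gen (pr (Ordinal nN) i)), (toSing (w : 'V _)).
split; first exact: diff_zcplx.
congr (_ + _); rewrite !linear_sum; apply: eq_bigr => i _.
by rewrite !linearZ /= lin_gen.
Qed.

End Euler.

(** * Euler characteristics of homeomorphic spaces, products and points *)

Lemma iso_qiso (A B : lmodType rat) (dA : {linear A -> A}) (dB : {linear B -> B})
    (F : {linear A -> B}) (G : {linear B -> A}) :
  (forall a, F (dA a) = dB (F a)) -> cancel F G -> cancel G F -> qiso dA dB F.
Proof.
move=> Fd FK GK a b da Fab; exists (G b), 0; rewrite linear0 addr0 GK; split=> //.
by apply: (can_inj FK); rewrite Fd GK.
Qed.

Lemma hmodel_bij (S T : symset) (phi : ssmap S T) (J : finType) (dg : J -> nat)
    (z : J -> 'V S) :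
  bijective phi -> hmodel dg z -> hmodel dg (fun j => lin (fun x => gen (phi x)) (z j)).
Proof.
move=> [psi phiK psiK] [zs zc qz].
pose F := lin (fun x => gen (phi x)); pose G := lin (fun y => gen (psi y)).
have Fd c : lin (fun x => gen (phi x)) (diff (scplx S) c) =
    diff (scplx T) (lin (fun x => gen (phi x)) c).
  apply: (@chain_map (scplx S) (scplx T)) => x.
  by rewrite diff_gen; exact: sbd_natural.
split=> [j|j|].
- apply: supp_lin (zs j) => x /eqP xj; rewrite /= lin_gen; apply: supp_gen.
  by rewrite ss_dim xj.
- by rewrite -Fd zc linear0.
have -> : lin (fun j => lin (fun x => gen (phi x)) (z j)) = F \o lin z.
  apply/funext => c /=; elim/gen_ind1: c => [|k j c IH]; first by rewrite /F !linear0.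
  by rewrite /F !linearP /= -/F IH !lin_gen.
have zd a : lin z (diff (zcplx dg) a) = diff (scplx S) (lin z a).
  rewrite diff_zcplx linear0; symmetry.
  elim/gen_ind1: a => [|l x a IH]; first by rewrite !linear0.
  by rewrite !linearP /= IH lin_gen zc addr0 scaler0.
apply: (@qiso_comp _ _ _ (diff (zcplx dg)) (diff (scplx S)) (diff (scplx T))
          (lin z) (lin (fun x => gen (phi x)))) => //.
- by move=> a; apply: diff_diff.
apply: (@iso_qiso _ _ (diff (scplx S)) (diff (scplx T)) _ (lin (fun y => gen (psi y)))) => //.
- move=> c /=; elim/gen_ind1: c => [|k x c IH]; first by rewrite !linear0.
  by rewrite !linearP /= IH !lin_gen phiK.
- move=> c /=; elim/gen_ind1: c => [|k x c IH]; first by rewrite !linear0.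
  by rewrite !linearP /= IH !lin_gen psiK.
Qed.

Lemma ssmap_inv (S T : symset) (phi : ssmap S T) : injective phi ->
  (forall y, exists x, phi x = y) -> exists psi : ssmap T S, bijective psi.
Proof.
move=> inj /choice [psi psiK]; have phiK x : psi (phi x) = x by apply: inj.
have psi_dim y : dim (psi y) = dim y by rewrite -(ss_dim phi) psiK.
have psi_act y n f : (forall i, (i <= n)%N -> (f i <= dim y)%N) ->
    psi (act y n f) = act (psi y) n f.
  by move=> fy; apply: inj; rewrite psiK ss_act ?psiK // psi_dim.
exists (SSMap psi_dim psi_act); exists phi => //.
Qed.

Lemma pair_cont (T Y Z : topologicalType) (f : T -> Y) (g : T -> Z) :
  continuous f -> continuous g -> continuous (fun p => (f p, g p)).
Proof. by move=> cf cg p; apply: cvg_pair; [exact: cf | exact: cg]. Qed.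

Section SingMaps.
Variables (R : realType).

Section Map.
Variables (Y Z : topologicalType) (f : continuousType Y Z).

Definition sing_fun (x : Sing R Y) : Sing R Z :=
  Tagged (singular R Z) (f \o tagged x : singular R Z (tag x)).

Lemma sing_fun_dim x : dim (sing_fun x) = dim x. Proof. by []. Qed.

Lemma sing_fun_act x n g : (forall i, (i <= n)%N -> (g i <= dim x)%N) ->
  sing_fun (act x n g) = act (sing_fun x) n g.
Proof. by move=> _; congr Tagged; apply: singP. Qed.

Definition sing_map : ssmap (Sing R Y) (Sing R Z) := SSMap sing_fun_dim sing_fun_act.

End Map.

Lemma has_euler_homeo (Y Z : topologicalType) (f : Y -> Z) (g : Z -> Y) e :
  continuous f -> continuous g -> cancel f g -> cancel g f ->
  has_euler R Y e -> has_euler R Z e.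
Proof.
move=> cf cg fK gK [J [dg [z [mz eE]]]].
pose f' : continuousType Y Z := mkcts cf; pose g' : continuousType Z Y := mkcts cg.
exists J, dg, (fun j => lin (fun x => gen (sing_map f' x)) (z j)); split=> //.
apply: hmodel_bij mz; exists (sing_map g') => -[n s];
  by rewrite /= /sing_fun /=; congr Tagged; apply: singP => y /=; rewrite ?fK ?gK.
Qed.

Section Product.
Variables Y Z : topologicalType.

Lemma fst_cont : continuous (@fst Y Z).
Proof. by move=> p; exact: cvg_fst. Qed.

Lemma snd_cont : continuous (@snd Y Z).
Proof. by move=> p; exact: cvg_snd. Qed.

Let f1 : continuousType (Y * Z)%type Y := mkcts fst_cont.
Let f2 : continuousType (Y * Z)%type Z := mkcts snd_cont.

(** By the universal property of the product, this is an isomorphism of simplicial sets, which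
    brings [kunneth] to topological products. *)
Definition sing_split (x : Sing R (Y * Z)%type) : pset (Sing R Y) (Sing R Z) :=
  exist (fun p : Sing R Y * Sing R Z => is_true (dim p.1 == dim p.2))
    (sing_map f1 x, sing_map f2 x) (eqxx _).

Lemma sing_split_dim x : dim (sing_split x) = dim x. Proof. by []. Qed.

Lemma sing_split_act x n g : (forall i, (i <= n)%N -> (g i <= dim x)%N) ->
  sing_split (act x n g) = act (sing_split x) n g.
Proof.
by move=> gx; apply: val_inj; congr pair; apply: (@ss_act _ _ (sing_map _)).
Qed.

Definition split_map := SSMap sing_split_dim sing_split_act.

Lemma split_map_inj : injective split_map.
Proof.
move=> [n s] [m t] E.
have E1 := congr1 (fun u => (val u).1) E; have E2 := congr1 (fun u => (val u).2) E.
have nm : n = m by have := congr1 tag E1.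
case: m / nm t E1 E2 {E} => t /eqP E1 /eqP E2.
move: E1; rewrite -[_ == _]/(Tagged (singular R Y) _ == Tagged (singular R Y) _).
rewrite eq_Tagged => /eqP /continuousEP E1.
move: E2; rewrite -[_ == _]/(Tagged (singular R Z) _ == Tagged (singular R Z) _).
rewrite eq_Tagged => /eqP /continuousEP E2.
congr Tagged; apply: singP => y.
rewrite [LHS]surjective_pairing [RHS]surjective_pairing; congr pair.
  exact: E1.
exact: E2.
Qed.

Lemma split_map_surj y : exists x, split_map x = y.
Proof.
case: y => -[[n s] [m t]] /= nm; have E := eqP nm; rewrite /= in E.
case: m / E t nm => t nm.
have cst : continuous (fun p => (s p, t p)).
  by apply: pair_cont; exact: cts_fun.
exists (Tagged (singular R (Y * Z)%type) (mkcts cst : singular R (Y * Z)%type n)).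
apply: val_inj; congr pair; congr Tagged; exact: singP.
Qed.

Lemma has_euler_prod e e' : has_euler R Y e -> has_euler R Z e' ->
  has_euler R (Y * Z)%type (e * e').
Proof.
move=> [J [dg [z [mz ->]]]] [J' [dg' [z' [mz' ->]]]].
have [z2 mz2] := kunneth mz mz'.
have [psi psiB] := ssmap_inv split_map_inj split_map_surj.
exists (J * J')%type, (fun p => dg p.1 + dg' p.2)%N,
  (fun j => lin (fun x => gen (psi x)) (z2 j)).
split; first exact: hmodel_bij.
rewrite big_distrl /=.
under eq_bigr => j _ do rewrite big_distrr /=.
rewrite pair_bigA /=; apply: eq_bigr => p _.
by rewrite exprD.
Qed.

End Product.

Lemma has_euler_point (Y : topologicalType) (y0 : Y) :
  (forall y, y = y0) -> has_euler R Y 1.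
Proof.
move=> Y1.
have cc n : continuous (fun _ : @simplex R n => y0) by exact: cst_continuous.
pose cst n : singular R Y n := mkcts (cc n).
have all_eq (x x' : Sing R Y) : dim x = dim x' -> x = x'.
  case: x x' => [n s] [m t] /= nm; case: m / nm t => t.
  by congr Tagged; apply: singP => p; rewrite (Y1 (s p)) (Y1 (t p)).
pose pnt n : Sing R Y := Tagged (singular R Y) (cst n).
exists unit, (fun=> 0%N), (fun=> gen (pnt 0%N)); split; last by rewrite big_const card_unit.
(* There is one singular simplex in each dimension, so raising the dimension is a cone operator
   whose identities are all trivial. *)
have qe := @coned_qiso (Sing R Y) (fun x => pnt (dim x).+1) (pnt 0%N) (fun=> erefl).
have {}qe : qiso (diff (scplx (Sing R Y))) (fun _ : rat^o => 0) (lin (@augf (Sing R Y))).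
  by apply: qe => //; move=> *; apply: all_eq; rewrite ?dim_act //= ?dim_act.
have d0 : diff (scplx (Sing R Y)) (gen (pnt 0)) = 0 by rewrite diff_gen /= sbd0.
split=> //; first by move=> _; apply: supp_gen.
have fd a : lin (fun=> gen (pnt 0)) (diff (zcplx (fun _ : unit => 0%N)) a) =
   diff (scplx (Sing R Y)) (lin (fun=> gen (pnt 0)) a).
  rewrite diff_zcplx linear0; symmetry.
  elim/gen_ind1: a => [|l x a IH]; first by rewrite !linear0.
  by rewrite !linearP /= IH lin_gen d0 addr0 scaler0.
apply: (@qiso_cancel _ _ rat^o (diff (zcplx (fun _ : unit => 0%N)))
  (diff (scplx (Sing R Y))) (\0 : {linear rat^o -> rat^o})
  (lin (fun=> gen (pnt 0))) (lin (@augf (Sing R Y)))) => //.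
  exact: augf_diff.
have Ea a : lin (@augf (Sing R Y)) (lin (fun=> gen (pnt 0)) a) = cf tt a.
  elim/gen_ind1: a => [|l [] a IH]; first by rewrite !linear0.
  by rewrite !linearP /= IH !lin_gen cf_gen.
move=> a b _ /= ab.
have a0 : a = 0.
  by apply: gen_ext => -[]; rewrite linear0 -Ea ab.
exists (b *: gen tt), 0; split; first by rewrite a0; symmetry; apply: diff_zcplx.
by rewrite /= Ea linearZ /= cf_gen addr0 [RHS]mulr1.
Qed.

End SingMaps.

(** * Pairs of commuting labelled permutations *)

Section LabelledPairs.
Variable G : finGroupType.

(* [q i = ((s i, u i), (t i, v i))]: two permutations [s] and [t] with [G]-valued
   labels [u] and [v]. *)
Definition lperm (I : finType) := {ffun I -> (I * G) * (I * G)}.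

Section One.
Variable I : finType.
Implicit Types q : lperm I.

Definition sp q i := (q i).1.1.
Definition su q i := (q i).1.2.
Definition tp q i := (q i).2.1.
Definition tu q i := (q i).2.2.

(** The two maps [(i, x) |-> (s i, u i x)] and [(i, x) |-> (t i, v i x)] of [I * G] commute, over
    injective [s] and [t]. *)
Definition good q := [&& injectiveb (sp q), injectiveb (tp q),
  [forall i, sp q (tp q i) == tp q (sp q i)] &
  [forall i, (su q (tp q i) * tu q i == tu q (sp q i) * su q i)%g]].

Lemma goodP q : reflect
  [/\ injective (sp q), injective (tp q), (forall i, sp q (tp q i) = tp q (sp q i))
    & (forall i, su q (tp q i) * tu q i = tu q (sp q i) * su q i)%g] (good q).
Proof.
apply: (iffP and4P) => -[].
  by move=> /injectiveP a /injectiveP b /forallP c /forallP d; split=> // i; apply/eqP.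
by move=> a b c d; split; [exact/injectiveP|exact/injectiveP|apply/forallP => i|
  apply/forallP => i]; apply/eqP.
Qed.

(* Simultaneous conjugation by [c] in [G^I]. *)
Definition regauge (c : {ffun I -> G}) q : lperm I :=
  [ffun i => (((q i).1.1, c (q i).1.1 * (q i).1.2 * (c i)^-1),
              ((q i).2.1, c (q i).2.1 * (q i).2.2 * (c i)^-1))]%g.

End One.

Definition pull (I J : finType) (f : I -> J) (g : J -> I) (q : lperm J) : lperm I :=
  [ffun i => ((g (q (f i)).1.1, (q (f i)).1.2), (g (q (f i)).2.1, (q (f i)).2.2))].

Definition join (T C : finType) (q : lperm T) (q' : lperm C) : lperm (T + C)%type :=
  [ffun k => match k with
    | inl x => ((inl (q x).1.1, (q x).1.2), (inl (q x).2.1, (q x).2.2))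
    | inr y => ((inr (q' y).1.1, (q' y).1.2), (inr (q' y).2.1, (q' y).2.2))
    end].

Section Pull.
Variables (I J : finType) (f : I -> J) (g : J -> I).
Hypotheses (fK : cancel f g) (gK : cancel g f).

Lemma sp_pull q i : sp (pull f g q) i = g (sp q (f i)).
Proof. by rewrite /sp ffunE. Qed.
Lemma tp_pull q i : tp (pull f g q) i = g (tp q (f i)).
Proof. by rewrite /tp ffunE. Qed.
Lemma su_pull q i : su (pull f g q) i = su q (f i).
Proof. by rewrite /su ffunE. Qed.
Lemma tu_pull q i : tu (pull f g q) i = tu q (f i).
Proof. by rewrite /tu ffunE. Qed.

Lemma good_pull1 q : good q -> good (pull f g q).
Proof.
move=> /goodP[si ti st uv]; apply/goodP; split.
- by move=> i i'; rewrite !sp_pull => /(can_inj gK)/si/(can_inj fK).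
- by move=> i i'; rewrite !tp_pull => /(can_inj gK)/ti/(can_inj fK).
- by move=> i; rewrite !(sp_pull, tp_pull) !gK st.
- by move=> i; rewrite !(su_pull, tu_pull, sp_pull, tp_pull) !gK uv.
Qed.

End Pull.

Lemma pullK (I J : finType) (f : I -> J) (g : J -> I) : cancel g f ->
  cancel (pull f g) (pull g f).
Proof.
move=> gK q; apply/ffunP => j; rewrite !ffunE /= !gK.
by case: (q j) => -[? ?] [].
Qed.

Lemma good_pull (I J : finType) (f : I -> J) (g : J -> I) q :
  cancel f g -> cancel g f -> good (pull f g q) = good q.
Proof.
move=> fK gK; apply/idP/idP; last exact: good_pull1.
by move=> /(good_pull1 gK fK); rewrite (pullK gK).
Qed.

Lemma good_join (T C : finType) (q : lperm T) (q' : lperm C) :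
  good (join q q') = good q && good q'.
Proof.
have sl x : sp (join q q') (inl x) = inl (sp q x) by rewrite /sp ffunE.
have sr x : sp (join q q') (inr x) = inr (sp q' x) by rewrite /sp ffunE.
have tl x : tp (join q q') (inl x) = inl (tp q x) by rewrite /tp ffunE.
have tr x : tp (join q q') (inr x) = inr (tp q' x) by rewrite /tp ffunE.
have ul x : su (join q q') (inl x) = su q x by rewrite /su ffunE.
have ur x : su (join q q') (inr x) = su q' x by rewrite /su ffunE.
have vl x : tu (join q q') (inl x) = tu q x by rewrite /tu ffunE.
have vr x : tu (join q q') (inr x) = tu q' x by rewrite /tu ffunE.
apply/goodP/andP => [[si ti st uv]|[/goodP[si ti st uv] /goodP[si' ti' st' uv']]].
  split; apply/goodP; split=> x.
  - by move=> y E; have := si (inl x) (inl y); rewrite !sl E => /(_ erefl)[].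
  - by move=> y E; have := ti (inl x) (inl y); rewrite !tl E => /(_ erefl)[].
  - by have := st (inl x); rewrite !(sl, tl) => -[].
  - by have := uv (inl x); rewrite !(sl, tl, ul, vl).
  - by move=> y E; have := si (inr x) (inr y); rewrite !sr E => /(_ erefl)[].
  - by move=> y E; have := ti (inr x) (inr y); rewrite !tr E => /(_ erefl)[].
  - by have := st (inr x); rewrite !(sr, tr) => -[].
  - by have := uv (inr x); rewrite !(sr, tr, ur, vr).
split.
- by move=> [x|x] [y|y]; rewrite !(sl, sr) // => -[]; [move/si|move/si'] => ->.
- by move=> [x|x] [y|y]; rewrite !(tl, tr) // => -[]; [move/ti|move/ti'] => ->.
- by move=> [x|x]; rewrite !(sl, sr, tl, tr) ?st ?st'.
- by move=> [x|x]; rewrite !(sl, sr, tl, tr, ul, ur, vl, vr) ?uv ?uv'.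
Qed.

(* The shape of an orbit of two commuting permutations: [(a, b)] stands for
   [s^a (t^b i0)], where [d.+1] is the size of the [s]-orbit of [i0] and
   [t^(m.+1) i0 = s^j i0] is its first return to that orbit. *)
Definition torus d m := ('I_d.+1 * 'I_m.+1)%type.

Section Torus.
Variables (d m : nat) (j : 'I_d.+1).

Definition torS (x : torus d m) : torus d m := (ordS x.1, x.2).
Definition torT (x : torus d m) : torus d m :=
  (if x.2 == ord_max then inord ((x.1 + j) %% d.+1) else x.1, ordS x.2).
Definition tor0 : torus d m := (ord0, ord0).

Definition eqv (I : finType) (psi : torus d m -> I) (q : lperm I) :=
  [forall x, (psi (torS x) == sp q (psi x)) && (psi (torT x) == tp q (psi x))].

End Torus.

(** * Parametrization of an orbit by a twisted torus *)

Section OrbitParam.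
Variables (I : finType) (s t : I -> I) (i0 : I).
Hypotheses (si : injective s) (ti : injective t) (st : forall i, s (t i) = t (s i)).

Lemma iter_st a b i : iter a s (iter b t i) = iter b t (iter a s i).
Proof.
have st1 a' i' : iter a' s (t i') = t (iter a' s i') by elim: a' => //= a' ->.
by elim: b => //= b IH; rewrite st1 IH.
Qed.

Lemma iter_inj (f : I -> I) n : injective f -> injective (iter n f).
Proof. by move=> fi; elim: n => //= n IH i i' /fi/IH. Qed.

Let D := fingraph.order s i0.

Lemma ex_ret : exists b, (0 < b)%N && fconnect s i0 (iter b t i0).
Proof. by exists (fingraph.order t i0); rewrite fingraph.order_gt0 iter_order ?connect0. Qed.

Let M := ex_minn ex_ret.
Let J := findex s i0 (iter M t i0).

Lemma retM : (0 < M)%N /\ iter M t i0 = iter J s i0.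
Proof.
by rewrite /J /M; case: ex_minnP => b /andP[b0 sb] _; rewrite iter_findex.
Qed.

Lemma iter_mod a : iter (a %% D)%N s i0 = iter a s i0.
Proof.
rewrite [in RHS](divn_eq a D) addnC iterD; congr iter.
elim: (a %/ D)%N => //= k IH; rewrite mulSn iterD -IH.
by rewrite iter_order.
Qed.

Lemma minM b : (0 < b < M)%N -> ~~ fconnect s i0 (iter b t i0).
Proof.
rewrite {1}/M; case: ex_minnP => c _ minc /andP[b0 bc]; apply/negP => sb.
by have := minc b; rewrite b0 sb => /(_ isT); rewrite leqNgt bc.
Qed.

Lemma J_lt : (J < D)%N.
Proof. by apply: findex_max; have [_ ->] := retM; apply: fconnect_iter. Qed.

Section Uniq.
Variables (d m : nat) (j : 'I_d.+1) (psi : torus d m -> I).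
Hypotheses (psi_inj : injective psi) (psi0 : psi (tor0 d m) = i0).
Hypothesis psiS : forall x, psi (torS x) = s (psi x).
Hypothesis psiT : forall x, psi (torT j x) = t (psi x).

Lemma psi_iter (x : torus d m) : psi x = iter x.1 s (iter x.2 t i0).
Proof.
case: x => -[a ad] [b bm] /=.
elim: a ad => [|a IHa] ad /=; last first.
  rewrite -(IHa (ltnW ad)) -psiS; congr (psi (_, _)).
  by apply: val_inj; rewrite /= modn_small.
elim: b bm => [|b IHb] bm /=.
  by rewrite -psi0; congr (psi (_, _)); apply: val_inj.
rewrite -(IHb (ltnW bm)) -psiT; congr (psi (_, _)); apply: val_inj => /=.
  by case: eqP => // /(congr1 val) /= E; rewrite E ltnn in bm.
by rewrite modn_small.
Qed.

Lemma iterS_ret b : (b <= m)%N -> iter d.+1 s (iter b t i0) = iter b t i0.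
Proof.
move=> bm; have := psiS (ord_max, inord b).
rewrite !psi_iter /= inordK ?ltnS // modnn /= => {2}->.
by [].
Qed.

(** The closing of the torus bounds the [s]-orbit of [i0] by [d.+1], and injectivity of [psi]
    prevents it from being shorter. *)
Lemma order_d : D = d.+1.
Proof.
apply/eqP; rewrite eqn_leq; apply/andP; split.
  rewrite leqNgt; apply/negP => dD.
  have := findex_iter dD; rewrite (iterS_ret (b := 0)) // findex0 => E.
  by [].
rewrite leqNgt; apply/negP => Dd.
have E : psi (inord D, ord0) = psi (ord0, ord0).
  by rewrite !psi_iter /= inordK //= iter_order.
have [/(congr1 val)] := psi_inj E; rewrite /= inordK // => D0.
by have := fingraph.order_gt0 s i0; rewrite -/D D0.
Qed.

Lemma iterT_ret : iter m.+1 t i0 = iter j s i0.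
Proof.
have := psiT (ord0, ord_max); rewrite !psi_iter /= eqxx modnn /= add0n => <-.
by rewrite inordK ?modn_small.
Qed.

(** The torus returns to the [s]-orbit at [m.+1]; an earlier return would give the points [(0, M)]
    and [(J, 0)] of the torus the same image. *)
Lemma ret_m : M = m.+1.
Proof.
apply/eqP; rewrite eqn_leq; apply/andP; split.
  by rewrite leqNgt; apply/negP => mM; have := @minM m.+1;
    rewrite mM iterT_ret fconnect_iter => /(_ isT).
rewrite leqNgt; apply/negP => Mm; have [M0 ME] := retM.
have Jd : (J < d.+1)%N by rewrite -order_d J_lt.
have E : psi (ord0, inord M) = psi (inord J, ord0).
  by rewrite !psi_iter /= !inordK.
have [_ /(congr1 val)] := psi_inj E; rewrite /= inordK // => M00.
by rewrite M00 in M0.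
Qed.

Lemma ret_j : J = j.
Proof.
have [_ ME] := retM; rewrite ret_m iterT_ret in ME.
rewrite /J ret_m iterT_ret findex_iter //.
by rewrite -/D order_d.
Qed.

End Uniq.

Lemma orbit_param : exists (d m : 'I_#|I|) (j : 'I_d.+1) (psi : {ffun torus d m -> I}),
  [/\ injective psi, psi (tor0 d m) = i0, forall x, psi (torS x) = s (psi x)
    & forall x, psi (torT j x) = t (psi x)].
Proof.
have [M0 ME] := retM.
have D0 : (0 < D)%N by apply: fingraph.order_gt0.
have DE : D = D.-1.+1 by rewrite prednK.
have MEq : M = M.-1.+1 by rewrite prednK.
have DI : (D.-1 < #|I|)%N by rewrite -DE; apply: max_card.
have MI : (M.-1 < #|I|)%N.
  rewrite -MEq /M; case: ex_minnP => b _ minb.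
  apply: leq_trans (minb (fingraph.order t i0) _) (max_card _).
  by rewrite fingraph.order_gt0 iter_order //= connect0.
have JD : (J < D.-1.+1)%N by rewrite -DE J_lt.
have mod' c : iter (c %% D.-1.+1)%N s i0 = iter c s i0 by rewrite -DE iter_mod.
pose psi := [ffun x : torus D.-1 M.-1 => iter x.1 s (iter x.2 t i0)].
have psiE x : psi x = iter x.1 s (iter x.2 t i0) by rewrite ffunE.
exists (Ordinal DI), (Ordinal MI), (Ordinal JD), psi; split.
(* After cancelling the common power of [t], a positive difference of second coordinates would be a
   return to the [s]-orbit before the first one. *)
- have inj1 (x y : torus D.-1 M.-1) : (x.2 <= y.2)%N -> psi x = psi y -> x = y.
    move=> xy; rewrite !psiE -[in RHS](subnKC xy) iterD !iter_st.
    move/(iter_inj ti); rewrite -iter_st => E.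
    have yx : x.2 = y.2.
      apply/val_inj/eqP; rewrite /= eqn_leq xy -subn_eq0 -leqn0 leqNgt; apply/negP => y0.
      have yM : (0 < y.2 - x.2 < M)%N.
        rewrite y0 /=; apply: leq_ltn_trans (leq_subr _ _) _.
        by apply: leq_trans (ltn_ord y.2) _; rewrite prednK.
      have /negP := minM yM; apply.
      apply: (@connect_trans _ _ (iter x.1 s i0)); first exact: fconnect_iter.
      by rewrite E fconnect_sym // fconnect_iter.
    rewrite yx subnn /= in E; rewrite [x]surjective_pairing yx [y]surjective_pairing /=.
    congr pair; apply: val_inj => /=.
    have zD (z : torus D.-1 M.-1) : (z.1 < D)%N.
      by apply: leq_trans (ltn_ord z.1) _; rewrite prednK.
    by rewrite -(findex_iter (zD x)) -(findex_iter (zD y)) E.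
  move=> x y E; have [xy|/ltnW yx] := leqP x.2 y.2; first exact: inj1.
  by symmetry; apply: inj1.
- by rewrite psiE.
- by case=> a b; rewrite !psiE /= -iterS !iter_st mod'.
case=> a b; rewrite !psiE /=.
have -> : t (iter a s (iter b t i0)) = iter a s (iter b.+1 t i0).
  by rewrite !iter_st.
case: eqP => [->|/eqP bm] /=.
  rewrite modnn /= inordK ?ltn_mod // mod' iterD -ME.
  by congr (iter _ s _); rewrite -[RHS]iterS prednK.
rewrite modn_small // ltn_neqAle ltn_ord andbT eqSS.
exact: bm.
Qed.

End OrbitParam.
End LabelledPairs.

Lemma inj_extend (T I : finType) (psi : T -> I) c :
  injective psi -> c = (#|I| - #|T|)%N ->
  exists (f : T + 'I_c -> I) g,
    [/\ cancel f g, cancel g f & forall x, f (inl x) = psi x].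
Proof.
move=> pi cE; pose C := [set i | i \notin codom psi].
have cC : c = #|C|.
  rewrite cE -(card_codom pi) -[#|I|](cardC (mem (codom psi))) addKn.
  by apply: eq_card => i; rewrite !inE.
pose f (k : T + 'I_c) := match k with
  | inl x => psi x | inr y => enum_val (cast_ord cC y) end.
have CP y : enum_val (cast_ord cC y) \notin codom psi.
  by have := enum_valP (cast_ord cC y); rewrite inE.
have fi : injective f.
  move=> [x|y] [x'|y'] /= E.
  - by rewrite (pi _ _ E).
  - by have := CP y'; rewrite -E codom_f.
  - by have := CP y; rewrite E codom_f.
  - by congr inr; apply: (@cast_ord_inj _ _ cC); apply: enum_val_inj.
have [g fK gK] : bijective f.
  apply: inj_card_bij fi _; rewrite card_sum card_ord cE subnKC //.
  exact: leq_card pi.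
by exists f, g.
Qed.

(** * Weighted counting of labelled pairs *)

Section Counting.
Variables (G : finGroupType) (W : forall I : finType, lperm G I -> int).
Hypothesis W_pull : forall (I J : finType) (f : I -> J) (g : J -> I) (q : lperm G J),
  cancel f g -> cancel g f -> good q -> W (pull f g q) = W q.
Hypothesis W_join : forall (T C : finType) (q : lperm G T) (q' : lperm G C),
  good q -> good q' -> W (join q q') = W q * W q'.

Definition torq d m (j : 'I_d.+1) (w : {ffun torus d m -> G * G}) : lperm G (torus d m) :=
  [ffun x => ((torS x, (w x).1), (torT j x, (w x).2))].

(* A point [i0] lies on exactly one orbit, with exactly one parametrization
   starting at [i0]. *)
Lemma pointed_unique (I : finType) (q : lperm G I) i0 : good q ->
  (\sum_(d < #|I|) \sum_(m < #|I|) \sum_(j < d.+1) \sum_(psi : {ffun torus d m -> I})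
    [&& injectiveb psi, psi (tor0 d m) == i0 & eqv j psi q] = 1)%N.
Proof.
move=> /goodP[si ti st _].
have U d m (j : 'I_d.+1) (psi : {ffun torus d m -> I}) :
    [&& injectiveb psi, psi (tor0 d m) == i0 & eqv j psi q] ->
    [/\ fingraph.order (sp q) i0 = d.+1, ex_minn (ex_ret (sp q) i0 ti) = m.+1,
        findex (sp q) i0 (iter (ex_minn (ex_ret (sp q) i0 ti)) (tp q) i0) = j
      & forall x, psi x = iter x.1 (sp q) (iter x.2 (tp q) i0)].
  case/and3P => /injectiveP pi /eqP p0 /forallP pe.
  have pS x : psi (torS x) = sp q (psi x) by have /andP[/eqP] := pe x.
  have pT x : psi (torT j x) = tp q (psi x) by have /andP[_ /eqP] := pe x.
  split.
  - exact: (order_d si pi p0 pS pT).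
  - exact: (ret_m si ti pi p0 pS pT).
  - exact: (ret_j si ti pi p0 pS pT).
  - exact: (psi_iter p0 pS pT).
have [d [m [j [psi [pi p0 pS pT]]]]] := orbit_param i0 si ti st.
have P0 : [&& injectiveb psi, psi (tor0 d m) == i0 & eqv j psi q].
  apply/and3P; split; [exact/injectiveP|exact/eqP|].
  by apply/forallP => x; rewrite pS pT !eqxx.
have [Ed Em Ej Ep] := U _ _ _ _ P0.
rewrite (bigD1 d) //= [X in (_ + X)%N]big1 ?addn0 => [|d' /eqP dd']; last first.
  do 3 (rewrite big1 // => ? _); apply/eqP; rewrite eqb0; apply/negP => /U[E _ _ _].
  by apply: dd'; apply: val_inj; move: E; rewrite Ed => -[].
rewrite (bigD1 m) //= [X in (_ + X)%N]big1 ?addn0 => [|m' /eqP mm']; last first.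
  do 2 (rewrite big1 // => ? _); apply/eqP; rewrite eqb0; apply/negP => /U[_ E _ _].
  by apply: mm'; apply: val_inj; move: E; rewrite Em => -[].
rewrite (bigD1 j) //= [X in (_ + X)%N]big1 ?addn0 => [|j' /eqP jj']; last first.
  rewrite big1 // => ? _; apply/eqP; rewrite eqb0; apply/negP => /U[_ _ E _].
  by apply: jj'; apply: val_inj; rewrite /= -E -Ej.
rewrite (bigD1 psi) //= P0 [X in (_ + X)%N]big1 ?addn0 // => psi' /eqP pp'.
apply/eqP; rewrite eqb0; apply/negP => /U[_ _ _ E].
by apply: pp'; apply/ffunP => x; rewrite E Ep.
Qed.

(** Double counting of pairs with a marked point. By [pointed_unique] the marked point may be
    replaced by a parametrization of its orbit, from which it is read off as the image of the
    corner. *)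
Lemma sum_pointed (I : finType) :
  (\sum_(q : lperm G I | good q) W q) *+ #|I| =
  \sum_(d < #|I|) \sum_(m < #|I|) \sum_(j < d.+1)
    \sum_(psi : {ffun torus d m -> I} | injectiveb psi)
      \sum_(q | good q && eqv j psi q) W q.
Proof.
transitivity (\sum_(q : lperm G I | good q) \sum_(i0 : I)
    \sum_(d < #|I|) \sum_(m < #|I|) \sum_(j < d.+1) \sum_(psi : {ffun torus d m -> I})
      if [&& injectiveb psi, psi (tor0 d m) == i0 & eqv j psi q] then W q else 0).
  rewrite -sumrMnl; apply: eq_bigr => q gq.
  rewrite -sumr_const; apply: eq_bigr => i0 _.
  rewrite -[LHS]mulr1 -[1 in LHS](_ : 1%N%:R = _) // -(pointed_unique i0 gq).
  do 4 (rewrite natr_sum mulr_sumr; apply: eq_bigr => ? _).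
  by case: ifP => _; rewrite ?mulr1 ?mulr0.
rewrite exchange_big /=.
under eq_bigr => i0 _ do rewrite exchange_big /=.
rewrite exchange_big /=; apply: eq_bigr => d _.
under eq_bigr => i0 _ do rewrite exchange_big /=.
rewrite exchange_big /=; apply: eq_bigr => m _.
under eq_bigr => i0 _ do rewrite exchange_big /=.
rewrite exchange_big /=; apply: eq_bigr => j _.
under eq_bigr => i0 _ do rewrite exchange_big /=.
rewrite exchange_big /= [RHS]big_mkcond /=; apply: eq_bigr => psi _.
rewrite exchange_big /=; case: (boolP (injectiveb psi)) => /= pi; last first.
  by rewrite big1 // => q _; rewrite big1.
rewrite [RHS]big_mkcondr /=; apply: eq_bigr => q _.
rewrite (bigD1 (psi (tor0 d m))) //= eqxx /= big1 ?addr0 // => i /negbTE.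
by rewrite eq_sym => ->.
Qed.

Lemma torS_inj d m : injective (@torS d m).
Proof.
move=> [a b] [a' b'] E.
have /(can_inj (@ordSK _)) /= -> := congr1 fst E.
by have /= -> := congr1 snd E.
Qed.

Lemma torT_inj d m (j : 'I_d.+1) : injective (@torT d m j).
Proof.
move=> [a b] [a' b'] E.
have /(can_inj (@ordSK _)) /= bb' := congr1 snd E.
move: E; rewrite -bb' => /(congr1 fst) /=; case: eqP => _ [E]; last by rewrite E.
congr pair; apply/val_inj/eqP; move/(congr1 val): E => /=.
rewrite !inordK ?ltn_mod // => /eqP; rewrite eqn_modDr.
by rewrite !modn_small.
Qed.

Section Split.
Variables (d m : nat) (j : 'I_d.+1) (C : finType).
Implicit Types q : lperm G (torus d m + C)%type.

Definition lpart q : {ffun torus d m -> G * G} :=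
  [ffun x => (su q (inl x), tu q (inl x))].

(** The default [y] only makes [str] total: as the torus is stable under injective maps that permute
    it, its complement is stable too, and [join_parts] never meets the default. *)
Definition rpart q : lperm G C :=
  let str y0 (k : torus d m + C) := if k is inr y then y else y0 in
  [ffun y => ((str y (sp q (inr y)), su q (inr y)),
              (str y (tp q (inr y)), tu q (inr y)))].

Lemma join_parts q : good q -> eqv j inl q -> join (torq j (lpart q)) (rpart q) = q.
Proof.
move=> /goodP[si ti st uv] /forallP e.
have eS x : sp q (inl x) = inl (torS x) by have /andP[/eqP] := e x.
have eT x : tp q (inl x) = inl (torT j x) by have /andP[_ /eqP] := e x.
apply/ffunP => -[x|y]; do ?rewrite ffunE /=.
  rewrite -eS -eT /sp /su /tp /tu.
  by case: (q _) => -[? ?] [].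
have strE (r : torus d m -> torus d m) (p : torus d m + C -> torus d m + C) :
    injective r -> injective p -> (forall x, p (inl x) = inl (r x)) ->
    inr (if p (inr y) is inr y' then y' else y) = p (inr y).
  move=> ri pi pr; case E: (p (inr y)) => [x|//].
  have [g _ gK] := injF_bij ri.
  by have := @pi (inl (g x)) (inr y); rewrite pr gK E => /(_ erefl).
rewrite (strE _ _ (@torS_inj d m) si eS) (strE _ _ (@torT_inj d m j) ti eT).
by rewrite /sp /su /tp /tu; case: (q _) => -[? ?] [].
Qed.

Lemma sum_split :
  \sum_(q : lperm G (torus d m + C)%type | good q && eqv j inl q) W q =
  (\sum_(w : {ffun torus d m -> G * G} | good (torq j w)) W (torq j w)) *
  \sum_(q : lperm G C | good q) W q.
Proof.
pose h (p : {ffun torus d m -> G * G} * lperm G C) := join (torq j p.1) p.2.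
pose h' q := (lpart q, rpart q).
have h'h p : h' (h p) = p.
  case: p => w q; rewrite /h' /h; congr pair; apply/ffunP => x.
    by rewrite /lpart /su /tu; do ?rewrite ffunE /=; case: (w x).
  by rewrite /rpart /sp /tp /su /tu; do ?rewrite ffunE /=; case: (q x) => -[? ?] [].
rewrite (reindex_onto h h') /= => [|q /andP[gq eq]]; last exact: join_parts.
rewrite big_distrl /=.
under [RHS]eq_bigr => w _ do rewrite big_distrr /=.
rewrite pair_big_dep /=.
apply: eq_big => [[w q]|[w q] /andP[/andP[]]] /=.
  rewrite h'h eqxx andbT /h good_join /= -andbA.
  have -> : eqv j inl (join (torq j w) q).
    by apply/forallP => x; rewrite /sp /tp; do ?rewrite ffunE /=; rewrite !eqxx.
  by rewrite andbT.
by rewrite /h good_join /= => /andP[gw gq] _ _; rewrite W_join.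
Qed.

End Split.

(** Extending [psi] to a bijection from the disjoint union of the torus and a numbered complement
    reduces to the inclusion [inl], so the value does not depend on [psi]. *)
Lemma sum_eqv (I : finType) d m (j : 'I_d.+1) (psi : {ffun torus d m -> I}) :
  injective psi ->
  \sum_(q : lperm G I | good q && eqv j psi q) W q =
  (\sum_(w : {ffun torus d m -> G * G} | good (torq j w)) W (torq j w)) *
  \sum_(q : lperm G 'I_(#|I| - d.+1 * m.+1) | good q) W q.
Proof.
move=> pi; rewrite -sum_split.
have [f [g [fK gK fl]]] : exists (f : torus d m + 'I_(#|I| - d.+1 * m.+1) -> I) g,
    [/\ cancel f g, cancel g f & forall x, f (inl x) = psi x].
  by apply: inj_extend => //; rewrite card_prod !card_ord.
have fi := can_inj fK.
rewrite (reindex (pull g f)) /=; last first.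
  by apply: onW_bij; exists (pull f g); apply: pullK.
apply: eq_big => [q|q]; last first.
  by rewrite (good_pull _ gK fK) => /andP[gq _]; apply: W_pull.
rewrite (good_pull _ gK fK); congr (_ && _); apply: eq_forallb => x.
by rewrite sp_pull tp_pull -!fl fK !(inj_eq fi).
Qed.

(** * Gauge fixing on the twisted torus *)

Section TorusSum.
Variables (d m : nat) (j : 'I_d.+1).
Local Notation T := (torus d m).
Implicit Types (w : {ffun T -> G * G}) (c : {ffun T -> G}) (x : T).

Lemma torST x : torS (torT j x) = torT j (torS x).
Proof.
case: x => a b; rewrite /torS /torT /=; congr pair; case: eqP => // _.
by apply: val_inj; rewrite /= !inordK ?ltn_mod // -addn1 modnDml addn1 modnDml addSn.
Qed.

(** Seen as a discrete connection on the torus, [w] has trivial holonomy around every unit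
    square. *)
Definition flat w := [forall x, ((w (torT j x)).1 * (w x).2 == (w (torS x)).2 * (w x).1)%g].

Lemma good_torq w : good (torq j w) = flat w.
Proof.
rewrite /good /flat.
have -> : injectiveb (sp (torq j w)).
  by apply/injectiveP => x y; rewrite /sp !ffunE; apply: torS_inj.
have -> : injectiveb (tp (torq j w)).
  by apply/injectiveP => x y; rewrite /tp !ffunE; apply: torT_inj.
have -> : [forall i, sp (torq j w) (tp (torq j w) i) == tp (torq j w) (sp (torq j w) i)].
  by apply/forallP => x; rewrite /sp /tp; do ?rewrite ffunE /=; rewrite torST.
by apply: eq_forallb => x; rewrite /sp /tp /su /tu; do ?rewrite ffunE /=.
Qed.

Definition gw c w : {ffun T -> G * G} :=
  [ffun x : T => (c (torS x) * (w x).1 * (c x)^-1, c (torT j x) * (w x).2 * (c x)^-1)%g].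

Lemma regauge_torq c w : regauge c (torq j w) = torq j (gw c w).
Proof. by apply/ffunP => x; do ?rewrite ffunE /=. Qed.

Lemma flat_gw c w : flat (gw c w) = flat w.
Proof.
apply: eq_forallb => x; do ?rewrite ffunE /=; rewrite torST !mulgA !mulgKV.
by rewrite (inj_eq (mulIg _)) -!mulgA (inj_eq (mulgI _)).
Qed.

Definition cinv c : {ffun T -> G} := [ffun x => (c x)^-1%g].

Lemma gwK c w : gw c (gw (cinv c) w) = w.
Proof.
apply/ffunP => x; do ?rewrite ffunE /=.
by rewrite !invgK !mulgA !mulgV !mul1g !mulgK; case: (w x).
Qed.

Lemma gwVK c w : gw (cinv c) (gw c w) = w.
Proof.
apply/ffunP => x; do ?rewrite ffunE /=.
by rewrite !invgK !mulgA !mulVg !mul1g !mulgKV; case: (w x).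
Qed.

(* The labels can be gauged away except along the seams of the torus, where they
   are [g] and [h]; crossing the twisted corner costs an additional [g]. *)
Definition model (g h : G) : {ffun T -> G * G} :=
  [ffun x : T => (if x.1 == ord_max then g else 1%g,
              if x.2 == ord_max then (if (d < x.1 + j)%N then (g * h)%g else h) else 1%g)].

(** Parallel transport from the corner to [(a, b)]: [b] steps in the [t] direction along the column
    [0], then [a] steps in the [s] direction. These paths form a spanning tree. *)
Fixpoint holv w (b : nat) : G :=
  if b is b'.+1 then ((w (ord0, inord b')).2 * holv w b')%g else 1%g.
Fixpoint holu w (b : 'I_m.+1) (a : nat) : G :=
  if a is a'.+1 then ((w (inord a', b)).1 * holu w b a')%g else holv w b.
Definition hol w : {ffun T -> G} := [ffun x : T => holu w x.2 x.1].

Lemma neq_max n (i : 'I_n.+1) : (i != ord_max) = (i < n)%N.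
Proof. by rewrite ltn_neqAle -ltnS ltn_ord andbT -val_eqE. Qed.

Lemma ordS_max n : ordS (@ord_max n) = ord0.
Proof. by apply: val_inj; rewrite /= modnn. Qed.

(** Triviality of the labels on the edges of the spanning tree. *)
Definition normalized w :=
  (forall a b, a != ord_max -> (w (a, b)).1 = 1%g) /\
  (forall b, b != ord_max -> (w (ord0, b)).2 = 1%g).

Lemma hol_normalized w : normalized (gw (cinv (hol w)) w).
Proof.
split=> [a b|b]; rewrite neq_max => am; do ?rewrite ffunE /=.
  by rewrite invgK modn_small //= inord_val -mulgA mulVg.
rewrite invgK.
have bmax : (b == ord_max) = false by apply/negbTE; rewrite neq_max.
rewrite bmax /= modn_small //= inord_val.
by rewrite -mulgA mulVg.
Qed.

(** Flatness propagates the labels from the tree square by square: [t]-labels are trivial below the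
    last row, and [s]-labels on the last column are all [g]. The square at [(ord_max, ord_max)]
    yields the commutation of [g] and [h]. *)
Lemma normalized_model w : flat w -> normalized w ->
  let g := (w (ord_max, ord0)).1 in let h := (w (ord0, ord_max)).2 in
  w = model g h /\ (g * h = h * g)%g.
Proof.
move=> /forallP fl [nu nv] g h.
have {}fl x : ((w (torT j x)).1 * (w x).2 = (w (torS x)).2 * (w x).1)%g.
  exact/eqP.
have v1 (a : 'I_d.+1) (b : 'I_m.+1) : b != ord_max -> (w (a, b)).2 = 1%g.
  move=> bm; case: a => a; elim: a => [|a IH] ad.
    by rewrite -(nv b bm); congr (w (_, _)).2; apply: val_inj.
  have := fl (Ordinal (ltnW ad), b); rewrite /torT /torS /= (negbTE bm).
  have am : Ordinal (ltnW ad) != ord_max by rewrite neq_max.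
  rewrite !nu // IH !mulg1 => ->; congr (w (_, _)).2.
  by apply: val_inj; rewrite /= modn_small.
have u1 (b : 'I_m.+1) : (w (ord_max, b)).1 = g.
  case: b => b; elim: b => [|b IH] bm.
    by congr (w (_, _)).1; apply: val_inj.
  have bm' : Ordinal (ltnW bm) != ord_max by rewrite neq_max.
  have := fl (ord_max, Ordinal (ltnW bm)); rewrite /torT /torS /= (negbTE bm').
  rewrite !v1 // mulg1 IH mul1g => <-; congr (w (_, _)).1.
  by apply: val_inj; rewrite /= modn_small.
have uE a b : (w (a, b)).1 = if a == ord_max then g else 1%g.
  by case: eqP => [->|/eqP/nu//]; rewrite u1.
(* Along the last row the factor [g] is acquired once, at the square with [a + j = d], whose twisted
   image lies on the seam column. *)
have vm (a : 'I_d.+1) : (w (a, ord_max)).2 = if (d < a + j)%N then (g * h)%g else h.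
  case: a => a; elim: a => [|a IH] ad.
    have -> : (d < Ordinal ad + j)%N = false by rewrite /= add0n ltnNge -ltnS ltn_ord.
    by rewrite /h; congr (w (_, _)).2; apply: val_inj.
  have am : Ordinal (ltnW ad) != ord_max by rewrite neq_max.
  have := fl (Ordinal (ltnW ad), ord_max); rewrite /torT /torS /= eqxx.
  rewrite (nu (Ordinal (ltnW ad))) // mulg1 IH => E.
  have -> : Ordinal ad = ordS (Ordinal (ltnW ad)).
    by apply: val_inj; rewrite /= modn_small.
  rewrite -E uE -val_eqE /= inordK ?ltn_mod //.
  have jd := ltn_ord j.
  have [aj|aj] := ltnP d (a + j).
    rewrite addSn ltnS (ltnW aj) ifN ?mul1g //.
    have -> : (a + j = a + j - d.+1 + d.+1)%N by rewrite subnK.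
    rewrite modnDr modn_small; lia.
  rewrite modn_small // addSn ltnS leq_eqVlt eq_sym [(d < a + j)%N]ltnNge aj orbF.
  by case: eqP; rewrite ?mul1g.
split.
  apply/ffunP => -[a b]; rewrite ffunE [LHS]surjective_pairing /= uE.
  by congr pair; case: eqP => [->|/eqP/v1//]; rewrite vm.
have := fl (ord_max, ord_max); rewrite /torT /torS /= eqxx !ordS_max -/h u1 => <-.
rewrite vm uE -val_eqE /= inordK ?ltn_mod //.
case: (posnP j) => [->|j0].
  by rewrite addn0 modn_small // eqxx ltnn.
have jd := ltn_ord j.
have -> : (d + j = j.-1 + d.+1)%N by lia.
rewrite modnDr modn_small; last by lia.
rewrite ifN; last by lia.
rewrite mul1g ifT //; lia.
Qed.

Lemma flat_model g h : (g * h = h * g)%g -> flat (model g h).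
Proof.
move=> gh; apply/forallP => -[a b]; do ?rewrite ffunE /=.
case: (eqVneq b ord_max) => [_|bm]; last by rewrite mulg1 mul1g.
have jd := ltn_ord j; have ad := ltn_ord a.
have jd0 : (d < j)%N = false by lia.
rewrite -!val_eqE /= inordK ?ltn_mod //.
have [->|am] := eqVneq (val a) d.
  rewrite modnn add0n jd0; case: (posnP j) => [->|j0].
    by rewrite addn0 modn_small // eqxx ltnn gh.
  have -> : (d + j = j.-1 + d.+1)%N by lia.
  rewrite modnDr modn_small; last by lia.
  rewrite ifN; last by lia.
  by rewrite mul1g ifT ?gh //; lia.
have {}am : (a < d)%N by rewrite ltn_neqAle am -ltnS.
rewrite [in X in _ == X]modn_small // mulg1 addSn ltnS.
have [aj|aj] := ltnP d (a + j).
  rewrite (ltnW aj) ifN ?mul1g //.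
  have -> : (a + j = a + j - d.+1 + d.+1)%N by rewrite subnK.
  rewrite modnDr modn_small; lia.
rewrite modn_small // [(d <= _)%N]leq_eqVlt [(d < a + j)%N]ltnNge aj orbF.
by rewrite [(d == _)%N]eq_sym; case: ifP; rewrite ?mul1g.
Qed.

(** The model being trivial on the tree, transport telescopes to [c] at the end point times the
    inverse of [c] at the corner. Hence a gauge based at [1] can be recovered from the labels. *)
Lemma hol_gw c g h : c (tor0 d m) = 1%g -> hol (gw c (model g h)) = c.
Proof.
move=> c0; apply/ffunP => -[a b]; rewrite ffunE /=.
have hv (b' : nat) : (b' < m.+1)%N -> holv (gw c (model g h)) b' = c (ord0, inord b').
  elim: b' => [|b' IH] bm /=.
    by rewrite -c0; congr (c (_, _)); apply: val_inj; rewrite /= inordK.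
  rewrite IH ?(ltnW bm) //; do ?rewrite ffunE /=.
  have bmax : (inord b' == ord_max :> 'I_m.+1) = false.
    by apply/negbTE; rewrite neq_max inordK // ltnW.
  rewrite bmax mulg1 mulgKV; congr (c _); rewrite /torT /= bmax; congr pair.
  by apply: val_inj; rewrite /= !inordK // ?modn_small // ltnW.
case: a => a; elim: a => [|a IH] ad /=.
  by rewrite hv // inord_val; congr (c (_, _)); apply: val_inj.
rewrite IH ?(ltnW ad) // => ad'; do ?rewrite ffunE /=.
have -> : (inord a == ord_max :> 'I_d.+1) = false.
  by apply/negbTE; rewrite neq_max inordK // ltnW.
rewrite mulg1; have -> : inord a = Ordinal ad' :> 'I_d.+1.
  by apply: val_inj; rewrite /= inordK.
rewrite mulgKV; congr (c (_, _)).
by apply: val_inj; rewrite /= modn_small.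
Qed.

End TorusSum.

Variable chi : G -> G -> int.
Hypothesis W_torus : forall d m (j : 'I_d.+1) (c : {ffun torus d m -> G}) g h,
  (g * h = h * g)%g -> W (regauge c (torq j (model m j g h))) = chi g h.

(** A constant gauge only conjugates [g] and [h]; the condition at the corner removes this
    ambiguity. *)
Definition based_gauges d m := #|[pred c : {ffun torus d m -> G} | c (tor0 d m) == 1%g]|.

(** Right multiplication by [a] carries the gauges equal to [1] at the corner to those equal to [a]
    there. *)
Lemma card_based_gauges d m : (#|G| * based_gauges d m = #|G| ^ (d.+1 * m.+1))%N.
Proof.
have <- : #|{: {ffun torus d m -> G}}| = (#|G| ^ (d.+1 * m.+1))%N.
  by rewrite card_ffun card_prod !card_ord.
rewrite -[RHS]sum1_card (partition_big (fun c : {ffun torus d m -> G} => c (tor0 d m)) predT) //=.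
rewrite -[#|G| in LHS]sum1_card big_distrl /=; apply: eq_bigr => a _.
rewrite mul1n /based_gauges -sum1_card.
pose h (a : G) (c : {ffun torus d m -> G}) := [ffun x => (c x * a)%g].
rewrite (reindex (h a^-1%g)) /=; last first.
  by exists (h a) => c _; apply/ffunP => x; rewrite !ffunE ?mulgK ?mulgKV.
apply: eq_bigl => c; rewrite inE ffunE.
by rewrite -(inj_eq (mulIg a)) mulgKV mul1g.
Qed.

Definition pair_sum : int := \sum_g \sum_(h | (g * h == h * g)%g) chi g h.

(** Flat labellings correspond bijectively to a based gauge together with a commuting pair of [G],
    and the weight depends on the pair alone. *)
Lemma torus_sum d m (j : 'I_d.+1) :
  \sum_(w : {ffun torus d m -> G * G} | good (torq j w)) W (torq j w) =
  pair_sum *+ based_gauges d m.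
Proof.
pose h (p : {ffun torus d m -> G} * (G * G)) := gw j p.1 (model m j p.2.1 p.2.2).
pose nw (w : {ffun torus d m -> G * G}) := gw j (cinv (hol w)) w.
pose h' (w : {ffun torus d m -> G * G}) :=
  (hol w, ((nw w (ord_max, ord0)).1, (nw w (ord0, ord_max)).2)).
rewrite (eq_bigl (flat j)); last by move=> w; rewrite good_torq.
have hh' w : flat j w -> h (h' w) = w /\ ((h' w).2.1 * (h' w).2.2 = (h' w).2.2 * (h' w).2.1)%g.
  move=> fw; have fn : flat j (nw w) by rewrite flat_gw.
  have [E comm] := normalized_model fn (hol_normalized j w).
  by split=> //; rewrite /h /= -E gwK.
rewrite (reindex_onto h h') /= => [|w /hh'[]//].
have model_max g k : (model m j g k (ord_max, ord0)).1 = g.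
  by rewrite ffunE /= eqxx.
have model_max' g k : (model m j g k (ord0, ord_max)).2 = k.
  by rewrite ffunE /= eqxx add0n ltnNge -ltnS ltn_ord.
transitivity (\sum_(p : {ffun torus d m -> G} * (G * G) |
    (p.1 (tor0 d m) == 1%g) && (p.2.1 * p.2.2 == p.2.2 * p.2.1)%g) chi p.2.1 p.2.2).
  apply: eq_big => [[c [g k]]|[c [g k]]] /=; last first.
    case/andP => /hh'[_] + /eqP E; rewrite E /= => gk.
    by rewrite /h /= -regauge_torq W_torus.
  apply/andP/andP => [[/hh'[_ +] /eqP E]|[/eqP c0 /eqP gk]].
    rewrite E /= => ->; split=> //.
    by have := congr1 fst E; rewrite /= => <-; rewrite ffunE.
  have Hc : hol (h (c, (g, k))) = c by apply: hol_gw.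
  split; last by rewrite /h' /nw Hc /h /= gwVK model_max model_max'.
  by rewrite flat_gw flat_model.
rewrite -(pair_big_dep (fun c : {ffun torus d m -> G} => c (tor0 d m) == 1%g)
  (fun _ (p : G * G) => (p.1 * p.2 == p.2 * p.1)%g) (fun _ (p : G * G) => chi p.1 p.2)) /=.
rewrite sumr_const; congr (_ *+ _).
by rewrite -(pair_big_dep predT (fun g k => (g * k == k * g)%g) chi).
Qed.

Definition pairs_sum n : int := \sum_(q : lperm G 'I_n | good q) W q.

(** [n ^_ k] counts the injections of the torus and [d.+1] the twists, none of which affects the
    summand. The falling factorial vanishes for tori that are too large, so the sums carry no
    condition. *)
Lemma pairs_sum_rec n :
  pairs_sum n *+ n = \sum_(d < n) \sum_(m < n)
    (pair_sum *+ based_gauges d m * pairs_sum (n - d.+1 * m.+1)) *+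
      (n ^_ (d.+1 * m.+1) * d.+1).
Proof.
have := sum_pointed 'I_n; rewrite card_ord => ->.
apply: eq_bigr => d _; apply: eq_bigr => m _.
rewrite mulrnA -[X in _ = _ *+ X](card_ord d.+1) -sumr_const; apply: eq_bigr => j _.
rewrite (eq_bigr (fun=> pair_sum *+ based_gauges d m * pairs_sum (n - d.+1 * m.+1))).
  rewrite sumr_const; congr (_ *+ _).
  have := card_inj_ffuns (torus d m) 'I_n; rewrite card_prod !card_ord => <-.
  by apply: eq_card => psi; rewrite inE.
move=> psi /injectiveP pi; rewrite sum_eqv // torus_sum /pairs_sum card_ord.
by [].
Qed.

End Counting.

(** * Fixed points of commuting pairs in the wreath product *)

Lemma ptws_cont (Y : topologicalType) (I : Type) (X : topologicalType)
    (h : Y -> {ptws I -> X}) :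
  (forall i, continuous (fun y => h y i)) -> continuous h.
Proof.
move=> hc y; apply/cvg_sup => i.
have ci : continuous (h : Y -> initial_topology (fun x : I -> X => x i)).
  by apply: continuous_comp_initial; exact: hc.
exact: ci.
Qed.

Lemma ptws_proj_cont (I : eqType) (X : topologicalType) (i : I) :
  continuous (fun x : {ptws I -> X} => x i).
Proof. exact: (@proj_continuous I (fun=> X) i). Qed.

Lemma set_val_cont (U : topologicalType) (A : set U) :
  continuous (set_val : set_type A -> U).
Proof. exact: initial_continuous. Qed.

Lemma set_type_cont (Y U : topologicalType) (A : set U) (h : Y -> set_type A) :
  continuous (set_val \o h) -> continuous h.
Proof. exact: continuous_comp_initial. Qed.

Lemma has_euler_set (R : realType) (U U' : topologicalType) (A : set U) (B : set U')
    (f : U -> U') (g : U' -> U) e :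
  continuous f -> continuous g ->
  (forall x, A x -> B (f x) /\ g (f x) = x) ->
  (forall y, B y -> A (g y) /\ f (g y) = y) ->
  has_euler R (set_type A) e -> has_euler R (set_type B) e.
Proof.
move=> cf cg AB BA.
have fB (x : set_type A) : f (set_val x) \in B by rewrite inE; apply/(AB _ _).1/set_valP.
have gA (y : set_type B) : g (set_val y) \in A by rewrite inE; apply/(BA _ _).1/set_valP.
apply: (@has_euler_homeo R _ _ (fun x => SigSub (fB x) : set_type B)
   (fun y => SigSub (gA y) : set_type A)).
- apply: set_type_cont => x.
  by apply: (@continuous_comp _ _ _ set_val f); [exact: set_val_cont|exact: cf].
- apply: set_type_cont => x.
  by apply: (@continuous_comp _ _ _ set_val g); [exact: set_val_cont|exact: cg].
- by move=> x; apply: val_inj => /=; apply: (AB _ (set_valP x)).2.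
- by move=> x; apply: val_inj => /=; apply: (BA _ (set_valP x)).2.
Qed.

Lemma has_euler_setX (R : realType) (U V W : topologicalType) (A : set U) (B : set V)
    (C : set W) (p1 : W -> U) (p2 : W -> V) (m : U * V -> W) e e' :
  continuous p1 -> continuous p2 -> continuous m ->
  (forall w, C w -> [/\ A (p1 w), B (p2 w) & m (p1 w, p2 w) = w]) ->
  (forall u v, A u -> B v -> [/\ C (m (u, v)), p1 (m (u, v)) = u & p2 (m (u, v)) = v]) ->
  has_euler R (set_type A) e -> has_euler R (set_type B) e' ->
  has_euler R (set_type C) (e * e').
Proof.
move=> c1 c2 cm CAB ABC hA hB.
have p1A (w : set_type C) : p1 (set_val w) \in A.
  by rewrite inE; have [] := CAB _ (set_valP w).
have p2B (w : set_type C) : p2 (set_val w) \in B.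
  by rewrite inE; have [] := CAB _ (set_valP w).
have mC (p : (set_type A * set_type B)%type) : m (set_val p.1, set_val p.2) \in C.
  by rewrite inE; have [] := ABC _ _ (set_valP p.1) (set_valP p.2).
apply: (has_euler_homeo (f := fun p => SigSub (mC p) : set_type C)
  (g := fun w => (SigSub (p1A w) : set_type A, SigSub (p2B w) : set_type B)) _ _ _ _
  (has_euler_prod hA hB)).
- apply: set_type_cont => p.
  apply: (@continuous_comp _ _ _ (fun p : (set_type A * set_type B)%type =>
    (set_val p.1 : U, set_val p.2 : V)) m); last exact: cm.
  apply: pair_cont => q.
    by apply: (@continuous_comp _ _ _ fst set_val); [exact: fst_cont|exact: set_val_cont].
  by apply: (@continuous_comp _ _ _ snd set_val); [exact: snd_cont|exact: set_val_cont].
- apply: pair_cont; apply: set_type_cont => w.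
    by apply: (@continuous_comp _ _ _ set_val p1); [exact: set_val_cont|exact: c1].
  by apply: (@continuous_comp _ _ _ set_val p2); [exact: set_val_cont|exact: c2].
- move=> [u v]; have [_ E1 E2] := ABC _ _ (set_valP u) (set_valP v).
  by congr pair; apply: val_inj.
- move=> w; apply: val_inj => /=.
  by have [_ _ ->] := CAB _ (set_valP w).
Qed.

Section FixedSets.
Variables (R : realType) (G : finGroupType) (X : topologicalType) (to : left_action G X).
Hypothesis to_cont : forall g, continuous (to g).

Definition fixset (I : finType) (q : lperm G I) : set {ptws I -> X} :=
  [set x | forall i, x (q i).1.1 = to (q i).1.2 (x i) /\
                     x (q i).2.1 = to (q i).2.2 (x i)]%classic.

Definition fixsp (I : finType) (q : lperm G I) : topologicalType := set_type (fixset q).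

Lemma fixsp_pull (I J : finType) (f : I -> J) (g : J -> I) (q : lperm G J) e :
  cancel f g -> cancel g f -> has_euler R (fixsp q) e -> has_euler R (fixsp (pull f g q)) e.
Proof.
move=> fK gK.
apply: (has_euler_set (f := fun (x : {ptws J -> X}) => (x \o f : {ptws I -> X}))
  (g := fun (x : {ptws I -> X}) => (x \o g : {ptws J -> X}))).
- by apply: ptws_cont => i; apply: ptws_proj_cont.
- by apply: ptws_cont => i; apply: ptws_proj_cont.
- move=> x qx; split; last by apply/funext => j /=; rewrite gK.
  by move=> i; rewrite /pull !ffunE /= !gK; apply: qx.
move=> x qx; split; last by apply/funext => j /=; rewrite fK.
by move=> j /=; have := qx (g j); rewrite /pull ffunE /= !gK.
Qed.

Lemma lact_inv (g : G) x : to g^-1%g (to g x) = x.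
Proof. by rewrite -lactM mulVg lact1. Qed.

Lemma lact_invr (g : G) x : to g (to g^-1%g x) = x.
Proof. by rewrite -lactM mulgV lact1. Qed.

Lemma fixsp_regauge (I : finType) (c : {ffun I -> G}) (q : lperm G I) e :
  has_euler R (fixsp q) e -> has_euler R (fixsp (regauge c q)) e.
Proof.
apply: (has_euler_set (f := fun (x : {ptws I -> X}) => (fun i => to (c i) (x i)) : {ptws I -> X})
  (g := fun (x : {ptws I -> X}) => (fun i => to (c i)^-1%g (x i)) : {ptws I -> X})).
- apply: ptws_cont => i x; apply: continuous_comp; [exact: ptws_proj_cont|exact: to_cont].
- apply: ptws_cont => i x; apply: continuous_comp; [exact: ptws_proj_cont|exact: to_cont].
- move=> x qx; split; last by apply/funext => i; rewrite lact_inv.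
  by move=> i; rewrite /regauge ffunE /= !lactM !lact_inv; have [-> ->] := qx i.
move=> x qx; split; last by apply/funext => i; rewrite lact_invr.
by move=> i; have := qx i; rewrite /regauge ffunE /= !lactM => -[-> ->]; rewrite !lact_inv.
Qed.

Lemma fixsp_join (T C : finType) (q : lperm G T) (q' : lperm G C) e e' :
  has_euler R (fixsp q) e -> has_euler R (fixsp q') e' ->
  has_euler R (fixsp (join q q')) (e * e').
Proof.
apply: (has_euler_setX
  (p1 := fun (x : {ptws T + C -> X}) => (x \o inl) : {ptws T -> X})
  (p2 := fun (x : {ptws T + C -> X}) => (x \o inr) : {ptws C -> X})
  (m := fun p => (fun k => match k with inl x => p.1 x | inr y => p.2 y end) : {ptws T + C -> X})).
- by apply: ptws_cont => i; apply: ptws_proj_cont.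
- by apply: ptws_cont => i; apply: ptws_proj_cont.
- apply: ptws_cont => -[x|y] p.
    by apply: (@continuous_comp _ _ _ fst (fun u : {ptws T -> X} => u x));
      [exact: fst_cont|exact: ptws_proj_cont].
  by apply: (@continuous_comp _ _ _ snd (fun u : {ptws C -> X} => u y));
    [exact: snd_cont|exact: ptws_proj_cont].
- move=> x qx; split.
  + by move=> i; have := qx (inl i); rewrite /join ffunE.
  + by move=> i; have := qx (inr i); rewrite /join ffunE.
  + by apply/funext => -[].
move=> u v qu qv; split=> // -[x|y]; rewrite /join ffunE /=; [exact: qu|exact: qv].
Qed.

Lemma fixsp_empty (I : finType) (q : lperm G I) : #|I| = 0%N -> has_euler R (fixsp q) 1.
Proof.
move=> /card0_eq I0.
have noI (i : I) : False by have := I0 i.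
have x0 : fixset q (fun i => False_rect X (noI i)) by move=> i; case: (noI i).
have x0' := mem_set x0.
apply: (@has_euler_point R (fixsp q) (SigSub x0')) => y; apply: val_inj.
by apply/funext => i; case: (noI i).
Qed.

End FixedSets.

(** * Fixed sets of commuting pairs and the recurrence *)

Section WreathPairs.
Variables (R : realType) (G : finGroupType) (X : topologicalType) (to : left_action G X).
Hypothesis to_cont : forall g, continuous (to g).
Hypothesis to_fin : forall g h : G, (g * h = h * g)%g ->
  finite_homology R (fixed_space to g h).

(** Off the seams the labels are trivial and force a fixed point to be constant on the torus; across
    the seams its value is fixed by [g] and by [h]. Evaluation at the corner is the
    homeomorphism. *)
Lemma fixsp_model d m (j : 'I_d.+1) g h e :
  has_euler R (fixed_space to g h) e ->
  has_euler R (fixsp to (torq j (model m j g h))) e.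
Proof.
pose T := torus d m.
apply: (has_euler_set (f := fun y => (fun=> y) : {ptws T -> X})
  (g := fun x : {ptws T -> X} => x (tor0 d m))).
- by apply: ptws_cont => i y; apply: cvg_id.
- exact: ptws_proj_cont.
- move=> y [gy hy]; split=> // i; case: i => a b; do ?rewrite ffunE /=; split.
    by case: ifP => _; rewrite ?gy ?lact1.
  by case: ifP => _; [case: ifP => _|]; rewrite ?lactM ?hy ?gy ?lact1.
move=> x qx.
have qS a b : x (ordS a, b) = to (if a == ord_max then g else 1%g) (x (a, b)).
  by have := (qx (a, b)).1; do ?rewrite ffunE /=.
have qT a b : x (torT j (a, b)) = to (if b == ord_max
     then (if (d < a + j)%N then (g * h)%g else h) else 1%g) (x (a, b)).
  by have := (qx (a, b)).2; do ?rewrite ffunE /=.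
have x0 b : x (ord0, b) = x (ord0, ord0).
  case: b => b; elim: b => [|b IH] bm; first by congr (x (_, _)); apply: val_inj.
  have bm' : (Ordinal (ltnW bm) == ord_max :> 'I_m.+1) = false.
    by apply/negbTE; rewrite neq_max.
  rewrite -(IH (ltnW bm)); have := qT ord0 (Ordinal (ltnW bm)).
  rewrite /torT /= bm' lact1 => <-; congr (x (_, _)).
  by apply: val_inj; rewrite /= modn_small.
have xE a b : x (a, b) = x (ord0, ord0).
  rewrite -(x0 b); case: a => a; elim: a => [|a IH] ad.
    by congr (x (_, _)); apply: val_inj.
  have ad' : (Ordinal (ltnW ad) == ord_max :> 'I_d.+1) = false.
    by apply/negbTE; rewrite neq_max.
  rewrite -(IH (ltnW ad)); have := qS (Ordinal (ltnW ad)) b.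
  rewrite ad' lact1 => <-; congr (x (_, _)).
  by apply: val_inj; rewrite /= modn_small.
split; last by apply/funext => -[a b]; rewrite xE.
split.
  by have := qS ord_max ord0; rewrite eqxx !xE => <-.
have := qT ord0 ord_max; rewrite eqxx /torT /= eqxx !xE add0n => {2}->.
by rewrite ltnNge -ltnS ltn_ord.
Qed.

Lemma fixsp_torq d m (j : 'I_d.+1) (w : {ffun torus d m -> G * G}) :
  good (torq j w) -> exists e, has_euler R (fixsp to (torq j w)) e.
Proof.
rewrite good_torq => fw; pose w' := gw j (cinv (hol w)) w.
have fw' : flat j w' by rewrite flat_gw.
have [E comm] := normalized_model fw' (hol_normalized j w).
have h0 := finite_homology_euler (to_fin comm).
have := fixsp_regauge to_cont (hol w) (fixsp_model m j h0).
by rewrite regauge_torq -E gwK => h1; eexists; exact: h1.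
Qed.

(** Finiteness for an arbitrary pair, by induction on the number of points: the orbit of one point
    contributes a common fixed set of a commuting pair of [G] up to homeomorphism, and the rest is a
    smaller pair. *)
Lemma fixsp_euler (I : finType) (q : lperm G I) :
  good q -> has_euler R (fixsp to q) (euler_char R (fixsp to q)).
Proof.
move=> gq; suff [e he] : exists e, has_euler R (fixsp to q) e by rewrite (has_eulerP he).
have [n In] := ubnP #|I|; elim: n => // n IH in I q gq In *.
have [I0|/card_gt0P[i0 _]] := posnP #|I|; first by exists 1; apply: fixsp_empty.
have [si ti st uv] := goodP _ gq.
have [d [m [j [psi [pi _ pS pT]]]]] := orbit_param i0 si ti st.
have [f [g [fK gK fl]]] := inj_extend pi (erefl (#|I| - #|{: torus d m}|)%N).
pose q' := pull f g q.
have gq' : good q' by rewrite good_pull.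
have eq' : eqv j inl q'.
  apply/forallP => x; rewrite sp_pull tp_pull !fl.
  by rewrite -pS -pT -!fl !fK !eqxx.
have E := join_parts gq' eq'.
move: (gq'); rewrite -E good_join => /andP[gl gr].
have [e1 h1] := fixsp_torq gl.
have [|e2 h2] := IH _ _ gr.
  rewrite card_ord; apply: (@leq_trans #|I|); last by rewrite -ltnS.
  rewrite ltn_subrL.
  by apply/andP; split; apply/card_gt0P; [exists (tor0 d m)|exists i0].
exists (e1 * e2); rewrite -(pullK gK q) -/q' -E.
by apply: fixsp_pull => //; apply: fixsp_join.
Qed.

Definition fix_euler (I : finType) (q : lperm G I) : int := euler_char R (fixsp to q).

Lemma fix_euler_pull (I J : finType) (f : I -> J) (g : J -> I) (q : lperm G J) :
  cancel f g -> cancel g f -> good q -> fix_euler (pull f g q) = fix_euler q.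
Proof.
by move=> fK gK /fixsp_euler h; apply/has_eulerP/fixsp_pull.
Qed.

Lemma fix_euler_join (T C : finType) (q : lperm G T) (q' : lperm G C) :
  good q -> good q' -> fix_euler (join q q') = fix_euler q * fix_euler q'.
Proof.
by move=> /fixsp_euler h /fixsp_euler h'; apply/has_eulerP/fixsp_join.
Qed.

Lemma fix_euler_torus d m (j : 'I_d.+1) (c : {ffun torus d m -> G}) g h :
  (g * h = h * g)%g ->
  fix_euler (regauge c (torq j (model m j g h))) = euler_char R (fixed_space to g h).
Proof.
move=> gh; apply/has_eulerP/fixsp_regauge => //; apply/fixsp_model.
exact/finite_homology_euler/to_fin.
Qed.

Section Wreath.
Variable n : nat.
Implicit Types (p : wreath G n * wreath G n).

(** The element [(g, s)] moves coordinate [i] to place [s i] and applies [g] at the index [s i];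
    labels in an [lperm] sit at the source, hence the shift. *)
Definition enc p : lperm G 'I_n :=
  [ffun i => ((p.1.2 i, p.1.1 (p.1.2 i)), (p.2.2 i, p.2.1 (p.2.2 i)))].

(** The identity is the junk value when [f] is not injective. *)
Definition toperm (f : 'I_n -> 'I_n) : 'S_n :=
  insubd (1%g : {perm 'I_n}) [ffun i => f i].

Lemma topermE f : injective f -> toperm f =1 f.
Proof.
move=> fi i; rewrite -pvalE /toperm insubdK ?ffunE //.
by apply/injectiveP => x y; rewrite !ffunE => /fi.
Qed.

Definition dec (q : lperm G 'I_n) : wreath G n * wreath G n :=
  (([ffun i => su q ((toperm (sp q))^-1%g i)], toperm (sp q)),
   ([ffun i => tu q ((toperm (tp q))^-1%g i)], toperm (tp q))).

Lemma enc_dec q : good q -> enc (dec q) = q.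
Proof.
move=> /goodP[si ti _ _]; apply/ffunP => i; do ?rewrite ffunE /=.
rewrite !permK !topermE // /sp /su /tp /tu.
by case: (q i) => -[? ?] [].
Qed.

Lemma dec_enc p : dec (enc p) = p.
Proof.
case: p => -[f s] [g t]; rewrite /dec.
have -> : toperm (sp (enc ((f, s), (g, t)))) = s.
  by apply/permP => i; rewrite topermE => [|x y]; rewrite /sp !ffunE //= => /perm_inj.
have -> : toperm (tp (enc ((f, s), (g, t)))) = t.
  by apply/permP => i; rewrite topermE => [|x y]; rewrite /tp !ffunE //= => /perm_inj.
congr ((_, _), (_, _)); apply/ffunP => i; rewrite ffunE.
  by rewrite /su ffunE /= permKV.
by rewrite /tu ffunE /= permKV.
Qed.

Lemma good_enc p : good (enc p) = (p.1 * p.2 == p.2 * p.1)%g.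
Proof.
case: p => a b /=.
have sE i : sp (enc (a, b)) i = a.2 i by rewrite /sp ffunE.
have tE i : tp (enc (a, b)) i = b.2 i by rewrite /tp ffunE.
have uE i : su (enc (a, b)) i = a.1 (a.2 i) by rewrite /su ffunE.
have vE i : tu (enc (a, b)) i = b.1 (b.2 i) by rewrite /tu ffunE.
apply/goodP/eqP => [[_ _ st uv]|E].
  have ab : (b.2 * a.2 = a.2 * b.2)%g.
    by apply/permP => i; rewrite !permM; have := st i; rewrite !sE !tE.
  congr pair => //; apply/ffunP => i; rewrite !ffunE.
  have := uv ((b.2)^-1 ((a.2)^-1 i))%g; rewrite !(uE, vE, sE, tE) !permKV.
  have -> : (b.2)^-1%g ((a.2)^-1%g i) = (a.2)^-1%g ((b.2)^-1%g i).
    by rewrite -!permM -!invMg ab.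
  by rewrite !permKV.
have E1 := congr1 (fun c : wreath G n => c.1) E; have E2 := congr1 (fun c : wreath G n => c.2) E.
split.
- by move=> x y; rewrite !sE => /perm_inj.
- by move=> x y; rewrite !tE => /perm_inj.
- by move=> i; have /permP/(_ i) := E2; rewrite !(sE, tE) /= !permM.
move=> i; rewrite !(uE, vE, sE, tE).
have st : a.2 (b.2 i) = b.2 (a.2 i) by have /permP/(_ i) := E2; rewrite /= !permM.
have := congr1 (fun f : {ffun 'I_n -> G} => f (a.2 (b.2 i))) E1.
by rewrite /= !ffunE permK st permK.
Qed.

Lemma fixset_enc p : fixset to (enc p) = common_fixed (wreath_action to n) p.1 p.2.
Proof.
apply/seteqP; split=> x.
  move=> fx; split; apply/funext => i; rewrite /= /wreath_act.
    have [+ _] := fx ((p.1.2)^-1%g i); rewrite ffunE /= permKV => H; exact: esym H.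
  have [_] := fx ((p.2.2)^-1%g i); rewrite ffunE /= permKV => H; exact: esym H.
move=> [fa fb] i; rewrite ffunE /=; split.
  by rewrite -[in LHS]fa /= /wreath_act permK.
by rewrite -[in LHS]fb /= /wreath_act permK.
Qed.

Lemma pairs_sumE : pairs_sum fix_euler n =
  \sum_(a : wreath G n) \sum_(b : wreath G n | (a * b == b * a)%g)
    euler_char R (fixed_space (wreath_action to n) a b).
Proof.
rewrite /pairs_sum (reindex_onto enc dec) /= => [|q]; last exact: enc_dec.
rewrite pair_big_dep /=; apply: eq_big => [[a b]|[a b] _] /=.
  by rewrite dec_enc eqxx andbT good_enc.
by rewrite /fix_euler /fixsp fixset_enc.
Qed.

Lemma card_wreath : #|{: wreath G n}| = (#|G| ^ n * n`!)%N.
Proof.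
rewrite -[LHS]/(#|{: {ffun 'I_n -> G} * 'S_n}|) card_prod card_ffun card_ord.
by rewrite card_Sn.
Qed.

End Wreath.

Lemma orbifold_euler_wreath n :
  orbifold_euler R (wreath_action to n) =
  (pairs_sum fix_euler n)%:~R / (#|G| ^ n * n`!)%:R.
Proof.
rewrite /orbifold_euler mulrC pairs_sumE card_wreath; congr (_ / _).
rewrite rmorph_sum; apply: eq_bigr => a _; rewrite rmorph_sum.
by apply: eq_bigr.
Qed.

Lemma orbifold_euler_wreath0 : orbifold_euler R (wreath_action to 0) = 1.
Proof.
rewrite orbifold_euler_wreath fact0 expn0 muln1 divr1 /pairs_sum.
rewrite (big_pred1 [ffun i => ((i, 1%g), (i, 1%g))]) => [|q].
  have /has_eulerP E : has_euler R (fixsp to ([ffun i => ((i, 1%g), (i, 1%g))] : lperm G 'I_0)) 1.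
    by apply: fixsp_empty; rewrite card_ord.
  by rewrite /fix_euler E.
have -> : good q by apply/goodP; split=> [[]//|[]//|[]//|[]//].
by apply/esym/eqP/ffunP => -[].
Qed.

Lemma orbifold_eulerE : orbifold_euler R to =
  (pair_sum (fun g h => euler_char R (fixed_space to g h)))%:~R / #|G|%:R.
Proof.
rewrite /orbifold_euler mulrC; congr (_ / _).
rewrite rmorph_sum; apply: eq_bigr => a _; rewrite rmorph_sum.
by apply: eq_bigr.
Qed.

(** With [k] the size of the torus, [n! = n ^_ k * (n - k)!] and the number [|G| ^ k / |G|] of based
    gauges absorb the normalizations; the leftover [1 / |G|] turns [pair_sum] into the orbifold
    Euler characteristic of [X]. *)
Lemma orbifold_euler_rec n :
  orbifold_euler R (wreath_action to n) *+ n =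
  \sum_(d < n) \sum_(m < n | (d.+1 * m.+1 <= n)%N)
    (orbifold_euler R to * orbifold_euler R (wreath_action to (n - d.+1 * m.+1))) *+ d.+1.
Proof.
have rec := pairs_sum_rec fix_euler_pull fix_euler_join fix_euler_torus n.
rewrite orbifold_euler_wreath orbifold_eulerE -mulrnAl.
rewrite -[(_)%:~R *+ n]/(_) -rmorphMn /= rec rmorph_sum mulr_suml.
apply: eq_bigr => d _; rewrite rmorph_sum mulr_suml [RHS]big_mkcond.
apply: eq_bigr => m _; set k := (d.+1 * m.+1)%N; case: ifPn => [kn|]; last first.
  rewrite -ltnNge => kn; rewrite ffact_small // mul0n mulr0n rmorph0.
  exact: mul0r.
rewrite orbifold_euler_wreath.
have G0 : (#|G|%:R : rat) != 0 by rewrite pnatr_eq0 -lt0n; apply/card_gt0P; exists 1%g.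
have fn0 (i : nat) : (i`!%:R : rat) != 0 by rewrite pnatr_eq0 -lt0n fact_gt0.
have nE : (n`!%:R : rat) = (n ^_ k)%:R * (n - k)`!%:R by rewrite -natrM ffact_fact.
have ff0 : ((n ^_ k)%:R : rat) != 0.
  by have := fn0 n; rewrite nE mulf_eq0 negb_or => /andP[].
have NE : ((based_gauges G d m)%:R : rat) = #|G|%:R ^+ k / #|G|%:R.
  by rewrite -natrX -card_based_gauges natrM mulrC mulKf.
rewrite rmorphMn rmorphM rmorphMn /=; set A : rat := (pair_sum _)%:~R.
set B : rat := (pairs_sum _ _)%:~R.
rewrite -(mulr_natr A) -(mulr_natr (_ * B)) -[RHS]mulr_natr.
rewrite (natrM _ (n ^_ k)) (natrM _ (#|G| ^ n)) (natrM _ (#|G| ^ (n - k))) !natrX nE.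
have GE : (#|G|%:R : rat) ^+ n = #|G|%:R ^+ (n - k) * #|G|%:R ^+ k.
  by rewrite -exprD subnK.
rewrite GE NE.
set u := _ ^+ k; set v := _ ^+ (n - k)%N; set w := (n - k)`!%:R.
field.
by rewrite G0 ff0 fn0 !expf_neq0.
Qed.

End WreathPairs.

(** * Power series *)

Section PowerSeries.
Implicit Types f g h c : fps.

Let tr N f : {poly rat} := \poly_(i < N.+1) f i.

(** Coefficients up to [N] can be computed on truncations, so commutativity and associativity are
    inherited from polynomials. *)
Lemma fps_mul_poly N f g n : (n <= N)%N -> fps_mul f g n = (tr N f * tr N g)`_n.
Proof.
move=> nN; rewrite coefM; apply: eq_bigr => i _; rewrite !coef_poly.
have iN : (i <= N)%N by apply: leq_trans nN; rewrite -ltnS.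
by rewrite !ltnS iN (leq_trans (leq_subr _ _) nN).
Qed.

Lemma fps_mulC f g : fps_mul f g =1 fps_mul g f.
Proof. by move=> n; rewrite !(@fps_mul_poly n) // mulrC. Qed.

Lemma fps_mulA f g h : fps_mul f (fps_mul g h) =1 fps_mul (fps_mul f g) h.
Proof.
move=> n; transitivity ((tr n f * (tr n g * tr n h))`_n).
  rewrite coefM; apply: eq_bigr => i _; rewrite coef_poly ltn_ord.
  by rewrite (@fps_mul_poly n) // leq_subr.
rewrite mulrA coefM; apply: eq_bigr => i _.
rewrite -(@fps_mul_poly n) ?coef_poly; last by rewrite -ltnS.
by rewrite ltnS leq_subr.
Qed.

(* [q f' = c f]: the coefficients of [c] are those of [q f' / f]. *)
Definition log_deriv c f := forall n, n%:R * f n = fps_mul c f n.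

Lemma log_deriv_mul c c' f g : log_deriv c f -> log_deriv c' g ->
  log_deriv (fun n => c n + c' n) (fps_mul f g).
Proof.
move=> cf cg n.
(* The Leibniz rule, from [n = i + (n - i)] in each term. *)
have E : n%:R * fps_mul f g n =
    fps_mul (fps_mul c f) g n + fps_mul f (fps_mul c' g) n.
  rewrite /fps_mul mulr_sumr -big_split /=; apply: eq_bigr => i _.
  have i_n : (i <= n)%N by rewrite -ltnS.
  rewrite -[\sum_(_ < _) _ * f _]cf -[\sum_(_ < _) _ * g _]cg natrB //.
  ring.
rewrite E -fps_mulA [X in _ + X](fps_mulA f c' g).
have -> : fps_mul (fps_mul f c') g n = fps_mul (fps_mul c' f) g n.
  by apply: eq_bigr => i _; rewrite (fps_mulC f c').
rewrite -fps_mulA -big_split; apply: eq_bigr => i _.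
by rewrite mulrDl.
Qed.

Lemma log_deriv_one : log_deriv (fun=> 0) fps_one.
Proof.
move=> n; rewrite /fps_mul big1 => [|i _]; last by rewrite mul0r.
by case: n => [|n]; rewrite /fps_one ?mul0r ?mulr0.
Qed.

Lemma mult_sum r n (F : nat -> rat) : (0 < r)%N ->
  \sum_(i < n.+1 | (r %| i)%N && (0 < i)%N) F i =
  \sum_(m < n | (r * m.+1 <= n)%N) F (r * m.+1)%N.
Proof.
move=> r0.
transitivity (\sum_(i < n.+1 | (r %| i)%N && (0 < i)%N) \sum_(m < n | (r * m.+1 == i)%N) F i).
  apply: eq_bigr => i /andP[/dvdnP[k ik] i0].
  have k0 : (0 < k)%N by move: i0; rewrite ik muln_gt0 => /andP[].
  have kn : (k.-1 < n)%N.
    rewrite prednK //; have := ltn_ord i; rewrite ltnS; apply: leq_trans.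
    by rewrite ik leq_pmulr.
  rewrite (big_pred1 (Ordinal kn)) // => m; rewrite ik mulnC eqn_pmul2r //.
  by rewrite /= -[RHS]val_eqE /= -[RHS]eqSS prednK.
rewrite (exchange_big_dep (fun m : 'I_n => (r * m.+1 <= n)%N)) /=; last first.
  by move=> i m _ /eqP ->; rewrite -ltnS.
apply: eq_bigr => m mn; have mn' : (r * m.+1 < n.+1)%N by [].
rewrite (big_pred1 (Ordinal mn')) // => i; rewrite /= -[RHS]val_eqE /= eq_sym.
by case: eqP => [->|]; rewrite ?andbF // dvdn_mulr // muln_gt0 r0.
Qed.

Variable e : rat.

Let a k : rat := (-1) ^+ k * gbinom (- e) k.

(** Coefficientwise, [x f' = e (x / (1 - x)) f] for [f = (1 - x)^(-e)], obtained by summing the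
    ratio [aS] of consecutive coefficients. *)
Lemma binom_rec k : k%:R * a k = e * \sum_(i < k) a i.
Proof.
have aS i : i.+1%:R * a i.+1 = (e + i%:R) * a i.
  rewrite /a /gbinom big_ord_recr /= factS natrM.
  have i0 : (i.+1%:R : rat) != 0 by rewrite pnatr_eq0.
  have f0 : (i`!%:R : rat) != 0 by rewrite pnatr_eq0 -lt0n fact_gt0.
  rewrite exprS; field.
  by rewrite f0 nat1r.
elim: k => [|k IH]; first by rewrite big_ord0 mul0r mulr0.
by rewrite aS mulrDl IH big_ord_recr /= mulrDr addrC.
Qed.

(** Coefficients of [e r q^r / (1 - q^r)], the logarithmic derivative of [(1 - q^r)^(-e)] times [q];
    the guard removes the constant term, since [r] divides [0]. *)
Definition clog (r n : nat) : rat := if (r %| n)%N && (0 < n)%N then e *+ r else 0.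

Lemma fps_mul_clog r f n : (0 < r)%N ->
  fps_mul (clog r) f n = \sum_(m < n | (r * m.+1 <= n)%N) (e * f (n - r * m.+1)%N) *+ r.
Proof.
move=> r0; rewrite -(@mult_sum _ _ (fun i => (e * f (n - i)%N) *+ r)) // [RHS]big_mkcond.
apply: eq_bigr => i _; rewrite /clog; case: ifP => _; last by rewrite mul0r.
by rewrite mulrnAl.
Qed.

Lemma log_deriv_pow r : (0 < r)%N -> log_deriv (clog r) (one_minus_qr_pow r (- e)).
Proof.
move=> r0 n; rewrite fps_mul_clog // /one_minus_qr_pow.
case: ifPn => [/dvdnP[k ->]|rn]; last first.
  rewrite mulr0 big1 // => m mn; rewrite dvdn_subl ?dvdn_mulr //.
  by rewrite (negbTE rn) mulr0 mul0rn.
rewrite mulnK // -/(a k).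
transitivity (\sum_(m < k) (e * a (k - m.+1)) *+ r).
  rewrite natrM -mulrA [_ * a k]mulrC mulrA binom_rec mulr_natr sumrMnl.
  by rewrite mulr_sumr (reindex_inj rev_ord_inj).
have kr : (k <= k * r)%N by rewrite leq_pmulr.
rewrite (big_ord_widen _ (fun m => (e * a (k - m.+1)) *+ r) kr).
apply: eq_big => [m|m mk]; first by rewrite (mulnC r m.+1) leq_pmul2r.
rewrite [(r * _)%N]mulnC -mulnBl dvdn_mull // mulnK //.
Qed.

Lemma log_deriv_prod M :
  log_deriv (fun n => \sum_(0 <= i < M) clog i.+1 n)
    (\big[fps_mul/fps_one]_(1 <= r < M.+1) one_minus_qr_pow r (- e)).
Proof.
rewrite big_add1 /= /index_iota; elim: (iota _ _) => [|i s IH].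
  rewrite big_nil => n; rewrite log_deriv_one.
  by apply: eq_bigr => i _; rewrite big_nil.
have := log_deriv_mul (@log_deriv_pow i.+1 isT) IH.
rewrite big_cons => E n; rewrite E; apply: eq_bigr => k _.
by rewrite big_cons.
Qed.

Lemma prod_coef0 M :
  (\big[fps_mul/fps_one]_(1 <= r < M.+1) one_minus_qr_pow r (- e)) 0%N = 1.
Proof.
rewrite big_add1; elim: (index_iota _ _) => [|i s IH]; first by rewrite big_nil.
rewrite big_cons /fps_mul big_ord1 IH mulr1 /one_minus_qr_pow dvdn0 div0n.
by rewrite /gbinom big_ord0 expr0 mul1r fact0 divr1.
Qed.

(** The product of the first [M] factors obeys the recurrence of [f] in all degrees up to [M],
    because a factor with [r > n] adds nothing in degree [n] to the logarithmic derivative.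
    Coefficient [n] is therefore stationary from [M = n] on. *)
Lemma euler_product f : f 0%N = 1 ->
  (forall n, f n *+ n = \sum_(d < n) \sum_(m < n | (d.+1 * m.+1 <= n)%N)
     (e * f (n - d.+1 * m.+1)%N) *+ d.+1) ->
  fps_infinite_prod (fun r => one_minus_qr_pow r (- e)) f.
Proof.
move=> f0 frec n; exists n => M nM.
elim/ltn_ind: n nM => n IH nM.
set P := \big[_/_]_(_ <= _ < _) _ in IH *.
case: (posnP n) => [->|n0]; first by rewrite f0 /P prod_coef0.
have nn0 : (n%:R : rat) != 0 by rewrite pnatr_eq0 -lt0n.
apply: (mulfI nn0); rewrite [in RHS]mulrC mulr_natr frec.
rewrite (@log_deriv_prod M n) -/P /fps_mul.
under eq_bigr => i _ do rewrite mulr_suml.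
rewrite exchange_big /= big_mkord.
rewrite (big_ord_widen M (fun d => \sum_(m < n | (d.+1 * m.+1 <= n)%N)
     (e * f (n - d.+1 * m.+1)%N) *+ d.+1)) // [RHS]big_mkcond /=.
apply: eq_bigr => d _; rewrite -[LHS]/(fps_mul (clog d.+1) P n) fps_mul_clog //.
case: ifPn => [dn|]; last first.
  rewrite -leqNgt => nd; apply: big1 => m mn.
  by have := leq_trans (@leq_pmulr d.+1 m.+1 isT) mn; rewrite ltnNge nd.
apply: eq_bigr => m mn; rewrite IH //.
  by rewrite ltn_subrL n0.
exact: leq_trans (leq_subr _ _) nM.
Qed.

End PowerSeries.

Theorem theorem5 (R : realType) (d : nat) (G : finGroupType)
    (X : smoothManifold R d) (to : left_action G X)
    (to_smooth : forall g : G, smooth_map (to g))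
    (to_fin : forall g h : G, (g * h = h * g)%g ->
       finite_homology R (fixed_space to g h)) :
  fps_infinite_prod
    (fun r => one_minus_qr_pow r (- orbifold_euler R to))
    (fun n => orbifold_euler R (wreath_action to n)).
Proof.
have to_cont g : continuous (to g) by exact: (to_smooth g).1.
apply: euler_product => [|n]; first exact: orbifold_euler_wreath0.
exact: orbifold_euler_rec.
Qed.
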